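(* Let $n\ge 1$ be an integer and let $(\mathbb{H}^n,g)$ be real hyperbolic $n$-space. There is a constant $C$, depending only on $n$, such that for every smooth vector field $f$ on $\mathbb{H}^n$ with $\operatorname{div}_g f=0$ and every compactly supported smooth vector field $\phi$ on $\mathbb{H}^n$, $$\left|\int_{\mathbb{H}^n}\langle f,\phi\rangle_g\,dV_g\right|\le C\,\|f\|_{L^1(\mathbb{H}^n)}\,\|\nabla_g\phi\|_{L^n(\mathbb{H}^n)}.$$
   Context: $\mathbb{H}^n$ is the upper half space $\{x=(x',x_n)\in\mathbb{R}^{n-1}\times\mathbb{R}: x_n>0\}$ with the Riemannian metric $g=|dx|^2/x_n^2$. $\operatorname{div}_g$ is the divergence, $\langle\cdot,\cdot\rangle_g$ the pointwise inner product, $|\cdot|_g$ the pointwise norm (of vectors and tensors) and $dV_g=dx/x_n^n$ the volume measure, all with respect to $g$. For a vector field $\phi$, $\nabla_g\phi$ is the $(1,1)$ tensor given by the Levi-Civita covariant derivative of $\phi$. The norms are $\|f\|_{L^1(\mathbb{H}^n)}=\int_{\mathbb{H}^n}|f|_g\,dV_g$ and $\|\nabla_g\phi\|_{L^n(\mathbb{H}^n)}=\left(\int_{\mathbb{H}^n}|\nabla_g\phi|_g^n\,dV_g\right)^{1/n}$. The field $f$ is not assumed integrable: norms take values in $[0,\infty]$, with the convention $0\cdot\infty=0$ on the right-hand side. *)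

(* Defs.v *)
From HB Require Import structures.
From mathcomp Require Import all_boot all_order all_algebra.
From mathcomp Require Import all_classical all_reals all_analysis.

Set Implicit Arguments.
Unset Strict Implicit.
Unset Printing Implicit Defensive.

Import Order.TTheory GRing.Theory Num.Theory.
Import numFieldNormedType.Exports.

Local Open Scope classical_set_scope.
Local Open Scope ring_scope.

(* n-dimensional Lebesgue measure on n.-tuple R: the point mass for n = 0,
   then the image of the product measure under (a, t) |-> a :: t. *)

Section leb_step.
Context (R : realType) (n : nat).
Variable mu : {sigma_finite_measure set (n.-tuple (measurableTypeR R)) -> \bar R}.

Definition tuple_cons (p : measurableTypeR R * n.-tuple (measurableTypeR R)) :
    n.+1.-tuple (measurableTypeR R) := [tuple of p.1 :: p.2].

Definition tuple_uncons (t : n.+1.-tuple (measurableTypeR R)) :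
    measurableTypeR R * n.-tuple (measurableTypeR R) :=
  (thead t, [tuple of behead t]).

Lemma measurable_tuple_cons : measurable_fun [set: _] tuple_cons.
Proof. exact: measurable_cons. Qed.

Lemma measurable_tuple_uncons : measurable_fun [set: _] tuple_uncons.
Proof.
by apply: measurable_fun_pair; [exact: measurable_tnth|exact: measurable_behead].
Qed.

Lemma tuple_consK : cancel tuple_cons tuple_uncons.
Proof.
by case=> a t; rewrite /tuple_uncons theadE; congr (_, _); exact: val_inj.
Qed.

Definition leb_step : set (n.+1.-tuple (measurableTypeR R)) -> \bar R :=
  pushforward (@lebesgue_measure R \x mu)%E tuple_cons.

Let leb_step0 : leb_step set0 = 0%E.
Proof. by rewrite /leb_step /pushforward preimage_set0 measure0. Qed.

Let leb_step_ge0 A : (0 <= leb_step A)%E.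
Proof. by rewrite /leb_step /pushforward measure_ge0. Qed.

Let leb_step_additive : semi_sigma_additive leb_step.
Proof.
move=> F mF tF mUF; rewrite /leb_step /pushforward preimage_bigcup.
have mc A : measurable A -> measurable (tuple_cons @^-1` A).
  by move=> mA; rewrite -[X in measurable X]setTI; exact: measurable_tuple_cons.
apply: measure_semi_sigma_additive.
- by move=> k; exact: mc.
- apply/trivIsetP => i j _ _ ij; rewrite -preimage_setI.
  by move/trivIsetP : tF => -> //; rewrite preimage_set0.
- by rewrite -preimage_bigcup; exact: mc.
Qed.

HB.instance Definition _ := isMeasure.Build _ _ _ leb_step
  leb_step0 leb_step_ge0 leb_step_additive.

Let leb_step_sigma_finite : sigma_finite setT leb_step.
Proof.
have /sigma_finiteP[F [FT ndF Foo]] := sigma_finiteT (@lebesgue_measure R).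
have /sigma_finiteP[G [GT ndG Goo]] := sigma_finiteT mu.
exists (fun k => tuple_uncons @^-1` (F k `*` G k)).
  apply/esym; rewrite -subTset => t _.
  have [i _ Fi] : (\bigcup_i F i) (thead t) by rewrite -FT.
  have [j _ Gj] : (\bigcup_i G i) [tuple of behead t] by rewrite -GT.
  exists (maxn i j) => //; split => /=.
    by move: Fi; exact/subsetPset/ndF/leq_maxl.
  by move: Gj; exact/subsetPset/ndG/leq_maxr.
move=> k; have [mF Fk] := Foo k; have [mG Gk] := Goo k; split.
  rewrite -[X in measurable X]setTI; apply: measurable_tuple_uncons => //.
  exact: measurableX.
rewrite /leb_step /pushforward.
rewrite (_ : tuple_cons @^-1` _ = F k `*` G k).
  by rewrite product_measure1E// lte_mul_pinfty// ge0_fin_numE.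
rewrite -comp_preimage (_ : _ \o _ = id) //.
by apply/funext => x /=; rewrite tuple_consK.
Qed.

HB.instance Definition _ := Measure_isSigmaFinite.Build _ _ _ leb_step
  leb_step_sigma_finite.

End leb_step.

Fixpoint lebesgue_tuple (R : realType) (n : nat) :
    {sigma_finite_measure set (n.-tuple (measurableTypeR R)) -> \bar R} :=
  match n with
  | 0 => [the {sigma_finite_measure set (0.-tuple (measurableTypeR R)) -> \bar R}
            of \d_ ([tuple] : 0.-tuple (measurableTypeR R))]
  | m.+1 => [the {sigma_finite_measure
                   set (m.+1.-tuple (measurableTypeR R)) -> \bar R}
               of leb_step (lebesgue_tuple R m)]
  end.

Section smooth.
Context (R : realType) (n : nat) (V : normedModType R).
Implicit Types (U : set 'rV[R]_n) (f : 'rV[R]_n -> V) (x : 'rV[R]_n).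

Definition partial (i : 'I_n) f x : V := 'D_(delta_mx 0 i) f x.

Fixpoint Ck (k : nat) U f : Prop :=
  match k with
  | 0 => forall x, U x -> {for x, continuous f}
  | m.+1 => (forall x, U x -> forall i, derivable f x (delta_mx 0 i)) /\
            (forall i, Ck m U (partial i f))
  end.

(* Only the values of f near points of U matter when U is open. *)
Definition smooth_on U f : Prop := forall k, Ck k U f.

End smooth.

(* A metric is given on (an open set of) R^n by its Gram matrix g_ij in the
   coordinate frame; vector fields are row vectors of coordinate components. *)
Section riemannian.
Context (R : realType) (n : nat).
Variable g : 'rV[R]_n -> 'M[R]_n.
Implicit Types (x u v : 'rV[R]_n) (X : 'rV[R]_n -> 'rV[R]_n) (T : 'M[R]_n).

Definition ginner x u v : R := \sum_i \sum_j g x i j * u 0 i * v 0 j.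

Definition gnorm x v : R := Num.sqrt (ginner x v v).

Definition christoffel (k i j : 'I_n) x : R :=
  2^-1 * \sum_l invmx (g x) k l *
    (partial i (fun y => g y j l) x + partial j (fun y => g y i l) x
     - partial l (fun y => g y i j) x).

(* Row k, column i: the component T^k_i = dx^k (nabla_i X). *)
Definition nabla X x : 'M[R]_n :=
  \matrix_(k, i) (partial i (fun y => X y 0 k) x
                  + \sum_j christoffel k i j x * X x 0 j).

Definition gdiv X x : R := \tr (nabla X x).

Definition gnorm11 x T : R :=
  Num.sqrt (\sum_k \sum_l \sum_i \sum_j
              g x k l * invmx (g x) i j * T k i * T l j).

End riemannian.

(* Hyperbolic space of dimension n.+1; the last coordinate has index ord_max. *)
Section hyperbolic.
Context (R : realType) (n : nat).
Implicit Types (x : 'rV[R]_n.+1) (X : 'rV[R]_n.+1 -> 'rV[R]_n.+1).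

Definition upper_half : set 'rV[R]_n.+1 := [set x | 0 < x 0 ord_max].

Definition hyp_metric x : 'M[R]_n.+1 := ((x 0 ord_max) ^- 2)%:M.

(* The support is the closure relative to the half space. *)
Definition compactly_supported X : Prop :=
  compact (upper_half `&` closure (upper_half `&` [set x | X x != 0])).

Definition row_of_tuple (t : n.+1.-tuple (measurableTypeR R)) : 'rV[R]_n.+1 :=
  \row_i (tnth t i : R).

(* Integral of F over the half space against dV_g = dx / x_n ^ dim. *)
Definition hyp_integral (F : 'rV[R]_n.+1 -> R) : \bar R :=
  (\int[lebesgue_tuple R n.+1]_(t in [set t | upper_half (row_of_tuple t)])
     (F (row_of_tuple t) / (row_of_tuple t 0 ord_max) ^+ n.+1)%:E)%E.

Definition hyp_L1norm X : \bar R := hyp_integral (fun x => gnorm hyp_metric x (X x)).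

Definition hyp_Lnorm_nabla X : \bar R :=
  poweR (hyp_integral (fun x => gnorm11 hyp_metric x (nabla hyp_metric X x)
                                ^+ n.+1))
        n.+1%:R^-1.

End hyperbolic.

(* Main.v *)
Require Import Defs.
From HB Require Import structures.
From mathcomp Require Import all_boot all_order all_algebra.
From mathcomp Require Import all_classical all_reals all_analysis.
From mathcomp Require Import measurable_realfun.
From mathcomp Require Import ring lra zify.

(** Let N = n + 1 be the dimension and let y be the last coordinate.  The fields
    F_j = f_j / y^N and u_k = phi_k / y, extended by zero to y <= 0, turn the claim into a
    Euclidean one: the F_j are divergence free in the Euclidean sense, the u_k are C^1 with
    compact support inside y > 0, and the left-hand side is the integral of
    sum_i F_i u_i / y.  The components of the covariant derivative of phi become
    y d_i u_k - delta_ki u_N + delta_kN u_i.  In particular y |d_N u_k| is at most the norm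
    of the covariant derivative, so Hardy's inequality ([hardy]) bounds u_k / y in L^N, and
    then every d_i u_k, by that norm ([slice_energy]; the case N = 1, where the slices below
    are points, is trivial).

    The core is an estimate on the slice x_i = t ([slice_estimate]).  Let A(t) be the
    integral of |F_i| / y over the slice, K the integral of sum_j |F_j| / y over the whole
    space, p a bound for the derivatives of u_i in the directions j <> i (and for |u_i| / y
    when i <> N), and mu the L^N norm of p on the slice.  The slice has dimension N - 1, so
    Morrey's inequality applies on it.  Let w range over the unit cube and replace u_i on
    the slice by its translate by tau^N w.
    - The error is at most C tau mu A(t) on average over w ([morrey_path],
      [cube_average]).
    - The translate, divided by y and extended constantly along x_i, is a test function Psi.
      As F is divergence free, the flux of F_i Psi through x_i = t differs from the flux
      through x_i = a by the integral of sum_(j <> i) F_j d_j Psi in between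
      ([slab_bound]).  Since F is integrable against 1 / y, some slices a carry arbitrarily
      little flux, with a tending to -oo, or to 0 if i = N ([slice_test_bound]).  On
      average over w this gives C tau^(1-N) mu K.
    For tau = beta / mu the sum is C (beta A(t) + beta^(1-N) K mu^N).  This is linear in
    the slice quantities A(t) and mu^N, so it can be integrated over t ([coordinate_estimate])
    and summed over i.  Taking beta^N to be the N-th power of the norm of the covariant
    derivative concludes.

    If f is not integrable, only the case of a vanishing covariant derivative has content:
    then the Hardy inequality with exponent 2 shows that phi vanishes almost everywhere
    ([pairing_zero]). *)

Set Implicit Arguments.
Unset Strict Implicit.
Unset Printing Implicit Defensive.
Import Order.TTheory GRing.Theory Num.Theory.
Import numFieldNormedType.Exports.
Local Open Scope classical_set_scope.
Local Open Scope ring_scope.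

(** * Lebesgue measure on row vectors *)

Section row_measurable.
Context (R : realType) (n : nat).

(** Row vectors and tuples are identified; [tup_of_row] is the inverse. *)
Definition row_of_tup (t : n.-tuple (measurableTypeR R)) : 'rV[R]_n :=
  \row_i (tnth t i : R).

Definition tup_of_row (x : 'rV[R]_n) : n.-tuple (measurableTypeR R) :=
  [tuple (x 0 i : measurableTypeR R) | i < n].

Lemma row_of_tupK : cancel row_of_tup tup_of_row.
Proof. by move=> t; apply: eq_from_tnth => i; rewrite tnth_mktuple mxE. Qed.

Lemma tup_of_rowK : cancel tup_of_row row_of_tup.
Proof. by move=> x; apply/rowP => i; rewrite mxE tnth_mktuple. Qed.

(** The sigma-algebra on row vectors transported from the product one on tuples; by
    [open_measurable_row] below it contains the open sets. *)
Definition row_measurable : set_system 'rV[R]_n :=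
  [set A | measurable (row_of_tup @^-1` A)].

Let row_measurable0 : row_measurable set0.
Proof. by rewrite /row_measurable/= preimage_set0. Qed.

Let row_measurableC A : row_measurable A -> row_measurable (~` A).
Proof. by rewrite /row_measurable/= preimage_setC; exact: measurableC. Qed.

Let row_measurable_bigcup (F : (set 'rV[R]_n)^nat) :
  (forall i, row_measurable (F i)) -> row_measurable (\bigcup_i (F i)).
Proof.
by move=> mF; rewrite /row_measurable/= preimage_bigcup; exact: bigcupT_measurable.
Qed.

HB.instance Definition _ := @isMeasurable.Build default_measure_display
  'rV[R]_n row_measurable row_measurable0 row_measurableC row_measurable_bigcup.

Lemma measurable_row_of_tup : measurable_fun setT row_of_tup.
Proof. by move=> _ A mA; rewrite setTI. Qed.

Lemma measurable_coord (i : 'I_n) :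
  measurable_fun setT (fun x : 'rV[R]_n => x 0 i).
Proof.
move=> _ A mA; rewrite setTI.
rewrite /measurable/= /row_measurable/=.
have := @measurable_tnth _ (measurableTypeR R) n i measurableT A mA.
rewrite setTI; congr measurable.
by apply/seteqP; split => t /=; rewrite mxE.
Qed.

Lemma measurable_rowP d (X : measurableType d) (g : X -> 'rV[R]_n) :
  (forall i, measurable_fun setT (fun x => g x 0 i)) -> measurable_fun setT g.
Proof.
move=> mg; have mt : measurable_fun setT (tup_of_row \o g).
  apply/measurable_fun_tnthP => i.
  rewrite (_ : _ \o _ = fun x => g x 0 i); first exact: mg.
  by apply/funext => x /=; rewrite tnth_mktuple.
move=> _ A mA; have := mt measurableT _ mA; rewrite !setTI.
congr measurable; apply/seteqP; split => x /=; by rewrite tup_of_rowK.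
Qed.

(** Lebesgue measure on row vectors. *)
Definition vol : set 'rV[R]_n -> \bar R :=
  pushforward (lebesgue_tuple R n) row_of_tup.

Let vol0 : vol set0 = 0%E.
Proof. by rewrite /vol /pushforward preimage_set0 measure0. Qed.

Let vol_ge0 A : (0 <= vol A)%E.
Proof. by rewrite /vol /pushforward measure_ge0. Qed.

Let vol_additive : semi_sigma_additive vol.
Proof.
move=> F mF tF mUF; rewrite /vol /pushforward preimage_bigcup.
apply: measure_semi_sigma_additive.
- by move=> k; exact: mF.
- apply/trivIsetP => i j _ _ ij; rewrite -preimage_setI.
  by move/trivIsetP : tF => -> //; rewrite preimage_set0.
- by rewrite -preimage_bigcup; exact: mUF.
Qed.

HB.instance Definition _ := isMeasure.Build _ _ _ vol vol0 vol_ge0 vol_additive.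

Let vol_sigma_finite : sigma_finite setT vol.
Proof.
have /sigma_finiteP[G [GT ndG Goo]] := sigma_finiteT (lebesgue_tuple R n).
exists (fun k => tup_of_row @^-1` (G k)).
  by rewrite -preimage_bigcup -GT preimage_setT.
move=> k; have [mG Gk] := Goo k; have E : row_of_tup @^-1` (tup_of_row @^-1` G k) = G k.
  by apply/seteqP; split => t /=; rewrite row_of_tupK.
by split; [rewrite /measurable/= /row_measurable/= E|rewrite /vol /pushforward E].
Qed.

HB.instance Definition _ := Measure_isSigmaFinite.Build _ _ _ vol
  vol_sigma_finite.

End row_measurable.
Arguments vol {R} n.
#[global] Hint Extern 0 (measurable_fun _ (fun x => fun_of_matrix x _ _)) =>
  solve [apply: measurable_coord] : core.

Section insert.
Context {R : realType} {n : nat}.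
Implicit Types (i : 'I_n.+1) (r : R) (z : 'rV[R]_n) (x : 'rV[R]_n.+1).

(** [ins i r z] inserts the coordinate r at position i into z, [del i x] forgets the i-th
    coordinate: z |-> ins i r z parametrizes the slice x_i = r. *)
Definition ins i r z : 'rV[R]_n.+1 := \row_j oapp (z 0) r (unlift i j).
Definition del i x : 'rV[R]_n := \row_k x 0 (lift i k).

Lemma ins_same i r z : (ins i r z) 0 i = r.
Proof. by rewrite mxE unlift_none. Qed.

Lemma ins_lift i r z k : (ins i r z) 0 (lift i k) = z 0 k.
Proof. by rewrite mxE liftK. Qed.

Lemma del_ins i r z : del i (ins i r z) = z.
Proof. by apply/rowP => k; rewrite mxE ins_lift. Qed.

Lemma measurable_ins d (X : measurableType d) i (f : X -> R) (g : X -> 'rV[R]_n) :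
  measurable_fun setT f -> measurable_fun setT g ->
  measurable_fun setT (fun p => ins i (f p) (g p)).
Proof.
move=> mf mg; apply: measurable_rowP => j; case: (unliftP i j) => [k|] ->.
  under eq_fun do rewrite ins_lift.
  by apply: (measurableT_comp (measurable_coord k)).
by under eq_fun do rewrite ins_same.
Qed.

Lemma measurable_del i : measurable_fun setT (del i).
Proof.
apply: measurable_rowP => j; under eq_fun do rewrite mxE.
exact: measurable_coord.
Qed.

End insert.

Lemma ins_ins {R : realType} {n} (i : 'I_n.+1) (r s : R) (w : 'rV[R]_n) :
  ins ord0 r (ins i s w) = ins (lift ord0 i) s (ins ord0 r w).
Proof.
apply/rowP => j; case: (unliftP (lift ord0 i) j) => [k|] ->; last first.
  by rewrite ins_lift !ins_same.
rewrite ins_lift; case: (unliftP ord0 k) => [k'|] ->; last first.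
  rewrite ins_same (_ : lift (lift ord0 i) ord0 = ord0) ?ins_same//.
  exact: val_inj.
rewrite ins_lift (_ : lift (lift ord0 i) (lift ord0 k') = lift ord0 (lift i k')).
  by rewrite !ins_lift.
apply: val_inj; rewrite /= /bump /=; lia.
Qed.

Section vol_ins.
Context (R : realType).
Local Notation leb := (@lebesgue_measure R).

Lemma measurable_ins2 n (i : 'I_n.+1) :
  measurable_fun setT (fun p : measurableTypeR R * 'rV[R]_n => ins i p.1 p.2).
Proof. exact: measurable_ins. Qed.

Lemma vol_ins0 n (A : set 'rV[R]_n.+1) : measurable A ->
  vol n.+1 A = (leb \x vol n)%E
    ((fun p : measurableTypeR R * 'rV[R]_n => ins ord0 p.1 p.2) @^-1` A).
Proof.
move=> mA; rewrite /vol /= /leb_step /pushforward /= /product_measure1.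
apply: eq_integral => r _ /=.
congr (lebesgue_tuple R n _); apply/seteqP; split => t; rewrite /xsection /= !inE /=.
  congr A; apply/rowP => j; rewrite !mxE; case: (unliftP ord0 j) => [k|] ->.
    by rewrite /= tnthS mxE.
  by rewrite /= tnth0.
congr A; apply/rowP => j; rewrite !mxE; case: (unliftP ord0 j) => [k|] ->.
  by rewrite /= tnthS mxE.
by rewrite /= tnth0.
Qed.

(** Lebesgue measure is the product of the i-th coordinate and the others, whichever i is:
    the definition gives i = 0, and Tonelli moves another coordinate to the front. *)
Lemma vol_ins n (i : 'I_n.+1) (A : set 'rV[R]_n.+1) : measurable A ->
  vol n.+1 A = (leb \x vol n)%E
    ((fun p : measurableTypeR R * 'rV[R]_n => ins i p.1 p.2) @^-1` A).
Proof.
elim: n i A => [|n IH] i A mA; first by rewrite (ord1 i); exact: vol_ins0.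
case: (unliftP ord0 i) => [i'|] ->; last exact: vol_ins0.
pose B : set ((measurableTypeR R * measurableTypeR R) * 'rV[R]_n) :=
  (fun p => ins ord0 p.1.1 (ins i' p.1.2 p.2)) @^-1` A.
have mB : measurable B.
  rewrite -[B]setTI; apply: measurable_ins => //.
    exact: (measurableT_comp measurable_fst measurable_fst).
  apply: measurable_ins => //.
  exact: (measurableT_comp measurable_snd measurable_fst).
have mh := @measurable_fun_xsection _ _ (measurableTypeR R * measurableTypeR R)%type
  'rV[R]_n R (vol n) B mB.
set h := (X in measurable_fun _ X) in mh.
transitivity (\int[leb]_r \int[leb]_s h (r, s))%E.
  rewrite (vol_ins0 mA) {1}/product_measure1; apply: eq_integral => r _ /=.
  rewrite (_ : xsection _ _ = (fun z => ins ord0 r z) @^-1` A); last first.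
    by apply/seteqP; split => z; rewrite /xsection /= inE.
  rewrite (IH i'); last first.
    rewrite -[X in measurable X]setTI; exact: measurable_ins.
  rewrite /product_measure1; apply: eq_integral => s _ /=; rewrite /h.
  congr (vol n _); apply/seteqP; split => z; by rewrite /xsection /= !inE.
rewrite (fubini_tonelli h mh); last by move=> p; exact: measure_ge0.
rewrite /product_measure1; apply: eq_integral => s _ /=.
rewrite [X in _ = vol _ X](_ : _ = (fun z => ins (lift ord0 i') s z) @^-1` A); last first.
  by apply/seteqP; split => z; rewrite /xsection /= inE.
rewrite vol_ins0; last first.
  rewrite -[X in measurable X]setTI; exact: measurable_ins.
rewrite /product_measure1; apply: eq_integral => r _ /=; rewrite /h.
congr (vol n _); apply/seteqP; split => z; by rewrite /xsection /= !inE /= /B /= ins_ins.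
Qed.

End vol_ins.

(** * Fubini along one coordinate, boxes, affine substitutions *)

Section tonelli.
Context {R : realType}.
Local Notation leb := (@lebesgue_measure R).
Variables (n : nat) (i : 'I_n.+1).

Let insp := fun p : measurableTypeR R * 'rV[R]_n => ins i p.1 p.2.

Section nonneg.
Variable G : 'rV[R]_n.+1 -> \bar R.
Hypotheses (mG : measurable_fun setT G) (G0 : forall x, (0 <= G x)%E).

Let mGi : measurable_fun setT (G \o insp).
Proof. apply: measurableT_comp => //; exact: measurable_ins2. Qed.

Lemma vol_pushforward_ins :
  (\int[vol n.+1]_x G x = \int[leb \x vol n]_p G (insp p))%E.
Proof.
transitivity (\int[pushforward (leb \x vol n)%E insp]_x G x)%E.
  apply: eq_measure_integral; first exact: measurable_ins2.
  by move=> mf A mA _; rewrite [LHS](vol_ins i mA).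
by rewrite (ge0_integral_pushforward (measurable_ins2 i)).
Qed.

Lemma tonelli_ins1 :
  (\int[vol n.+1]_x G x = \int[leb]_r \int[vol n]_z G (ins i r z))%E.
Proof.
by rewrite vol_pushforward_ins (fubini_tonelli1 (G \o insp))// => x; exact: G0.
Qed.

Lemma measurable_tonelli_ins1 :
  measurable_fun setT (fun r : R => \int[vol n]_z G (ins i r z))%E.
Proof. by apply: (measurable_fun_fubini_tonelli_F (G \o insp)) => // x; exact: G0. Qed.

End nonneg.

Section signed.
Variable G : 'rV[R]_n.+1 -> \bar R.
Hypothesis iG : (vol n.+1).-integrable setT G.

Let mG : measurable_fun setT G. Proof. exact: measurable_int iG. Qed.

Let iGi : (leb \x vol n)%E.-integrable setT (G \o insp).
Proof.
apply/integrableP; split.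
  apply: measurableT_comp => //; exact: measurable_ins2.
have /integrableP[_] := iG; rewrite vol_pushforward_ins//.
exact: measurableT_comp.
Qed.

Let vol_pushforward_ins_signed :
  (\int[vol n.+1]_x G x = \int[leb \x vol n]_p G (insp p))%E.
Proof.
transitivity (\int[pushforward (leb \x vol n)%E insp]_x G x)%E.
  apply: eq_measure_integral; first exact: measurable_ins2.
  by move=> mf A mA _; rewrite [LHS](vol_ins i mA).
by rewrite (integral_pushforward (measurable_ins2 i)).
Qed.

Lemma fubini_ins1 :
  (\int[vol n.+1]_x G x = \int[leb]_r \int[vol n]_z G (ins i r z))%E.
Proof. by rewrite vol_pushforward_ins_signed -(integral12_prod_meas1 iGi). Qed.

Lemma measurable_fubini_ins1 :
  measurable_fun setT (fun r : R => \int[vol n]_z G (ins i r z))%E.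
Proof. exact: (measurable_int _ (integrable_fubini_F iGi)). Qed.

Lemma fubini_ins2 :
  (\int[vol n.+1]_x G x = \int[vol n]_z \int[leb]_r G (ins i r z))%E.
Proof. by rewrite vol_pushforward_ins_signed -(integral21_prod_meas1 iGi). Qed.

End signed.
End tonelli.

Section box.
Context {R : realType}.
Local Notation leb := (@lebesgue_measure R).
Implicit Types (a b : R).

(** The cube with all coordinates in [a, b]. *)
Definition box n a b : set 'rV[R]_n := [set x | forall i, a <= x 0 i <= b].
Arguments box : clear implicits.

Lemma measurable_box n a b : measurable (box n a b).
Proof.
rewrite (_ : box n a b = \bigcap_(i in [set: 'I_n]) ((fun x => x 0 i) @^-1` `[a, b])).
  apply: fin_bigcap_measurable => // i _; rewrite -[X in measurable X]setTI.
  exact: (measurable_coord i).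
apply/seteqP; split => x /= xab i; first by move=> _; rewrite /= in_itv/=.
by have /= := xab i Logic.I; rewrite in_itv.
Qed.

Lemma vol_box n a b : a <= b -> vol n (box n a b) = ((b - a) ^+ n)%:E.
Proof.
move=> ab; elim: n => [|n IH].
  rewrite /vol /pushforward /= expr0 diracE mem_set//= => -[]//.
rewrite (vol_ins ord0)//; last exact: measurable_box.
rewrite (_ : _ @^-1` _ = (`[a, b]%classic : set (measurableTypeR R)) `*` box n a b).
  rewrite product_measure1E//; last exact: measurable_box.
  rewrite [X in (_ * X)%E]IH [X in (X * _)%E](lebesgue_measure_itv `[a, b]) /= lte_fin; case: ifPn => [_|].
    by rewrite -EFinB -EFinM exprS.
  by rewrite -leNgt => ba; rewrite (_ : b = a) ?subrr ?exprS ?mul0r ?mul0e//; lra.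
apply/seteqP; split => -[r z] /= H.
  split => [|k]; last by have := H (lift ord0 k); rewrite ins_lift.
  by have := H ord0; rewrite ins_same in_itv.
move=> j; case: (unliftP ord0 j) => [k|] ->; first by rewrite ins_lift; exact: H.2.
by rewrite ins_same; have := H.1; rewrite /= in_itv.
Qed.

Lemma bounded_box_integrable n (g : 'rV[R]_n -> R) (c L : R) :
  measurable_fun setT g -> (forall x, `|g x| <= c) ->
  (forall x, ~ box n (- L) L x -> g x = 0) ->
  (vol n).-integrable setT (EFin \o g).
Proof.
move=> mg gc g0; pose B := box n (- `|L|) `|L|.
have BL x : box n (- L) L x -> B x.
  move=> + i; move=> /(_ i); have := ler_norm L; lra.
rewrite (_ : EFin \o g = (EFin \o g) \_ B); last first.
  apply/funext => x; rewrite patchE; case: ifPn => //= /negP.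
  by rewrite inE => nB; rewrite g0// => /BL.
apply: ((integrable_mkcond (EFin \o g) (measurable_box (n:=n) _ _)).1).
apply: measurable_bounded_integrable.
- exact: measurable_box.
- rewrite /B [ltLHS]vol_box ?ltry//; have := normr_ge0 L; lra.
- exact: measurable_funTS.
- exists c; split; first exact: num_real.
  by move=> M cM x _ /=; apply: (le_trans (gc x)); exact: ltW.
Qed.

End box.
Arguments box {R} n a b _.

Section open_measurable.
Context {R : realType} {n : nat}.

(** Open cubes with rational centre and radius 1 / (k + 1), a countable base of the
    topology. *)
Let cube_ (q : 'rV[rat]_n) (k : nat) : set 'rV[R]_n :=
  [set y | forall i, `|ratr (q 0 i) - y 0 i| < k.+1%:R^-1].

Let measurable_cube_ q k : measurable (cube_ q k).
Proof.
rewrite (_ : cube_ q k = \bigcap_(i in [set: 'I_n]) ((fun x => x 0 i) @^-1`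
   (ball (ratr (q 0 i) : R) k.+1%:R^-1))).
  apply: fin_bigcap_measurable => // i _; rewrite -[X in measurable X]setTI.
  apply: (measurable_coord i) => //; exact: measurable_ball.
apply/seteqP; split => x /= xab i; first by move=> _; exact: xab.
exact: (xab i Logic.I).
Qed.

Lemma open_measurable_row (A : set 'rV[R]_n) : open A -> measurable A.
Proof.
move=> oA; pose S (m : nat) : set 'rV[R]_n :=
  if unpickle m is Some (q, k) then
    (if `[< cube_ q k `<=` A >] then cube_ q k else set0) else set0.
rewrite (_ : A = \bigcup_m S m).
  apply: bigcupT_measurable => m; rewrite /S; case: unpickle => [[q k]|//].
  case: asboolP => // _.
apply/seteqP; split => x; last first.
  by move=> [m _]; rewrite /S; case: unpickle => [[q k]|//]; case: asboolP => // + +; apply.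
move=> Ax; have /nbhs_ballP[e /= e0 eA] : nbhs x A by exact: open_nbhs_nbhs.
have [k ke] : exists k : nat, k.+1%:R^-1 < e / 2.
  have /ltr_add_invr[k] : (0 : R) < e / 2 by lra.
  by rewrite add0r => ?; exists k.
have kp : (0 : R) < k.+1%:R^-1 by rewrite invr_gt0.
have hq i : exists r : rat, ratr r \in `]x 0 i - k.+1%:R^-1, x 0 i + k.+1%:R^-1[.
  by apply: rat_in_itvoo; rewrite ltrD2l gtrN.
pose q : 'rV[rat]_n := \row_i projT1 (cid (hq i)).
have qx : cube_ q k x.
  move=> i; rewrite mxE; case: cid => r /=; rewrite in_itv /= => rx.
  rewrite ltr_norml; move: rx; set d := k.+1%:R^-1; lra.
exists (pickle (q, k)) => //; rewrite /S pickleK; case: asboolP => // -[].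
move=> y qy; apply: eA; split => // i0 i; rewrite (ord1 i0).
have := qx i; have := qy i; rewrite /ball/= !ltr_norml; move: ke; set d := k.+1%:R^-1; lra.
Qed.

Lemma continuous_measurable_row (U : set 'rV[R]_n) (f : 'rV[R]_n -> R) :
  open U -> (forall x, U x -> {for x, continuous f}) -> measurable_fun U f.
Proof.
move=> oU cf; apply: (measurability _ (RGenOpens.measurableE R)).
move=> _ [_ [a [b ->] <-]]; apply: open_measurable_row.
rewrite openE => x /= [Ux fx].
apply: filterI; first exact: open_nbhs_nbhs.
apply: (cf _ Ux); apply: open_nbhs_nbhs; split => //; exact: interval_open.
Qed.

Lemma continuous_measurable_rowT (f : 'rV[R]_n -> R) :
  continuous f -> measurable_fun setT f.
Proof.
by move=> cf; apply: continuous_measurable_row => [|x _]; [exact: openT|exact: cf].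
Qed.

End open_measurable.

Section affine.
Context {R : realType}.
Local Notation leb := (@lebesgue_measure R).

Lemma leb_affine (a c : R) (G : R -> \bar R) : 0 < c ->
  measurable_fun setT G -> (forall r, (0 <= G r)%E) ->
  (\int[leb]_r G (a - c * r)%R = (c^-1)%:E * \int[leb]_r G r)%E.
Proof.
move=> c0 mG G0.
pose h : measurableTypeR R -> measurableTypeR R := fun r => a - c * r.
have mh0 : @measurable_fun _ _ R R setT h.
  apply: (@measurable_funB _ _ _ _ (fun=> a)) => //.
have mh : measurable_fun setT h by exact: mh0.
have nc : 0 <= c by exact: ltW.
have E A : measurable A -> leb A = mscale (NngNum nc) (pushforward leb h) A.
  apply: lebesgue_measure_unique => _ [[x y] _ <-].
  rewrite /= /mscale /= /pushforward.
  rewrite (_ : _ @^-1` _ = `[(a - y) / c, (a - x) / c[%classic); last first.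
    apply/seteqP; split => r /=; rewrite !in_itv /= /h.
      by rewrite ler_pdivrMr// ltr_pdivlMr//; lra.
    by rewrite ler_pdivrMr// ltr_pdivlMr//; lra.
  rewrite !lebesgue_measure_itv/= !lte_fin ltr_pM2r ?invr_gt0// ltrD2l ltrN2.
  case: ifPn => _; last by rewrite mule0.
  by rewrite -!EFinD -EFinM; congr EFin; field; exact: lt0r_neq0.
rewrite [in RHS](eq_measure_integral _ (fun A mA _ => E mh A mA)).
rewrite ge0_integral_mscale//= muleA -EFinM mulVf ?lt0r_neq0// mul1e.
by rewrite (ge0_integral_pushforward mh).
Qed.

Lemma vol_affine n (a : 'rV[R]_n) (c : R) (G : 'rV[R]_n -> \bar R) : 0 < c ->
  measurable_fun setT G -> (forall r, (0 <= G r)%E) ->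
  (\int[vol n]_z G (a - c *: z)%R = (c ^- n)%:E * \int[vol n]_z G z)%E.
Proof.
move=> c0; elim: n a G => [|n IH] a G mG G0.
  rewrite expr0 invr1 mul1e; apply: eq_integral => z _; congr G.
  by apply/rowP; case.
have msub m (b : 'rV[R]_m) : measurable_fun setT (fun z : 'rV[R]_m => b - c *: z).
  apply: measurable_rowP => j; under eq_fun do rewrite !mxE.
  apply: (@measurable_funB _ _ _ _ (fun=> b 0 j)) => //.
  apply: (@measurable_funM _ _ _ _ (fun=> c)) => //; exact: measurable_coord.
rewrite (tonelli_ins1 ord0) //; last by apply: (measurableT_comp mG); exact: msub.
have E r z : a - c *: ins ord0 r z = ins ord0 (a 0 ord0 - c * r) (del ord0 a - c *: z).
  apply/rowP => j; case: (unliftP ord0 j) => [k|] ->; rewrite ?ins_lift ?ins_same !mxE.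
    by rewrite liftK /=.
  by rewrite unlift_none.
under eq_integral do under eq_integral do rewrite E.
transitivity (\int[leb]_r ((c ^- n)%:E * \int[vol n]_z G (ins ord0 (a 0 ord0 - c * r)%R z)))%E.
  apply: eq_integral => r _.
  rewrite (IH (del ord0 a) (fun z => G (ins ord0 (a 0 ord0 - c * r) z)))//.
  apply: (measurableT_comp mG); exact: measurable_ins.
have cn0 : 0 <= c ^- n by rewrite invr_ge0 exprn_ge0 ?ltW.
have mF := measurable_tonelli_ins1 ord0 mG G0.
rewrite ge0_integralZl//.
- rewrite (leb_affine (a 0 ord0) (G := fun r => (\int[vol n]_z G (ins ord0 r z))%E))//.
    rewrite muleA -EFinM (tonelli_ins1 ord0)//; congr (_%:E * _)%E.
    by rewrite -invfM exprSr.
  by move=> r; exact: integral_ge0.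
- apply: (measurableT_comp mF).
  by apply: (@measurable_funB _ _ _ _ (fun=> a 0 ord0)).
- by move=> r _; exact: integral_ge0.
Qed.

End affine.

(** * Derivatives along lines and paths *)

Section calculus.
Context {R : realType}.

Lemma line_quotient n (f : 'rV[R]_n -> R) (x v : 'rV[R]_n) (r : R) :
  (fun h : R => h^-1 *: (((fun s : R => f (x + s *: v)) \o shift r) (h *: 1) -
     (fun s : R => f (x + s *: v)) r)) =
  (fun h : R => h^-1 *: ((f \o shift (x + r *: v)) (h *: v) - f (x + r *: v))).
Proof.
apply/funext => h /=; congr (_ *: (f _ - _)).
by rewrite -[h *: 1]/(h * 1) mulr1 scalerDl addrCA addrA addrC addrA.
Qed.

Lemma is_derive_line n (f : 'rV[R]_n -> R) (x v : 'rV[R]_n) (r : R) :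
  derivable f (x + r *: v) v ->
  is_derive r 1 (fun s : R => f (x + s *: v)) ('D_v f (x + r *: v)).
Proof.
move=> df; split; first by rewrite /derivable line_quotient.
by rewrite /derive line_quotient.
Qed.

Lemma mvt0 (f df : R -> R) (s : R) : (forall r : R, is_derive r 1 f (df r)) ->
  exists2 t, `|t| <= `|s| & f s - f 0 = s * df t.
Proof.
move=> fdf.
have cf (a b : R) : {within `[a, b], continuous f}.
  apply: derivable_within_continuous => r _; exact: @ex_derive.
have [s0|s0] := leP 0 s.
  have [t /[!in_itv]/= ts E] := MVT_segment s0 (fun x _ => fdf x) (cf _ _).
  exists t; last by rewrite E subr0 mulrC.
  rewrite !ger0_norm//; lra.
have [t /[!in_itv]/= ts E] := MVT_segment (ltW s0) (fun x _ => fdf x) (cf _ _).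
exists t; last by rewrite -opprB E; ring.
rewrite !ler0_norm ?(ltW s0)//; lra.
Qed.

(** Directional derivative from continuous partial derivatives: the increment is split
    along the coordinate directions, each part being given by the mean value theorem. *)
Lemma is_derive_partial n (f : 'rV[R]_n -> R) (y w : 'rV[R]_n) :
  (forall x j, derivable f x (delta_mx 0 j)) ->
  (forall j, {for y, continuous (partial j f)}) ->
  is_derive y w f (\sum_j w 0 j * partial j f y).
Proof.
move=> df cf.
pose P (h : R) (k : nat) : 'rV[R]_n := \row_j (y 0 j + (if (j < k)%N then h * w 0 j else 0)).
have PS h (k : 'I_n) : P h k.+1 = P h k + (h * w 0 k) *: delta_mx 0 k.
  apply/rowP => j; rewrite !mxE eqxx /=.
  have -> : (j < k.+1)%N = (j == k) || (j < k)%N by rewrite ltnS leq_eqVlt.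
  by case: eqVneq => [->|jk]; rewrite ?ltnn /= ?mulr1 ?mulr0 ?addr0.
have step h (k : 'I_n) : exists2 t, `|t| <= `|h * w 0 k| &
   f (P h k.+1) - f (P h k) = (h * w 0 k) * partial k f (P h k + t *: delta_mx 0 k).
  rewrite PS.
  have [t th E] := @mvt0 (fun s => f (P h k + s *: delta_mx 0 k))
     (fun s => partial k f (P h k + s *: delta_mx 0 k)) (h * w 0 k)
     (fun r => is_derive_line (df _ _)).
  by exists t => //; rewrite -E scale0r addr0.
have tele h : f (y + h *: w) - f y = \sum_(k < n) (f (P h k.+1) - f (P h k)).
  rewrite -(big_mkord xpredT (fun k => f (P h k.+1) - f (P h k))) telescope_sumr//.
  congr (f _ - f _); apply/rowP => j; rewrite !mxE ?ltn_ord//.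
  by rewrite ltn0 addr0.
suff L : (fun h : R => h^-1 *: ((f \o shift y) (h *: w) - f y)) @ 0^' -->
   (\sum_j w 0 j * partial j f y).
  by split; [apply/cvg_ex; exists (\sum_j w 0 j * partial j f y)|exact/cvg_lim].
apply/cvgrPdist_le => e e0.
pose W := \sum_j `|w 0 j|.
have W0 : 0 <= W by apply: sumr_ge0.
pose e' := e / (W + 1).
have e'0 : 0 < e' by rewrite divr_gt0//; lra.
have : \forall x \near y, forall j : 'I_n, `|partial j f y - partial j f x| <= e'.
  apply: (@filter_forall _ _ (fun j x => `|partial j f y - partial j f x| <= e')
    (nbhs y) (nbhs_filter y)) => j.
  by have /cvgrPdist_le /(_ _ e'0) := cf j.
move=> /nbhs_ballP[d /= d0 dP].
near=> h.
have h0 : h != 0 by near: h; exact: nbhs_dnbhs_neq.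
have hd : `|h| * (2 * W + 1) < d.
  rewrite -ltr_pdivlMr; last by lra.
  near: h; apply: dnbhs0_lt; rewrite divr_gt0//; lra.
rewrite /= [h *: w + y]addrC tele scaler_sumr -sumrB.
apply: (le_trans (ler_norm_sum _ _ _)).
apply: (@le_trans _ _ (\sum_j `|w 0 j| * e')).
  apply: ler_sum => k _; have [t th ->] := step h k.
  rewrite /GRing.scale /= mulrA mulrA mulVf// mul1r -mulrBr normrM ler_wpM2l//.
  apply: dP; split => // i0 j; rewrite (ord1 i0) /ball /= !mxE.
  have Wj i : `|w 0 i| <= W.
    by rewrite /W (bigD1 i)//= lerDl sumr_ge0.
  set a := (if _ then _ else _); set b := t * _.
  have -> : y 0 j - (y 0 j + a + b) = - a - b by ring.
  apply: le_lt_trans (ler_normB _ _) _; rewrite normrN.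
  apply: le_lt_trans hd.
  have -> : `|h| * (2 * W + 1) = `|h| * W + `|h| * W + `|h| by ring.
  apply: ler_wpDr => //; apply: lerD.
    rewrite /a; case: ifP => _; last by rewrite normr0 mulr_ge0.
    by rewrite normrM ler_wpM2l.
  rewrite /b normrM; apply: le_trans (_ : `|t| <= _).
    by rewrite ler_piMr// normr_nat lern1 leq_b1.
  by apply: (le_trans th); rewrite normrM ler_wpM2l.
rewrite -mulr_suml -/W /e' mulrCA ler_piMr ?(ltW e0)// ler_pdivrMr; lra.
Unshelve. all: by end_near. Qed.

Lemma is_derive_path n (f : 'rV[R]_n -> R) (x w : 'rV[R]_n) (g : R -> R) (dg s : R) :
  (forall x j, derivable f x (delta_mx 0 j)) ->
  (forall j, continuous (partial j f)) ->
  is_derive s 1 g dg ->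
  is_derive s 1 (fun r => f (x + g r *: w))
    ((\sum_j w 0 j * partial j f (x + g s *: w)) * dg).
Proof.
move=> df cf gd.
have D := @is_derive_partial _ f (x + g s *: w) w df (fun j => cf j _).
have H1 : is_derive (g s) 1 (fun r => f (x + r *: w))
    (\sum_j w 0 j * partial j f (x + g s *: w)).
  rewrite -(@derive_val _ _ _ _ _ _ _ D); apply: is_derive_line.
  exact: (@ex_derive _ _ _ _ _ _ _ D).
exact: (@is_derive1_comp _ (fun r => f (x + r *: w)) g).
Qed.

End calculus.

(** * Functions of class C^1 *)

Section C1.
Context {R : realType} {n : nat}.
Implicit Types (U V : set 'rV[R]_n) (f g : 'rV[R]_n -> R) (x : 'rV[R]_n).

Lemma contM f g x : {for x, continuous f} -> {for x, continuous g} ->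
  {for x, continuous (fun y => f y * g y)}.
Proof. exact: continuousM. Qed.

Lemma contD f g x : {for x, continuous f} -> {for x, continuous g} ->
  {for x, continuous (fun y => f y + g y)}.
Proof. exact: continuousD. Qed.

Lemma contN f x : {for x, continuous f} -> {for x, continuous (fun y => - f y)}.
Proof. exact: continuousN. Qed.

Lemma contV f x : f x != 0 -> {for x, continuous f} ->
  {for x, continuous (fun y => (f y)^-1)}.
Proof. exact: continuousV. Qed.

(** Continuously differentiable on U: continuous, with continuous partial derivatives. *)
Definition C1on U f : Prop := Ck 0 U f /\ Ck 1 U f.

Lemma C1on_derivable U f x j : C1on U f -> U x -> derivable f x (delta_mx 0 j).
Proof. by move=> [_ [d _]] Ux; exact: d. Qed.

Lemma C1on_continuous U f x : C1on U f -> U x -> {for x, continuous f}.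
Proof. by move=> [c _] Ux; exact: c. Qed.

Lemma C1on_partial U f x j : C1on U f -> U x -> {for x, continuous (partial j f)}.
Proof. by move=> [_ [_ c]] Ux; exact: c. Qed.

Arguments C1on_derivable {U f x} j.
Arguments C1on_partial {U f x} j.

Lemma partial_near f g x j : (\forall y \near x, f y = g y) ->
  partial j f x = partial j g x.
Proof.
exact: near_eq_derive.
Qed.

Lemma derivable_near f g x j : (\forall y \near x, f y = g y) ->
  derivable f x (delta_mx 0 j) -> derivable g x (delta_mx 0 j).
Proof.
exact: near_eq_derivable.
Qed.

Lemma near_continuous (T : topologicalType) (f g : T -> R) (x : T) : (\forall y \near x, f y = g y) ->
  {for x, continuous f} -> {for x, continuous g}.
Proof.
move=> fg cf; have E : f x = g x by exact: (nbhs_singleton fg).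
rewrite /prop_for /continuous_at -E; apply: cvg_trans cf.
by apply: (@near_eq_cvg _ _ (nbhs x) (nbhs_filter x)); apply: filterS fg => y ->.
Qed.

Lemma C1on_eq U f g : open U -> (forall x, U x -> f x = g x) ->
  C1on U f -> C1on U g.
Proof.
move=> oU fg [cf [df pf]].
have N x : U x -> \forall y \near x, f y = g y.
  by move=> Ux; have := open_nbhs_nbhs (conj oU Ux); apply: filterS.
split; first by move=> x Ux; exact: near_continuous (N _ Ux) (cf _ Ux).
split; first by move=> x Ux j; exact: derivable_near (N _ Ux) (df _ Ux j).
move=> j x Ux; apply: near_continuous (pf j _ Ux).
have := open_nbhs_nbhs (conj oU Ux); apply: filterS => y Uy.
exact: partial_near (N _ Uy).
Qed.

Lemma C1onU U V f : C1on U f -> C1on V f -> C1on (U `|` V) f.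
Proof.
move=> [cU [dU pU]] [cV [dV pV]]; split; first by move=> x [/cU|/cV].
by split => [x [/dU|/dV]//|j x [/(pU j)|/(pV j)]].
Qed.

Lemma C1on_sub U V f : U `<=` V -> C1on V f -> C1on U f.
Proof.
move=> UV [cV [dV pV]]; split; first by move=> x /UV/cV.
by split => [x /UV/dV|j x /UV/(pV j)].
Qed.

Lemma C1on_cst U (c : R) : C1on U (fun=> c).
Proof.
split; first by move=> x _; exact: cst_continuous.
split; first by move=> x _ j; exact: derivable_cst.
move=> j x _; rewrite (_ : partial j _ = fun=> 0); first exact: cst_continuous.
by apply/funext => y; rewrite /partial derive_cst.
Qed.

Lemma partialM f g x j : derivable f x (delta_mx 0 j) ->
  derivable g x (delta_mx 0 j) ->
  partial j (fun y => f y * g y) x = f x * partial j g x + g x * partial j f x.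
Proof. by move=> df dg; rewrite /partial [LHS](deriveM df dg). Qed.

Lemma C1onM U f g : open U -> C1on U f -> C1on U g -> C1on U (fun x => f x * g x).
Proof.
move=> oU Cf Cg; split.
  by move=> x Ux; apply: contM; [exact: (C1on_continuous Cf Ux)|exact: (C1on_continuous Cg Ux)].
split.
  by move=> x Ux j; exact: (derivableM (C1on_derivable j Cf Ux) (C1on_derivable j Cg Ux)).
move=> j x Ux.
apply: (@near_continuous _ (fun x => f x * partial j g x + g x * partial j f x)).
  have := open_nbhs_nbhs (conj oU Ux); apply: filterS => y Uy.
  by rewrite partialM//; [exact: (C1on_derivable _ Cf Uy)|exact: (C1on_derivable _ Cg Uy)].
apply: contD; apply: contM.
- exact: (C1on_continuous Cf Ux).
- exact: (C1on_partial _ Cg Ux).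
- exact: (C1on_continuous Cg Ux).
- exact: (C1on_partial _ Cf Ux).
Qed.

Lemma partialV f x j : f x != 0 -> derivable f x (delta_mx 0 j) ->
  partial j (fun y => (f y)^-1) x = - (f x) ^- 2 * partial j f x.
Proof. by move=> f0 df; rewrite /partial [LHS](deriveV f0 df). Qed.

Lemma C1onV U f : open U -> (forall x, U x -> f x != 0) ->
  C1on U f -> C1on U (fun x => (f x)^-1).
Proof.
move=> oU f0 Cf; split.
  by move=> x Ux; apply: contV; [exact: f0|exact: (C1on_continuous Cf Ux)].
split.
  by move=> x Ux j; exact: (derivableV (f0 _ Ux) (C1on_derivable j Cf Ux)).
move=> j x Ux.
apply: (@near_continuous _ (fun x => (- (f x) ^- 2) * partial j f x)).
  have := open_nbhs_nbhs (conj oU Ux); apply: filterS => y Uy.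
  by rewrite partialV//; [exact: f0|exact: (C1on_derivable _ Cf Uy)].
apply: contM; last exact: (C1on_partial _ Cf Ux).
apply: (@contN (fun y => (f y ^+ 2)^-1)); apply: contV; first by rewrite expf_neq0// f0.
rewrite (_ : (fun x => f x ^+ 2) = (fun x => f x * f x)).
  by apply: contM; exact: (C1on_continuous Cf Ux).
by apply/funext => y; rewrite expr2.
Qed.

Lemma C1onX U f k : open U -> C1on U f -> C1on U (fun x => f x ^+ k).
Proof.
move=> oU Cf; elim: k => [|k IH].
  by under eq_fun do rewrite expr0; exact: C1on_cst.
by under eq_fun do rewrite exprS; exact: C1onM.
Qed.

Lemma is_derive_const_line f x v : (forall s, f (x + s *: v) = f x) ->
  is_derive x v f 0.
Proof.
move=> fc; have E : (fun h : R => h^-1 *: ((f \o shift x) (h *: v) - f x)) = fun=> 0.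
  by apply/funext => h /=; rewrite (addrC (h *: v)) fc subrr scaler0.
by split; [rewrite /derivable E; exact: is_cvg_cst|rewrite /derive E; exact: lim_cst].
Qed.

Lemma is_derive_subst m (f : 'rV[R]_m -> R) (A : 'rV[R]_n -> 'rV[R]_m) x v v' :
  (forall s, A (x + s *: v) = A x + s *: v') ->
  derivable f (A x) v' -> is_derive x v (f \o A) ('D_v' f (A x)).
Proof.
move=> Av df.
have E : (fun h : R => h^-1 *: (((f \o A) \o shift x) (h *: v) - (f \o A) x)) =
         (fun h : R => h^-1 *: ((f \o shift (A x)) (h *: v') - f (A x))).
  by apply/funext => h /=; rewrite (addrC (h *: v)) Av [A x + _]addrC.
by split; [rewrite /derivable E|rewrite /derive E].
Qed.

Lemma coord_line (i j : 'I_n) x (s : R) :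
  (x + s *: delta_mx 0 j) 0 i = x 0 i + s * (i == j)%:R.
Proof. by rewrite !mxE eqxx. Qed.

Lemma partial_coord (i j : 'I_n) x :
  is_derive x (delta_mx 0 j) (fun x : 'rV[R]_n => x 0 i) (i == j)%:R.
Proof.
have [->|ij] := eqVneq i j; last first.
  apply: is_derive_const_line => s.
  by rewrite coord_line (negPf ij) mulr0 addr0.
have E : (fun h : R => h^-1 *: (((fun x : 'rV[R]_n => x 0 j) \o shift x)
   (h *: delta_mx 0 j) - x 0 j)) @ 0^' --> (1 : R).
  apply: (@cvg_trans _ ((fun=> 1) @ 0^')); last exact: cvg_cst.
  apply: near_eq_cvg; near=> h => /=.
  rewrite (addrC (h *: _)) coord_line eqxx mulr1 addrAC subrr add0r.
  rewrite /GRing.scale /= mulVf//; near: h; exact: nbhs_dnbhs_neq.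
by split; [apply/cvg_ex; exists 1|apply/cvg_lim].
Unshelve. all: by end_near. Qed.

Lemma C1on_coord U i : C1on U (fun x => x 0 i).
Proof.
split; first by move=> x _; exact: coord_continuous.
split; first by move=> x _ j; exact: (@ex_derive _ _ _ _ _ _ _ (partial_coord i j x)).
move=> j x _; rewrite (_ : partial j _ = fun=> (i == j)%:R : R); first exact: cst_continuous.
by apply/funext => y; exact: (@derive_val _ _ _ _ _ _ _ (partial_coord i j y)).
Qed.

End C1.
Arguments C1on_derivable {R n U f x} j.
Arguments C1on_partial {R n U f x} j.

Section C1affine.
Context {R : realType} {n : nat}.

(** Substitution of an affine map that fixes each coordinate direction (j in P) or collapses
    it. *)
Lemma C1on_subst (U : set 'rV[R]_n) (f : 'rV[R]_n -> R)
    (A : 'rV[R]_n -> 'rV[R]_n) (P : pred 'I_n) :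
  (forall x j s, A (x + s *: delta_mx 0 j) =
     A x + (if P j then s *: delta_mx 0 j else 0)) ->
  continuous A -> open U -> C1on U f ->
  C1on (A @^-1` U) (f \o A) /\
  (forall x j, U (A x) ->
     partial j (f \o A) x = if P j then partial j f (A x) else 0).
Proof.
move=> AP cA oU Cf.
have D x j : U (A x) -> is_derive x (delta_mx 0 j) (f \o A)
     (if P j then partial j f (A x) else 0).
  move=> Ux; case: ifPn => Pj.
    apply: (@is_derive_subst _ _ _ f A x (delta_mx 0 j) (delta_mx 0 j)).
      by move=> s; rewrite AP Pj.
    exact: (C1on_derivable j Cf Ux).
  by apply: is_derive_const_line => s /=; rewrite AP (negPf Pj) addr0.
have E x j : U (A x) ->
     partial j (f \o A) x = if P j then partial j f (A x) else 0.
  by move=> /(D _ j) H; exact: (@derive_val _ _ _ _ _ _ _ H).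
split; last exact: E.
split; first by move=> x Ux; apply: continuous_comp; [exact: cA|exact: (C1on_continuous Cf Ux)].
split; first by move=> x Ux j; exact: (@ex_derive _ _ _ _ _ _ _ (D x j Ux)).
move=> j x Ux.
apply: (@near_continuous _ _ (fun x => if P j then partial j f (A x) else 0)).
  have N : \forall y \near x, U (A y) by exact: (cA x _ (open_nbhs_nbhs (conj oU Ux))).
  apply: filterS N => y Uy.
  by rewrite E.
case: (P j); last exact: cst_continuous.
apply: (@continuous_comp _ _ _ A (partial j f)); first exact: cA.
exact: (C1on_partial _ Cf Ux).
Qed.

End C1affine.

(** * Integration of a partial derivative *)

Section slab.
Context {R : realType} {n : nat}.
Local Notation leb := (@lebesgue_measure R).
Implicit Types (i j : 'I_n.+1) (G g : 'rV[R]_n.+1 -> R).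

Lemma ins_line j (s : R) (z : 'rV[R]_n) :
  ins j s z = ins j 0 z + s *: delta_mx 0 j.
Proof.
apply/rowP => k; rewrite coord_line; case: (unliftP j k) => [l|] ->.
  by rewrite !ins_lift eq_sym (negPf (neq_lift _ _)) mulr0 addr0.
by rewrite !ins_same eqxx mulr1 add0r.
Qed.

Lemma is_derive_ins G g j (r : R) (z : 'rV[R]_n) (d : R) :
  is_derive (ins j r z) (delta_mx 0 j) G d ->
  is_derive r 1 (fun s => G (ins j s z)) d.
Proof.
rewrite (ins_line j r) => -[dG dE].
rewrite (_ : (fun s => _) = (fun s => G (ins j 0 z + s *: delta_mx 0 j))); last first.
  by apply/funext => s; rewrite ins_line.
by rewrite -dE; exact: is_derive_line.
Qed.

Lemma FTC_line G g j (a b : R) (z : 'rV[R]_n) : a < b ->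
  (forall x : 'rV[R]_n.+1, a <= x 0 j <= b -> is_derive x (delta_mx 0 j) G (g x)) ->
  {within `[a, b], continuous (fun r => g (ins j r z))} ->
  (\int[leb]_(r in `[a, b]) (g (ins j r z))%:E =
     (G (ins j b z) - G (ins j a z))%:E)%E.
Proof.
move=> ab dG cg.
have D r : a <= r <= b -> is_derive r 1 (fun s => G (ins j s z)) (g (ins j r z)).
  by move=> rab; apply: is_derive_ins => //; apply: dG; rewrite ins_same.
have C r : a <= r <= b -> {for r, continuous (fun s => G (ins j s z))}.
  move=> /D H; apply: differentiable_continuous; apply/derivable1_diffP.
  exact: (@ex_derive _ _ _ _ _ _ _ H).
rewrite (@continuous_FTC2 _ _ (fun r => G (ins j r z)) a b)//.
- split.
  + move=> r; rewrite in_itv /= => rab.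
    have H : a <= r <= b by lra.
    exact: (@ex_derive _ _ _ _ _ _ _ (D r H)).
  + by apply: cvg_at_right_filter; apply: C; rewrite lexx ltW.
  + by apply: cvg_at_left_filter; apply: C; rewrite lexx ltW.
- move=> r; rewrite in_itv /= => rab; rewrite derive1E.
  have H : a <= r <= b by lra.
  exact: (@derive_val _ _ _ _ _ _ _ (D r H)).
Qed.

(** Fubini and the fundamental theorem of calculus on the slab a <= x_j <= b. *)
Lemma int_slab G g j (a b : R) : a < b ->
  (vol n.+1).-integrable setT
    (fun x : 'rV[R]_n.+1 => (if a <= x 0 j <= b then g x else 0)%:E) ->
  (forall x : 'rV[R]_n.+1, a <= x 0 j <= b -> is_derive x (delta_mx 0 j) G (g x)) ->
  (forall z, {within `[a, b], continuous (fun r => g (ins j r z))}) ->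
  (\int[vol n.+1]_x (if a <= x 0 j <= b then g x else 0)%:E =
   \int[vol n]_z (G (ins j b z) - G (ins j a z))%:E)%E.
Proof.
move=> ab ig dG cg; rewrite (fubini_ins2 j)//; apply: eq_integral => z _.
rewrite -(FTC_line (g := g) ab dG)// [RHS]integral_mkcond.
apply: eq_integral => r _; rewrite patchE ins_same.
by rewrite mem_setE in_itv /=; case: ifP.
Qed.

Lemma int_div0 G g j (L : R) : 0 < L ->
  (vol n.+1).-integrable setT (EFin \o g) ->
  (forall x : 'rV[R]_n.+1, is_derive x (delta_mx 0 j) G (g x)) ->
  (forall z, continuous (fun r => g (ins j r z))) ->
  (forall x : 'rV[R]_n.+1, L <= `|x 0 j| -> G x = 0) ->
  (forall x : 'rV[R]_n.+1, L < `|x 0 j| -> g x = 0) ->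
  (\int[vol n.+1]_x (g x)%:E = 0)%E.
Proof.
move=> L0 ig dG cg G0 g0.
have E x : g x = if - L <= x 0 j <= L then g x else 0.
  case: ifPn => // H; apply: g0; move: H; rewrite negb_and -!ltNge => H.
  by case/orP: H => H; [rewrite -normrN|]; apply: (lt_le_trans _ (ler_norm _)); lra.
under eq_integral do rewrite E.
rewrite (int_slab (G := G))//; last 3 first.
- lra.
- rewrite (_ : (fun x => _) = EFin \o g)//.
  by apply/funext => x /=; rewrite -E.
- by move=> z; exact: continuous_subspaceT.
apply: integral0_eq => z _; rewrite !G0 ?subrr// ins_same ?normrN ger0_norm//; lra.
Qed.

End slab.

(** * Flux of a divergence-free field between two slices *)

Lemma compact_bound {R : realType} n (K : set 'rV[R]_n) (f : 'rV[R]_n -> R) :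
  compact K -> (forall x, K x -> {for x, continuous f}) ->
  exists M, forall x, K x -> `|f x| <= M.
Proof.
move=> cK cf.
have cfK : {within K, continuous f}.
  by apply: continuous_in_subspaceT => x; rewrite inE => /cf.
have /compact_bounded[M [_ HM]] := continuous_compact cfK cK.
by exists (M + 1) => x Kx; apply: (HM (M + 1)); [rewrite ltrDl|exists x].
Qed.

Lemma compact_bound_fin {R : realType} n (I : finType) (K : set 'rV[R]_n)
    (f : I -> 'rV[R]_n -> R) :
  compact K -> (forall i x, K x -> {for x, continuous (f i)}) ->
  exists2 M, 0 <= M & forall i x, K x -> `|f i x| <= M.
Proof.
move=> cK cf; have /choice[M HM] i := compact_bound cK (cf i).
exists (\sum_i `|M i|); first exact: sumr_ge0.
move=> i x /(HM i) H; apply: (le_trans H); apply: (le_trans (ler_norm _)).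
by rewrite (bigD1 i)//= lerDl sumr_ge0.
Qed.

(** A compact box contained in the half space y >= c. *)
Definition halfbox {R : realType} n (L c : R) : set 'rV[R]_n.+1 :=
  [set x | (forall j, `|x 0 j| <= L) /\ c <= x 0 ord_max].

Lemma closed_coord_ge {R : realType} n (j : 'I_n) (c : R) :
  closed [set x : 'rV[R]_n | c <= x 0 j].
Proof.
have -> : [set x : 'rV[R]_n | c <= x 0 j] =
  (fun x : 'rV[R]_n => x 0 j) @^-1` [set r | c <= r] by [].
apply: closed_comp; last exact: closed_ge.
by move=> x _; exact: coord_continuous.
Qed.

Lemma closed_coord_le {R : realType} n (j : 'I_n) (c : R) :
  closed [set x : 'rV[R]_n | x 0 j <= c].
Proof.
have -> : [set x : 'rV[R]_n | x 0 j <= c] =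
  (fun x : 'rV[R]_n => x 0 j) @^-1` [set r | r <= c] by [].
apply: closed_comp; last exact: closed_le.
by move=> x _; exact: coord_continuous.
Qed.

Lemma halfbox_compact {R : realType} n (L c : R) : compact (@halfbox R n L c).
Proof.
have cI : forall i : 'I_n.+1, compact `[- L, L]%classic by move=> i; exact: segment_compact.
apply: (subclosed_compact _ (rV_compact cI)); last first.
  by move=> x [H _] i /=; rewrite in_itv /= -ler_norml.
rewrite (_ : halfbox _ _ = (\bigcap_(j in [set: 'I_n.+1])
   ([set x | - L <= x 0 j] `&` [set x | x 0 j <= L])) `&` [set x | c <= x 0 ord_max]).
  apply: closedI; last exact: closed_coord_ge.
  apply: closed_bigI => j _; apply: closedI; [exact: closed_coord_ge|exact: closed_coord_le].
apply/seteqP; split => x /= [H cx]; split => // j.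
  by move=> _; have := H j; rewrite ler_norml => /andP[].
by rewrite ler_norml; have [/= -> ->] := H j Logic.I.
Qed.

Lemma open_halfboxC {R : realType} n (L c : R) : open (~` @halfbox R n L c).
Proof.
apply: closed_openC; apply: compact_closed; first exact: norm_hausdorff.
exact: halfbox_compact.
Qed.

Lemma is_derive_eq_line {R : realType} n (f g : 'rV[R]_n -> R) (x v : 'rV[R]_n) (d : R) :
  (\forall s \near (0 : R), f (x + s *: v) = g (x + s *: v)) ->
  is_derive x v f d -> is_derive x v g d.
Proof.
move=> fg [df <-].
have E0 : f x = g x.
  by have := nbhs_singleton fg; rewrite /= scale0r addr0.
have E : (fun h : R => h^-1 *: ((f \o shift x) (h *: v) - f x)) @ 0^' =
         (fun h : R => h^-1 *: ((g \o shift x) (h *: v) - g x)) @ 0^'.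
  apply/seteqP; split; apply: near_eq_cvg; near=> h => /=.
    have -> : f (h *: v + x) = g (h *: v + x).
      by rewrite addrC; near: h; exact: cvg_within fg.
    by rewrite E0.
  have -> : f (h *: v + x) = g (h *: v + x).
    by rewrite addrC; near: h; exact: cvg_within fg.
  by rewrite E0.
by split; [rewrite /derivable -E|rewrite /derive -E].
Unshelve. all: by end_near. Qed.

Lemma continuous_ins {R : realType} n (j : 'I_n.+1) (z : 'rV[R]_n) :
  continuous (fun r => ins j r z).
Proof.
move=> r; rewrite (_ : (fun r => _) = (fun s => ins j 0 z + s *: delta_mx 0 j)).
  apply: cvgD; first exact: cvg_cst.
  by apply: cvgZr_tmp; exact: cvg_id.
by apply/funext => s; rewrite ins_line.
Qed.

(** A field F with pointwise partial derivatives dF_j = d_j F_j and zero divergence on the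
    half space, vanishing for y <= 0; no regularity is required at y = 0.  The test function
    Psi does not depend on x_i, and its support in the slab a <= x_i <= t is compact in
    y > 0. *)
Section slab_bound.
Context {R : realType} {n : nat}.
Variables (i : 'I_n.+1) (F dF : 'I_n.+1 -> 'rV[R]_n.+1 -> R).
Hypotheses (F0 : forall j (x : 'rV[R]_n.+1), x 0 ord_max <= 0 -> F j x = 0)
  (dF0 : forall j (x : 'rV[R]_n.+1), x 0 ord_max <= 0 -> dF j x = 0)
  (mF : forall j, measurable_fun setT (F j))
  (mdF : forall j, measurable_fun setT (dF j))
  (cF : forall j (x : 'rV[R]_n.+1), 0 < x 0 ord_max -> {for x, continuous (F j)})
  (cdF : forall j (x : 'rV[R]_n.+1), 0 < x 0 ord_max -> {for x, continuous (dF j)})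
  (DF : forall j (x : 'rV[R]_n.+1), 0 < x 0 ord_max -> is_derive x (delta_mx 0 j) (F j) (dF j x))
  (divF : forall x, \sum_j dF j x = 0).
Variables (Psi : 'rV[R]_n.+1 -> R) (a t c L : R).
Hypotheses (CPsi : C1on setT Psi)
  (Psii : forall x s, Psi (x + s *: delta_mx 0 i) = Psi x)
  (at_ : a < t) (c0 : 0 < c) (La : - L <= a) (Lt : t <= L)
  (Psi_supp : forall x : 'rV[R]_n.+1, a <= x 0 i <= t -> Psi x != 0 -> halfbox L c x).

Let S (x : 'rV[R]_n.+1) := a <= x 0 i <= t.

Let cPsi : continuous Psi.
Proof. by move=> x; exact: (C1on_continuous CPsi). Qed.

Let cdPsi j : continuous (partial j Psi).
Proof. by move=> x; exact: (C1on_partial j CPsi). Qed.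

Let dPsi_supp j x : S x -> ~ halfbox L c x -> partial j Psi x = 0.
Proof.
have [->|ji] := eqVneq j i.
  by move=> _ _; exact: (@derive_val _ _ _ _ _ _ _ (is_derive_const_line (Psii x))).
move=> Sx nB.
have Sl s : S (x + s *: delta_mx 0 j).
  by rewrite /S coord_line eq_sym (negPf ji) mulr0 addr0.
suff H : is_derive x (delta_mx 0 j) Psi 0 by exact: (@derive_val _ _ _ _ _ _ _ H).
have oB := @open_halfboxC R n L c.
apply: (@is_derive_eq_line _ _ (fun=> 0)).
have nB' : \forall y \near x, ~ halfbox L c y by exact: open_nbhs_nbhs.
have cl : {for 0, continuous (fun s : R => x + s *: (delta_mx 0 j : 'rV[R]_n.+1))}.
  apply: cvgD; first exact: cvg_cst.
  by apply: cvgZr_tmp; exact: cvg_id.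
have : \forall s \near (0 : R), ~ halfbox L c (x + s *: delta_mx 0 j).
  by apply: (cl [set y | ~ halfbox L c y]); rewrite scale0r addr0.
apply: filterS => s nBs; apply/esym/eqP/negPn/negP => /(Psi_supp (Sl s)).
exact: nBs.
Qed.

Let Psi0 x : S x -> ~ halfbox L c x -> Psi x = 0.
Proof. by move=> Sx nB; apply/eqP/negPn/negP => /(Psi_supp Sx). Qed.

(* g j is d_j (F_j Psi) on the slab. *)
Let g j x := if S x then dF j x * Psi x + F j x * partial j Psi x else 0.

Let g0 j x : ~ halfbox L c x -> g j x = 0.
Proof.
by move=> nB; rewrite /g; case: ifPn => // Sx; rewrite Psi0// dPsi_supp// !mulr0 addr0.
Qed.

Let B_pos x : @halfbox R n L c x -> 0 < x 0 ord_max.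
Proof. by move=> [_]; exact: lt_le_trans. Qed.

Let bounds : exists2 M, 0 <= M & forall j x, halfbox L c x ->
  [/\ `|F j x| <= M, `|dF j x| <= M, `|Psi x| <= M & `|partial j Psi x| <= M].
Proof.
have cB := @halfbox_compact R n L c.
have [M1 M10 H1] := compact_bound_fin (I := 'I_n.+1) cB (fun j x Bx => @cF j x (B_pos Bx)).
have [M2 M20 H2] := compact_bound_fin (I := 'I_n.+1) cB (fun j x Bx => @cdF j x (B_pos Bx)).
have [M3 M30 H3] := compact_bound_fin (I := unit) cB (fun j x Bx => @cPsi x).
have [M4 M40 H4] := compact_bound_fin (I := 'I_n.+1) cB (fun j x Bx => @cdPsi j x).
exists (M1 + M2 + M3 + M4); first by rewrite !addr_ge0.
move=> j x Bx; have := H1 j x Bx; have := H2 j x Bx; have := H3 tt x Bx.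
have := H4 j x Bx; split; lra.
Qed.

Let mS : measurable [set x | S x].
Proof.
rewrite (_ : [set x | _] = (fun x : 'rV[R]_n.+1 => x 0 i) @^-1` `[a, t]).
  by rewrite -[X in measurable X]setTI; exact: (measurable_coord i).
by apply/seteqP; split => x /=; rewrite in_itv.
Qed.

Let measurable_ifS (h : 'rV[R]_n.+1 -> R) : measurable_fun setT h ->
  measurable_fun setT (fun x => if S x then h x else 0).
Proof.
move=> mh; rewrite (_ : (fun x => _) = (h \_ [set x | S x])).
  by apply/(measurable_restrict _ mS measurableT); exact: measurable_funTS.
by apply/funext => x; rewrite patchE mem_setE.
Qed.

Let mPsi : measurable_fun setT Psi. Proof. exact: continuous_measurable_rowT. Qed.

Let mdPsi j : measurable_fun setT (partial j Psi).
Proof. exact: continuous_measurable_rowT. Qed.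

Let mg j : measurable_fun setT (g j).
Proof.
by apply: measurable_ifS; apply: measurable_funD; apply: measurable_funM.
Qed.

Let ig j : (vol n.+1).-integrable setT (EFin \o g j).
Proof.
have [M M0 HM] := bounds.
apply: (@bounded_box_integrable _ _ (g j) (M * M + M * M) L) => // x.
  have [Bx|/g0->] := pselect (halfbox L c x); last by rewrite normr0 addr_ge0// mulr_ge0.
  rewrite /g; case: ifP => _; last by rewrite normr0 addr_ge0// mulr_ge0.
  have [? ? ? ?] := HM j x Bx.
  by apply: (le_trans (ler_normD _ _)); rewrite !normrM lerD// ler_pM.
move=> nb; apply: g0 => -[H _]; apply: nb => k.
by rewrite -ler_norml.
Qed.

Let int_gj j : j != i -> (\int[vol n.+1]_x (g j x)%:E = 0)%E.
Proof.
move=> ji.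
have Sl x s : S (x + s *: delta_mx 0 j) = S x.
  by rewrite /S coord_line eq_sym (negPf ji) mulr0 addr0.
have Bn x : halfbox L c x -> `|x 0 j| <= L by move=> [].
have L0 : 0 <= L.
  by have := La; have := Lt; have := at_; lra.
apply: (@int_div0 _ _ (fun x => if S x then F j x * Psi x else 0) _ j (L + 1)) => //.
- lra.
- move=> x; rewrite /g; case: ifPn => Sx; last first.
    by apply: is_derive_const_line => s; rewrite Sl (negPf Sx).
  apply: (@is_derive_eq_line _ _ (fun x => F j x * Psi x)).
    by near=> s; rewrite Sl Sx.
  have [y0|y0] := ltP 0 (x 0 ord_max).
    have D1 := @DF j x y0.
    have D2 : is_derive x (delta_mx 0 j) Psi (partial j Psi x).
      by apply/derivableP; exact: (C1on_derivable j CPsi).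
    apply: (is_derive_eq (is_deriveM D1 D2)).
    rewrite /GRing.scale /=; ring.
  rewrite F0// dF0// !mul0r addr0.
  apply: (@is_derive_eq_line _ _ (fun=> 0)).
  near=> s; rewrite Psi0 ?mulr0 ?Sl//.
  move=> [_]; rewrite coord_line => H.
  have sc : `|s| < c by near: s; exists c => // r /=; rewrite sub0r normrN.
  have : s * (ord_max == j)%:R <= `|s|.
    by case: (_ == _); rewrite ?mulr1 ?mulr0// ler_norm.
  lra.
- move=> z; case: (boolP (S (ins j 0 z))) => Sz; last first.
    rewrite (_ : (fun r => _) = fun=> 0); first exact: cst_continuous.
    by apply/funext => r; rewrite /g ins_line Sl (negPf Sz).
  have Sr r : S (ins j r z) by rewrite ins_line Sl.
  rewrite (_ : (fun r => _) = (fun r => dF j (ins j r z) * Psi (ins j r z) +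
     F j (ins j r z) * partial j Psi (ins j r z))); last first.
    by apply/funext => r; rewrite /g Sr.
  move=> r; have [y0|y0] := ltP 0 ((ins j r z) 0 ord_max).
    apply: (@continuous_comp _ _ _ (fun r => ins j r z)
      (fun x => dF j x * Psi x + F j x * partial j Psi x)).
      exact: continuous_ins.
    apply: contD; apply: contM; [exact: cdF|exact: cPsi|exact: cF|exact: cdPsi].
  have N : \forall s \near r, ~ halfbox L c (ins j s z).
    have : \forall s \near r, (ins j s z) 0 ord_max < c.
      apply: (@cvgr_lt _ _ (nbhs r) _ (fun s => (ins j s z) 0 ord_max) ((ins j r z) 0 ord_max)).
        apply: (@continuous_comp _ _ _ (fun r => ins j r z) (fun x => x 0 ord_max)).
          exact: continuous_ins.
        exact: coord_continuous.
      exact: le_lt_trans y0 c0.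
    by apply: filterS => s sc [_]; rewrite leNgt sc.
  apply: (@near_continuous _ _ (fun=> 0)); last exact: cst_continuous.
  by apply: filterS N => s nB; rewrite Psi0// dPsi_supp// !mulr0 addr0.
- move=> x Lx; case: ifPn => // Sx; rewrite Psi0 ?mulr0//.
  by move=> /Bn; lra.
- by move=> x Lx; apply: g0 => /Bn; lra.
Unshelve. all: by end_near. Qed.

Let int_gi : (\int[vol n.+1]_x (g i x)%:E =
  \int[vol n]_z (F i (ins i t z) * Psi (ins i t z) - F i (ins i a z) * Psi (ins i a z))%:E)%E.
Proof.
have dPsii x : partial i Psi x = 0.
  exact: (@derive_val _ _ _ _ _ _ _ (is_derive_const_line (Psii x))).
have E x : g i x = if S x then dF i x * Psi x else 0.
  by rewrite /g dPsii mulr0 addr0.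
under eq_integral do rewrite E.
apply: (int_slab (G := fun x => F i x * Psi x) at_).
- rewrite (_ : (fun x => _) = EFin \o g i)//.
  by apply/funext => x /=; rewrite E.
- move=> x Sx; have [P0|P0] := eqVneq (Psi x) 0.
    rewrite P0 mulr0; apply: is_derive_const_line => s.
    by rewrite Psii P0 !mulr0.
  have y0 := B_pos (Psi_supp Sx P0).
  have D2 : is_derive x (delta_mx 0 i) Psi 0.
    by apply: is_derive_const_line.
  apply: (is_derive_eq (is_deriveM (@DF i x y0) D2)).
  rewrite /GRing.scale /=; ring.
- move=> z.
  have Pc r : Psi (ins i r z) = Psi (ins i 0 z) by rewrite ins_line Psii.
  have [P0|P0] := eqVneq (Psi (ins i 0 z)) 0.
    rewrite (_ : (fun r => _) = fun=> 0).
      by apply: continuous_subspaceT; exact: cst_continuous.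
    by apply/funext => r; rewrite Pc P0 mulr0.
  apply: continuous_in_subspaceT => r; rewrite inE /= in_itv /= => rab.
  have Sx : S (ins i r z) by rewrite /S ins_same.
  have y0 : 0 < (ins i r z) 0 ord_max by apply: B_pos; apply: Psi_supp => //; rewrite Pc.
  apply: (@continuous_comp _ _ _ (fun r => ins i r z) (fun x => dF i x * Psi x)).
    exact: continuous_ins.
  by apply: contM; [exact: cdF|exact: cPsi].
Qed.

Let islice s : a <= s <= t -> (vol n).-integrable setT
  (fun z => (F i (ins i s z) * Psi (ins i s z))%:E).
Proof.
move=> st; have [M M0 HM] := bounds.
have Ss z : S (ins i s z) by rewrite /S ins_same.
apply: (@bounded_box_integrable _ _ (fun z => F i (ins i s z) * Psi (ins i s z)) (M * M) L).
- by apply: measurable_funM; [apply: (measurableT_comp (mF i))|apply: (measurableT_comp mPsi)];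
    apply: measurable_ins.
- move=> z; have [Bx|nB] := pselect (halfbox L c (ins i s z)); last first.
    by rewrite Psi0// mulr0 normr0 mulr_ge0.
  by have [? ? ? ?] := HM i _ Bx; rewrite normrM ler_pM.
- move=> z nb; rewrite Psi0 ?mulr0// => -[H _]; apply: nb => k.
  by have := H (lift i k); rewrite ins_lift ler_norml.
Qed.

(** The divergence of F Psi on the slab is sum_(j <> i) F_j d_j Psi; the directions j <> i
    contribute nothing to its integral, and the direction i gives the two slice fluxes. *)
Lemma slab_bound (H : 'rV[R]_n.+1 -> R) : measurable_fun setT H ->
  (forall x, 0 <= H x) ->
  (forall x : 'rV[R]_n.+1, a <= x 0 i <= t ->
     \sum_(j | j != i) `|F j x| * `|partial j Psi x| <= H x) ->
  (`|\int[vol n]_z (F i (ins i t z) * Psi (ins i t z))%:E| <=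
   `|\int[vol n]_z (F i (ins i a z) * Psi (ins i a z))%:E| +
   \int[vol n.+1]_x (H x)%:E)%E.
Proof.
move=> mH H0 HF.
set A := (X in (`|X| <= _)%E); set B := (X in (_ <= `|X| + _)%E).
have iA := islice (s := t); have iB := islice (s := a).
have E : (A - B = \int[vol n.+1]_x (g i x)%:E)%E.
  rewrite int_gi -integralB_EFin//; [apply: iA|apply: iB]; rewrite lexx ltW//.
have E2 : (\int[vol n.+1]_x (g i x)%:E = \int[vol n.+1]_x (\sum_j (g j x)%:E))%E.
  rewrite integral_sum//.
  rewrite (bigD1 i)//= [X in (_ + X)%E]big1 ?adde0//.
have fA : A \is a fin_num.
  by apply: integrable_fin_num => //; apply: iA; rewrite lexx ltW.
have fB : B \is a fin_num.
  by apply: integrable_fin_num => //; apply: iB; rewrite lexx ltW.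
have -> : (A = B + \int[vol n.+1]_x (g i x)%:E)%E by rewrite -E addeC subeK.
apply: (le_trans (lee_abs_add _ _)); apply: leeD => //.
rewrite E2.
apply: (le_trans (le_abse_integral _ _ _)) => //.
  by apply: emeasurable_sum => j; apply/measurable_EFinP.
apply: ge0_le_integral => //.
- by apply: measurableT_comp => //; apply: emeasurable_sum => j; apply/measurable_EFinP.
- exact/measurable_EFinP.
- move=> x _; rewrite sumEFin lee_fin; case: (boolP (S x)) => Sx; last first.
    by rewrite big1 ?normr0 ?H0// => j _; rewrite /g (negPf Sx).
  rewrite (_ : \sum_j g j x = \sum_(j | j != i) F j x * partial j Psi x).
    apply: (le_trans _ (HF x Sx)); apply: (le_trans (ler_norm_sum _ _ _)).
    by apply: ler_sum => j _; rewrite normrM.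
  rewrite (eq_bigr (fun j => dF j x * Psi x + F j x * partial j Psi x)); last first.
    by move=> j _; rewrite /g Sx.
  rewrite big_split/= -mulr_suml divF mul0r add0r (bigD1 i)//=.
  have -> : partial i Psi x = 0.
    exact: (@derive_val _ _ _ _ _ _ _ (is_derive_const_line (Psii x))).
  by rewrite mulr0 add0r.
Qed.

End slab_bound.

(** * The translated test function *)

Section slice_map.
Context {R : realType} {n : nat}.
Implicit Types (i j : 'I_n.+1) (x : 'rV[R]_n.+1) (w : 'rV[R]_n).

(** Projection of x to the slice x_i = t followed by the translation by - w inside the
    slice. *)
Definition slice_map i (t : R) w x : 'rV[R]_n.+1 := ins i t (del i x - w).

Lemma slice_mapE i t w x :
  slice_map i t w x = x + ((t - x 0 i) *: delta_mx 0 i - ins i 0 w).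
Proof.
apply/rowP => j.
have E (v : 'rV[R]_n.+1) (c : R) :
    (x + (c *: delta_mx 0 i - v)) 0 j = x 0 j + (c * (j == i)%:R - v 0 j).
  by rewrite !mxE eqxx.
rewrite E /slice_map; case: (unliftP i j) => [k|] ->.
  by rewrite !ins_lift !mxE eq_sym (negPf (neq_lift _ _)) mulr0 add0r.
by rewrite !ins_same eqxx mulr1 subr0 addrC subrK.
Qed.

Lemma slice_map_line i t w x j (s : R) :
  slice_map i t w (x + s *: delta_mx 0 j) =
  slice_map i t w x + (if j != i then s *: delta_mx 0 j else 0).
Proof.
rewrite !slice_mapE coord_line; have [->|ji] := eqVneq j i.
  rewrite /= mulr1 addr0 -addrA; congr (_ + _).
  by rewrite addrA -scalerDl; congr (_ *: _ - _); ring.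
by rewrite /= mulr0 addr0 addrAC.
Qed.

Lemma slice_map_continuous i t w : continuous (slice_map i t w).
Proof.
rewrite (_ : slice_map i t w = (fun x => x + ((t - x 0 i) *: delta_mx 0 i - ins i 0 w))); last first.
  by apply/funext => x; rewrite slice_mapE.
move=> x; apply: (@continuousD _ _ _ id); first exact: cvg_id.
apply: (@continuousB _ _ _ (fun x : 'rV[R]_n.+1 => (t - x 0 i) *: delta_mx 0 i) (cst _)).
  apply: (@continuousZr_tmp _ _ _ (fun x : 'rV[R]_n.+1 => t - x 0 i)).
  apply: (@continuousB _ _ _ (cst t)); first exact: cst_continuous.
  exact: coord_continuous.
exact: cst_continuous.
Qed.

Lemma slice_map_ins i t w r z : slice_map i t w (ins i r z) = ins i t (z - w).
Proof. by rewrite /slice_map del_ins. Qed.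

Lemma slice_map_lift i t w x k : (slice_map i t w x) 0 (lift i k) = x 0 (lift i k) - w 0 k.
Proof. by rewrite /slice_map ins_lift !mxE. Qed.

Lemma slice_map_same i t w x : (slice_map i t w x) 0 i = t.
Proof. by rewrite /slice_map ins_same. Qed.

End slice_map.

Section test_function.
Context {R : realType} {n : nat}.
Variables (i : 'I_n.+1) (u : 'rV[R]_n.+1 -> R) (c L t : R) (w : 'rV[R]_n).
Hypotheses (Cu : C1on setT u) (c0 : 0 < c)
  (u_supp : forall x : 'rV[R]_n.+1, u x != 0 -> halfbox L c x)
  (tpos : i = ord_max -> 0 < t) (w0 : forall k, 0 <= w 0 k).

Let A := slice_map i t w.
Let B := slice_map i t 0.

(** The translate of u on the slice x_i = t, divided by the untranslated last coordinate and
    extended constantly along x_i.  Translating by w with nonnegative coordinates lowers y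
    in the numerator, so the support stays where y >= c. *)
Definition test_fun (x : 'rV[R]_n.+1) : R := u (A x) * ((B x) 0 ord_max)^-1.

Let AB x : (A x) 0 ord_max <= (B x) 0 ord_max.
Proof.
rewrite /A /B; case: (unliftP i ord_max) => [k ->|->].
  by rewrite !slice_map_lift mxE subr0 lerBlDr lerDl.
by rewrite !slice_map_same.
Qed.

Let U1 : set 'rV[R]_n.+1 := [set x | 0 < (B x) 0 ord_max].
Let U2 : set 'rV[R]_n.+1 := [set x | (B x) 0 ord_max < c].

Let cBy : continuous (fun x => (B x) 0 ord_max).
Proof.
move=> x; apply: (@continuous_comp _ _ _ B (fun x => x 0 ord_max)).
  exact: slice_map_continuous.
exact: coord_continuous.
Qed.

Let oU1 : open U1.
Proof. by apply: (open_comp _ (@open_gt R 0)) => x _; exact: cBy. Qed.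

Let oU2 : open U2.
Proof. by apply: (open_comp _ (@open_lt R c)) => x _; exact: cBy. Qed.

Let uA0 x : U2 x -> u (A x) = 0.
Proof.
move=> U2x; apply/eqP/negPn/negP => /u_supp[_ cA].
have := le_trans cA (AB x); by rewrite leNgt U2x.
Qed.

Let CuA := C1on_subst (P := fun j => j != i)
  (fun x j s => slice_map_line i t w x j s) (@slice_map_continuous _ _ i t w)
  openT Cu.

Let CyB := C1on_subst (P := fun j => j != i)
  (fun x j s => slice_map_line i t 0 x j s) (@slice_map_continuous _ _ i t 0)
  openT (@C1on_coord R n.+1 setT ord_max).

Let C1 : C1on U1 test_fun.
Proof.
apply: C1onM => //; first by apply: C1on_sub CuA.1.
apply: C1onV => //; first by move=> x; exact: lt0r_neq0.
by apply: C1on_sub CyB.1.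
Qed.

Let C2 : C1on U2 test_fun.
Proof.
apply: (@C1on_eq _ _ _ (fun=> 0)) => //; last exact: C1on_cst.
by move=> x U2x; rewrite /test_fun uA0// mul0r.
Qed.

Lemma test_fun_C1 : C1on setT test_fun.
Proof.
apply: C1on_sub (C1onU C1 C2) => x _.
by have [H|H] := ltP 0 ((B x) 0 ord_max); [left|right; exact: le_lt_trans c0].
Qed.

Lemma test_fun_const x s : test_fun (x + s *: delta_mx 0 i) = test_fun x.
Proof. by rewrite /test_fun /A /B !slice_map_line eqxx /= !addr0. Qed.

Lemma test_fun_supp (a W : R) (x : 'rV[R]_n.+1) : (i = ord_max -> 0 < a) -> (forall k, w 0 k <= W) ->
  a <= x 0 i <= t -> test_fun x != 0 ->
  halfbox (`|L| + `|a| + `|t| + `|W|) (Num.min c (if i == ord_max then a else c)) x.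
Proof.
move=> a0 wW Sx; rewrite /test_fun mulf_eq0 negb_or => /andP[/u_supp[AL cA] _].
split.
  move=> j; case: (unliftP i j) => [k|] ->.
    have := AL (lift i k); rewrite slice_map_lift !ler_norml.
    have := w0 k; have := wW k.
    have := ler_norm L; have := ler_norm W; have := normr_ge0 a; have := normr_ge0 t; lra.
  rewrite ler_norml; have := ler_norm t; have := ler_norm (- a).
  rewrite normrN; have := normr_ge0 L; have := normr_ge0 W; have := normr_ge0 a.
  have := normr_ge0 t; lra.
rewrite ge_min; apply/orP; have [iN|iN] := eqVneq i ord_max.
  by right; rewrite -iN; lra.
left; apply: (le_trans cA); apply: (le_trans (AB x)).
rewrite /B; case: (unliftP i ord_max) iN => [k ->|->]; last by rewrite eqxx.
by rewrite slice_map_lift mxE subr0.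
Qed.

(** The absolute value of d_j u, plus the term |u| / y that differentiating 1 / y produces
    when j is the last direction. *)
Definition grad_bound (j : 'I_n.+1) (x : 'rV[R]_n.+1) : R :=
  `|partial j u x| + (if j == ord_max then `|u x| / `|x 0 ord_max| else 0).

Lemma test_fun_grad j (x : 'rV[R]_n.+1) : j != i -> x 0 i <= t -> 0 < x 0 ord_max ->
  x 0 ord_max * `|partial j test_fun x| <= grad_bound j (A x).
Proof.
move=> ji xt y0.
have yB : x 0 ord_max <= (B x) 0 ord_max.
  rewrite /B; case: (unliftP i ord_max) => [k ->|->].
    by rewrite slice_map_lift mxE subr0.
  by rewrite slice_map_same; move: xt.
have B0 : 0 < (B x) 0 ord_max by exact: lt_le_trans yB.
have E1 : partial j (u \o A) x = partial j u (A x) by rewrite CuA.2// ji.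
have E2 : partial j ((fun x => x 0 ord_max) \o B) x = (ord_max == j)%:R.
  rewrite CyB.2// ji; exact: (@derive_val _ _ _ _ _ _ _ (partial_coord _ _ _)).
have dA : derivable (u \o A) x (delta_mx 0 j) by exact: (C1on_derivable j CuA.1).
have dB : derivable ((fun x => x 0 ord_max) \o B) x (delta_mx 0 j).
  exact: (C1on_derivable j CyB.1).
have -> : partial j test_fun x = partial j u (A x) / (B x) 0 ord_max
    - u (A x) * (ord_max == j)%:R / (B x) 0 ord_max ^+ 2.
  rewrite /test_fun (@partialM _ _ (u \o A) (fun x => ((B x) 0 ord_max)^-1))//; last first.
    exact: (derivableV (lt0r_neq0 B0) dB).
  rewrite (@partialV _ _ ((fun x => x 0 ord_max) \o B))//; last exact: lt0r_neq0.
  rewrite E1 E2 /=; field; exact: lt0r_neq0.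
set P := partial j u (A x); set Y := (B x) 0 ord_max.
have H1 : `|P / Y - u (A x) * (ord_max == j)%:R / Y ^+ 2| <=
    (`|P| + `|u (A x)| * (ord_max == j)%:R / Y) / Y.
  apply: (le_trans (ler_normB _ _)).
  rewrite !normrM !normfV (gtr0_norm B0) -/Y mulrDl lerD//.
  by rewrite normr_nat normrX (gtr0_norm B0) -/Y expr2 invfM mulrA.
apply: (@le_trans _ _ (Y * `|P / Y - u (A x) * (ord_max == j)%:R / Y ^+ 2|)).
  by apply: ler_wpM2r.
apply: (@le_trans _ _ (Y * ((`|P| + `|u (A x)| * (ord_max == j)%:R / Y) / Y))).
  by apply: ler_wpM2l => //; exact: ltW.
rewrite mulrCA mulfV ?lt0r_neq0// mulr1 /grad_bound -/P lerD2l eq_sym.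
case: eqP => _; last by rewrite mulr0 mul0r.
rewrite mulr1; have [->|u0] := eqVneq (u (A x)) 0; first by rewrite normr0 !mul0r.
have [_ cA] := u_supp u0; have A0 := lt_le_trans c0 cA.
rewrite ler_wpM2l// (gtr0_norm A0) lef_pV2 ?posrE//; exact: AB.
Qed.

End test_function.

(** * Slices of small mass *)

Lemma measurable_invr {R : realType} : measurable_fun setT (@GRing.inv R).
Proof.
have oU : open [set r : R | r != 0] by exact: open_neq.
rewrite (_ : GRing.inv = (GRing.inv \_ [set r : R | r != 0])).
  apply/(measurable_restrict _ (open_measurable oU) measurableT).
  rewrite setTI; apply: open_continuous_measurable_fun => // r; rewrite inE /= => r0.
  exact: inv_continuous.
apply/funext => r; rewrite patchE; case: ifPn => //.
by rewrite notin_setE /= => /negP/negPn/eqP ->; rewrite invr0.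
Qed.

(** An integrable A : R -> [0, +oo] takes arbitrarily small values far to the left, and
    values small compared with 1 / a at some a close to 0. *)
Section small_slices.
Context {R : realType}.
Local Notation leb := (@lebesgue_measure R).
Variable A : R -> \bar R.
Hypotheses (mA : measurable_fun setT A) (A0 : forall r, (0 <= A r)%E)
  (iA : (\int[leb]_r A r < +oo)%E).

Let int_sub (D : set R) : measurable D ->
  (\int[leb]_(r in D) A r <= \int[leb]_r A r)%E.
Proof. move=> mD. apply: (@ge0_subset_integral _ _ _ leb D setT) => //. Qed.

Lemma small_slice_below (t d : R) : 0 < d -> exists2 a, a < t & (A a <= d%:E)%E.
Proof.
move=> d0; apply: contrapT => H.
have Ad a : a < t -> (d%:E <= A a)%E.
  move=> at_; rewrite leNgt; apply/negP => Aa; apply: H; exists a => //; exact: ltW.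
suff : (+oo <= \int[leb]_r A r)%E by rewrite leNgt iA.
apply: (@le_trans _ _ (\int[leb]_(r in `]-oo, t[) A r)%E); last first.
  by apply: int_sub; exact: measurable_itv.
apply: (@le_trans _ _ (\int[leb]_(r in `]-oo, t[) (cst d%:E r))%E).
  rewrite integral_cst//.
  by rewrite [X in (_ * X)%E](lebesgue_measure_itv `]-oo, t[) /= ltNyr addey// gt0_muley ?lte_fin.
apply: ge0_le_integral => //.
- by move=> x _; rewrite lee_fin ltW.
- exact: measurable_funTS.
Qed.

Lemma small_slice_near0 (t d : R) : 0 < t -> 0 < d ->
  exists2 a, 0 < a < t & ((a / t)%:E * A a <= d%:E)%E.
Proof.
move=> t0 d0; apply: contrapT => H.
have Ad a : 0 < a < t -> ((d * t / a)%:E <= A a)%E.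
  move=> /andP[a0 at_]; rewrite leNgt; apply/negP => Aa; apply: H.
  exists a; first by rewrite a0.
  have fA : A a \is a fin_num by rewrite ge0_fin_numE// (lt_trans Aa)// ltry.
  move: Aa; rewrite -(fineK fA) lte_fin -EFinM lee_fin => Aa.
  apply: (@le_trans _ _ (a / t * (d * t / a))).
    by rewrite ler_wpM2l ?(ltW Aa)// divr_ge0 ?ltW.
  rewrite le_eqVlt; apply/orP; left; apply/eqP; field.
  by rewrite !lt0r_neq0.
have fI : (\int[leb]_r A r)%E \is a fin_num.
  by rewrite ge0_fin_numE//; exact: integral_ge0.
pose K := fine (\int[leb]_r A r)%E.
have K0 : 0 <= K by rewrite fine_ge0// integral_ge0.
have dt0 : 0 < d * t by rewrite mulr_gt0.
(* The integral of d t / a over [e, t] exceeds that of A. *)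
pose e := t * expR (- ((K + 1) / (d * t))).
have e0 : 0 < e by rewrite mulr_gt0// expR_gt0.
have et : e < t.
  rewrite /e gtr_pMr// expR_lt1 oppr_lt0 divr_gt0//; lra.
have lnE : d * t * (ln t - ln e) = K + 1.
  rewrite /e lnM ?posrE ?expR_gt0// expRK; field.
  by rewrite !lt0r_neq0.
have pos r : r \in `[e, t] -> 0 < r by rewrite in_itv /= => /andP[+ _]; exact: lt_le_trans.
have D (r : R) : 0 < r -> is_derive r 1 (fun x : R => d * t * ln x) (d * t / r).
  move=> r0; have := is_derive1_ln r0 => H1.
  have := is_deriveZ (d * t) H1.
  by [].
have E : (\int[leb]_(r in `[e, t]) (d * t / r)%:E = (K + 1)%:E)%E.
  rewrite (@continuous_FTC2 _ _ (fun r => d * t * ln r) e t)//.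
  - by rewrite -EFinB -mulrBr lnE.
  - apply: continuous_in_subspaceT => r; rewrite inE /= => /pos r0.
    apply: (@continuousM _ _ (cst (d * t))); first exact: cst_continuous.
    by apply: inv_continuous; exact: lt0r_neq0.
  - have C (r : R) : 0 < r -> {for r, continuous (fun x : R => d * t * ln x)}.
      move=> /D H1; apply: differentiable_continuous; apply/derivable1_diffP.
      exact: (@ex_derive _ _ _ _ _ _ _ H1).
    split.
    + move=> r; rewrite in_itv /= => /andP[er _].
      exact: (@ex_derive _ _ _ _ _ _ _ (D r (lt_trans e0 er))).
    + by apply: cvg_at_right_filter; exact: C.
    + by apply: cvg_at_left_filter; exact: C.
  - move=> r; rewrite in_itv /= => /andP[er _]; rewrite derive1E.
    exact: (@derive_val _ _ _ _ _ _ _ (D r (lt_trans e0 er))).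
suff : ((K + 1)%:E <= K%:E)%E by rewrite lee_fin; lra.
rewrite fineK// -E -integral_itv_bndo_bndc; last first.
  apply/measurable_EFinP; apply: measurable_funM => //.
  by apply: measurable_funTS; exact: measurable_invr.
apply: (@le_trans _ _ (\int[leb]_(r in `[e, t[) A r)%E); last first.
  by apply: int_sub; exact: measurable_itv.
apply: ge0_le_integral => //.
- move=> r /=; rewrite in_itv /= => /andP[er _]; rewrite lee_fin divr_ge0 ?ltW//.
  exact: lt_le_trans er.
- apply/measurable_EFinP; apply: measurable_funM => //.
  by apply: measurable_funTS; exact: measurable_invr.
- exact: measurable_funTS.
- move=> r /=; rewrite in_itv /= => /andP[er rt]; apply: Ad.
  by rewrite rt andbT; exact: lt_le_trans er.
Qed.

End small_slices.

Lemma continuous_measurable_map {R : realType} n m (A : 'rV[R]_n -> 'rV[R]_m) :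
  continuous A -> measurable_fun setT A.
Proof.
move=> cA; apply: measurable_rowP => i; apply: continuous_measurable_rowT => x.
apply: (@continuous_comp _ _ _ A (fun x => x 0 i)); first exact: cA.
exact: coord_continuous.
Qed.

Lemma grad_bound_ge0 {R : realType} {n} (u : 'rV[R]_n.+1 -> R) j x :
  0 <= grad_bound u j x.
Proof. by rewrite addr_ge0//; case: ifP => // _; rewrite divr_ge0. Qed.

Lemma measurable_grad_bound {R : realType} {n} (u : 'rV[R]_n.+1 -> R) j :
  C1on setT u -> measurable_fun setT (grad_bound u j).
Proof.
move=> Cu; apply: measurable_funD.
  apply: measurableT_comp => //.
  by apply: continuous_measurable_rowT => x; exact: (C1on_partial j Cu).
case: (j == ord_max) => //; apply: measurable_funM.
  apply: measurableT_comp => //.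
  by apply: continuous_measurable_rowT => x; exact: (C1on_continuous Cu).
by apply: (measurableT_comp measurable_invr); apply: measurableT_comp => //.
Qed.

Section slice_test.
Context {R : realType} {n : nat}.
Local Notation leb := (@lebesgue_measure R).
Variables (i : 'I_n.+1) (F dF : 'I_n.+1 -> 'rV[R]_n.+1 -> R).
Hypotheses (F0 : forall j (x : 'rV[R]_n.+1), x 0 ord_max <= 0 -> F j x = 0)
  (dF0 : forall j (x : 'rV[R]_n.+1), x 0 ord_max <= 0 -> dF j x = 0)
  (mF : forall j, measurable_fun setT (F j))
  (mdF : forall j, measurable_fun setT (dF j))
  (cF : forall j (x : 'rV[R]_n.+1), 0 < x 0 ord_max -> {for x, continuous (F j)})
  (cdF : forall j (x : 'rV[R]_n.+1), 0 < x 0 ord_max -> {for x, continuous (dF j)})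
  (DF : forall j (x : 'rV[R]_n.+1), 0 < x 0 ord_max -> is_derive x (delta_mx 0 j) (F j) (dF j x))
  (divF : forall x, \sum_j dF j x = 0).
Variables (u : 'rV[R]_n.+1 -> R) (c L : R).
Hypotheses (Cu : C1on setT u) (c0 : 0 < c)
  (u_supp : forall x : 'rV[R]_n.+1, u x != 0 -> halfbox L c x).

(** Density, with respect to the Euclidean measure, of |F_j| / y. *)
Definition weighted j (x : 'rV[R]_n.+1) : R := `|F j x| / x 0 ord_max.

Lemma weighted_ge0 j x : 0 <= weighted j x.
Proof.
have [y0|y0] := ltP 0 (x 0 ord_max); first by rewrite divr_ge0// ltW.
by rewrite /weighted F0// normr0 mul0r.
Qed.

Lemma measurable_weighted j : measurable_fun setT (weighted j).
Proof.
apply: measurable_funM; first exact: measurableT_comp.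
by apply: (measurableT_comp measurable_invr); exact: measurable_coord.
Qed.

Hypothesis iF : (\int[vol n.+1]_x (weighted i x)%:E < +oo)%E.

Variables (t W : R) (w : 'rV[R]_n).
Hypotheses (tpos : i = ord_max -> 0 < t) (w0 : forall k, 0 <= w 0 k)
  (wW : forall k, w 0 k <= W).

Let Psi := test_fun i u t w.
Let CPsi : C1on setT Psi. Proof. exact: (test_fun_C1 i t Cu c0 u_supp w0). Qed.
Let mPsi : measurable_fun setT Psi.
Proof. by apply: continuous_measurable_rowT => x; exact: (C1on_continuous CPsi). Qed.

Let u_bound : exists2 M, 0 <= M & forall x, `|u x| <= M.
Proof.
have [M M0 HM] := compact_bound_fin (I := unit) (@halfbox_compact R n L c)
  (fun j x Bx => (C1on_continuous Cu (x := x) Logic.I)).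
exists M => // x; have [->|/u_supp/(HM tt)//] := eqVneq (u x) 0.
by rewrite normr0.
Qed.

Let slice_mass a := (\int[vol n]_z (weighted i (ins i a z))%:E)%E.

Let mweighted_slice a : measurable_fun setT (fun z => (weighted i (ins i a z))%:E).
Proof.
apply/measurable_EFinP; apply: (measurableT_comp (measurable_weighted i)).
exact: measurable_ins.
Qed.

Let slice_mass_measurable : measurable_fun setT slice_mass.
Proof.
apply: (measurable_tonelli_ins1 i (G := fun x => (weighted i x)%:E)).
  by apply/measurable_EFinP; exact: measurable_weighted.
by move=> x; rewrite lee_fin weighted_ge0.
Qed.

Let slice_mass_ge0 a : (0 <= slice_mass a)%E.
Proof. by apply: integral_ge0 => z _; rewrite lee_fin weighted_ge0. Qed.

Let slice_mass_int : (\int[leb]_a slice_mass a < +oo)%E.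
Proof.
rewrite -(tonelli_ins1 i (G := fun x => (weighted i x)%:E))//.
  by apply/measurable_EFinP; exact: measurable_weighted.
by move=> x; rewrite lee_fin weighted_ge0.
Qed.

(* Flux of F_i Psi through the slice x_i = a. *)
Let J a := (\int[vol n]_z (F i (ins i a z) * Psi (ins i a z))%:E)%E.

(* When i is the last index, Psi is divided by t instead of by the height a of the slice,
   hence the factor a / t: by [small_slice_near0] the product with the slice mass can be
   made small although the slice mass itself may blow up as a tends to 0. *)
Let J_le (M a rho : R) : 0 <= M -> (forall x, `|u x| <= M) -> 0 <= rho ->
  (if i == ord_max then rho = a / t else rho = 1) ->
  (`|J a| <= (M * rho)%:E * slice_mass a)%E.
Proof.
move=> M0 uM rho0 Hrho.
have mFP : measurable_fun setT (fun z => (F i (ins i a z) * Psi (ins i a z))%:E).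
  apply/measurable_EFinP; apply: measurable_funM.
    by apply: (measurableT_comp (mF i)); exact: measurable_ins.
  by apply: (measurableT_comp mPsi); exact: measurable_ins.
apply: (le_trans (le_abse_integral _ _ mFP)) => //.
rewrite -ge0_integralZl//; last 2 first.
- by move=> z _; rewrite lee_fin weighted_ge0.
- by rewrite lee_fin mulr_ge0.
apply: ge0_le_integral => //.
- exact: measurableT_comp.
- apply: measurable_funeM; exact: mweighted_slice.
- move=> z _; rewrite abse_EFin -EFinM lee_fin normrM /weighted.
  set x := ins i a z.
  have [y0|y0] := ltP 0 (x 0 ord_max); last by rewrite F0// normr0 !mul0r mulr0.
  rewrite mulrCA ler_wpM2l// /Psi /test_fun normrM.
  rewrite mulrAC -mulrA ler_pM//.
  rewrite normfV.
  have [iN|iN] := eqVneq i ord_max.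
    have -> : rho = a / t by move: Hrho; rewrite iN eqxx.
    have xa : x 0 ord_max = a by rewrite -[in LHS]iN ins_same.
    have -> : (slice_map i t 0 x) 0 ord_max = t by rewrite -[in LHS]iN slice_map_same.
    have tp := tpos iN; rewrite gtr0_norm// xa.
    rewrite le_eqVlt; apply/orP; left; apply/eqP; field.
    by rewrite !lt0r_neq0 -?xa.
  move: Hrho; rewrite (negPf iN) => ->.
  have -> : (slice_map i t 0 x) 0 ord_max = x 0 ord_max.
    case: (unliftP i ord_max) iN => [k ->|->]; last by rewrite eqxx.
    by rewrite slice_map_lift [X in _ - X]mxE subr0.
  by rewrite gtr0_norm// mulr1.
Qed.

Let mH : measurable_fun setT (fun x => \sum_(j | j != i)
      weighted j x * grad_bound u j (slice_map i t w x)).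
Proof.
rewrite [X in measurable_fun _ X](_ : _ = (fun x => \sum_j (if j != i then
   weighted j x * grad_bound u j (slice_map i t w x) else 0))); last first.
  by apply/funext => x; rewrite big_mkcond.
apply: measurable_sum => j; case: (j != i) => //.
apply: measurable_funM; first exact: measurable_weighted.
apply: (@measurableT_comp _ _ _ _ _ _ (grad_bound u j)).
  exact: measurable_grad_bound.
by apply: continuous_measurable_map; exact: slice_map_continuous.
Qed.

(** The flux through the slice x_i = t, by [slab_bound] from slices of vanishing flux. *)
Lemma slice_test_bound :
  (`|\int[vol n]_z (F i (ins i t z) * Psi (ins i t z))%:E| <=
   \int[vol n.+1]_x (\sum_(j | j != i)
      weighted j x * grad_bound u j (slice_map i t w x))%:E)%E.
Proof.
set D := (X in (_ <= X)%E); rewrite -/(J t).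
have step a : a < t -> (i = ord_max -> 0 < a) -> (`|J t| <= `|J a| + D)%E.
  move=> at_ ap.
  pose L' := `|L| + `|a| + `|t| + `|W|.
  have c'0 : 0 < Num.min c (if i == ord_max then a else c).
    by rewrite lt_min c0 /=; case: eqP.
  have L'a : - L' <= a.
    rewrite /L'; have := ler_norm (- a); rewrite normrN.
    have := normr_ge0 L; have := normr_ge0 t; have := normr_ge0 W; lra.
  have L't : t <= L'.
    rewrite /L'; have := ler_norm t.
    have := normr_ge0 L; have := normr_ge0 a; have := normr_ge0 W; lra.
  apply: (slab_bound F0 dF0 mF mdF cF cdF DF divF CPsi _ at_ c'0 L'a L't _).
  - by move=> x s; exact: test_fun_const.
  - by move=> x Sx P0; apply: (test_fun_supp u_supp w0 ap wW Sx P0).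
  - exact: mH.
  - by move=> x; rewrite sumr_ge0// => j _; rewrite mulr_ge0 ?weighted_ge0// grad_bound_ge0.
  - move=> x /andP[_ xt]; apply: ler_sum => j ji; rewrite /weighted.
    have [y0|y0] := ltP 0 (x 0 ord_max); last by rewrite F0// normr0 !mul0r.
    rewrite mulrAC -mulrA ler_wpM2l// mulrC ler_pdivlMl//.
    exact: (test_fun_grad Cu c0 u_supp w0 ji xt y0).
have [M M0 uM] := u_bound.
apply/lee_addgt0Pr => e e0.
have [a at_ [ap Ja]] : exists2 a, a < t & (i = ord_max -> 0 < a) /\ (`|J a| <= e%:E)%E.
  have d0 : 0 < e / (M + 1) by rewrite divr_gt0//; lra.
  have fin (x : \bar R) (r : R) : 0 <= r -> (0 <= x)%E -> (r%:E * x <= (e / (M + 1))%:E)%E ->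
      ((M * r)%:E * x <= e%:E)%E.
    move=> r0 x0 H; rewrite EFinM -muleA.
    apply: (@le_trans _ _ (M%:E * (e / (M + 1))%:E)%E).
      by apply: lee_wpmul2l => //; rewrite lee_fin.
    rewrite -EFinM lee_fin mulrCA ler_piMr ?ltW// ltr_pdivrMr; lra.
  have [iN|iN] := eqVneq i ord_max.
    have [a /andP[a0 at_] Aa] := small_slice_near0 slice_mass_measurable slice_mass_ge0
      slice_mass_int (tpos iN) d0.
    exists a => //; split => //.
    have r0 : 0 <= a / t by rewrite divr_ge0 ?ltW// tpos.
    apply: (le_trans (J_le M0 uM r0 _)); first by rewrite iN eqxx.
    exact: fin.
  have [a at_ Aa] := small_slice_below slice_mass_measurable slice_mass_ge0
    slice_mass_int t d0.
  exists a => //; split; first by move/eqP: iN.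
  apply: (le_trans (J_le M0 uM ler01 _)); first by rewrite (negPf iN).
  by apply: fin => //; rewrite mul1e.
apply: (le_trans (step a at_ ap)); rewrite addeC; exact: leeD.
Qed.

End slice_test.

(** * Cube averages and the Morrey path estimate *)

Section averages.
Context {R : realType} {n : nat}.
Local Notation leb := (@lebesgue_measure R).

(** Form of Young's inequality: a linear term against a power. *)
Lemma young_expn (l a : R) (k : nat) : 0 < l -> 0 <= a -> a <= l + l ^- k * a ^+ k.+1.
Proof.
move=> l0 a0; have lk0 : 0 < l ^+ k by rewrite exprn_gt0.
have [al|la] := leP a l.
  by rewrite (le_trans al)// lerDl mulr_ge0 ?exprn_ge0// invr_ge0 ltW.
rewrite -[leLHS]add0r; apply: lerD; first exact: ltW.
rewrite exprS mulrCA ler_peMr//.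
rewrite mulrC ler_pdivlMr// mul1r; apply: lerXn2r; rewrite ?nnegrE//; exact: ltW.
Qed.

Lemma measurable_row_affine d (T : measurableType d) (f g : T -> 'rV[R]_n) (h : T -> R) :
  measurable_fun setT f -> measurable_fun setT g -> measurable_fun setT h ->
  measurable_fun setT (fun x => f x - h x *: g x).
Proof.
move=> mf mg mh; apply: measurable_rowP => i.
rewrite (_ : (fun x => _) = (fun x => f x 0 i - h x * g x 0 i)).
  apply: measurable_funB; first exact: (measurableT_comp (measurable_coord i) mf).
  by apply: measurable_funM => //; exact: (measurableT_comp (measurable_coord i) mg).
by apply/funext => x; rewrite !mxE.
Qed.

(** Average of p over the cube of side s^(n+1) with upper corner a; the parameter l of
    [young_expn] balances the two terms. *)
Lemma cube_average (p : 'rV[R]_n -> R) (a : 'rV[R]_n) (s mu : R) :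
  measurable_fun setT p -> (forall z, 0 <= p z) -> 0 < s -> 0 < mu ->
  (\int[vol n]_z (p z ^+ n.+1)%:E <= (mu ^+ n.+1)%:E)%E ->
  (\int[vol n]_(w in box n 0 1) (p (a - s ^+ n.+1 *: w))%:E <= (2 * s ^- n * mu)%:E)%E.
Proof.
move=> mp p0 s0 mu0 pmu; pose l := s ^- n * mu.
have l0 : 0 < l by rewrite mulr_gt0// invr_gt0 exprn_gt0.
have ln0 : 0 <= l ^- n by rewrite invr_ge0 exprn_ge0 ?ltW.
have sn0 : 0 < s ^+ n.+1 by rewrite exprn_gt0.
have mpX : measurable_fun setT (fun z => (p z ^+ n.+1)%:E).
  by apply/measurable_EFinP; exact: measurable_funX.
have ma : measurable_fun setT (fun w : 'rV[R]_n => a - s ^+ n.+1 *: w).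
  exact: (@measurable_row_affine _ _ (fun=> a) id (fun=> s ^+ n.+1)).
have mB := @measurable_box R n 0 1.
apply: (@le_trans _ _ (\int[vol n]_(w in box n 0 1)
   (l%:E + (l ^- n)%:E * (p (a - s ^+ n.+1 *: w) ^+ n.+1)%:E))%E).
  apply: ge0_le_integral => //.
  - by move=> w _; rewrite lee_fin.
  - by apply/measurable_funTS/measurable_EFinP; exact: measurableT_comp.
  - apply: emeasurable_funD; first exact: measurable_cst.
    by apply/measurable_funTS/measurable_funeM; exact: (measurableT_comp mpX).
  - by move=> w _; rewrite -EFinM -EFinD lee_fin; exact: young_expn.
have mq : measurable_fun (box n 0 1)
    (fun w : 'rV[R]_n => (p (a - s ^+ n.+1 *: w) ^+ n.+1)%:E).
  by apply/measurable_funTS; exact: (measurableT_comp mpX).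
rewrite ge0_integralD//; last 3 first.
- by move=> w _; rewrite lee_fin ltW.
- by move=> w _; rewrite -EFinM lee_fin mulr_ge0 ?exprn_ge0.
- exact: measurable_funeM.
rewrite integral_cst// [X in (_ * X + _)%E]vol_box// subr0 expr1n mule1.
rewrite ge0_integralZl//; last by move=> w _; rewrite lee_fin exprn_ge0.
apply: (@le_trans _ _ (l%:E + (l ^- n)%:E * \int[vol n]_w (p (a - s ^+ n.+1 *: w) ^+ n.+1)%:E)%E).
  rewrite leeD2l// lee_wpmul2l ?lee_fin//.
  apply: ge0_subset_integral => //; first exact: (measurableT_comp mpX).
  by move=> w _; rewrite lee_fin exprn_ge0.
rewrite (@vol_affine _ _ a (s ^+ n.+1) (fun z => (p z ^+ n.+1)%:E))//; last first.
  by move=> w; rewrite lee_fin exprn_ge0.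
apply: (@le_trans _ _ (l%:E + (l ^- n)%:E * (((s ^+ n.+1) ^- n)%:E * (mu ^+ n.+1)%:E))%E).
  rewrite leeD2l// lee_wpmul2l ?lee_fin// lee_wpmul2l// lee_fin invr_ge0 exprn_ge0//.
  exact: ltW.
rewrite -!EFinM -EFinD lee_fin le_eqVlt; apply/orP; left; apply/eqP.
rewrite /l exprMn exprVn invfM invrK -!exprM mulSn exprD exprS.
have sn : s ^+ n != 0 by rewrite lt0r_neq0// exprn_gt0.
have snn : s ^+ (n * n) != 0 by rewrite lt0r_neq0// exprn_gt0.
have mun : mu ^+ n != 0 by rewrite lt0r_neq0// exprn_gt0.
by field; rewrite sn snn mun.
Qed.

(** If the average over w of q w x is at most b x, the integral in x against the weight a
    has average at most that of a b. *)
Lemma average_tonelli d (T : measurableType d) (m : {sigma_finite_measure set T -> \bar R})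
  (a b : T -> R) (q : 'rV[R]_n * T -> R) :
  measurable_fun setT a -> measurable_fun setT b -> measurable_fun setT q ->
  (forall x, 0 <= a x) -> (forall w, 0 <= q w) ->
  (forall x, (a x)%:E * \int[vol n]_(w in box n 0 1) (q (w, x))%:E <= (a x * b x)%:E)%E ->
  (\int[vol n]_(w in box n 0 1) \int[m]_x (a x * q (w, x))%:E <= \int[m]_x (a x * b x)%:E)%E.
Proof.
move=> ma mb mq a0 q0 H; have mB := @measurable_box R n 0 1.
pose chi : 'rV[R]_n -> R := \1_(box n 0 1).
have mchi : measurable_fun setT chi by exact: measurable_indic.
have chi0 w : 0 <= chi w by rewrite /chi indicE.
pose G (p : 'rV[R]_n * T) := (chi p.1 * (a p.2 * q p))%:E.
have mG : measurable_fun setT G.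
  apply/measurable_EFinP; apply: measurable_funM.
    exact: (measurableT_comp mchi measurable_fst).
  apply: measurable_funM => //; exact: (measurableT_comp ma measurable_snd).
have G0 p : (0 <= G p)%E by rewrite lee_fin !mulr_ge0.
have mqw w : measurable_fun setT (fun x => q (w, x)) by exact: measurableT_comp.
have mqx x : measurable_fun setT (fun w => q (w, x)) by exact: measurableT_comp.
have -> : (\int[vol n]_(w in box n 0 1) \int[m]_x (a x * q (w, x))%:E =
    \int[vol n]_w \int[m]_x G (w, x))%E.
  rewrite integral_mkcond; apply: eq_integral => w _; rewrite patchE /G /= /chi indicE.
  case: (w \in _); first by apply: eq_integral => x _; rewrite mul1r.
  by rewrite integral0_eq// => x _; rewrite mul0r.
rewrite (fubini_tonelli G)//; apply: ge0_le_integral => //.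
- by move=> x _; exact: integral_ge0.
- by apply: (measurable_fun_fubini_tonelli_G G).
- by apply/measurable_EFinP; exact: measurable_funM.
- move=> x _; apply: le_trans (H x).
  have -> : (\int[vol n]_(w in box n 0 1) (q (w, x))%:E = \int[vol n]_w (chi w * q (w, x))%:E)%E.
    rewrite integral_mkcond; apply: eq_integral => w _; rewrite patchE /chi indicE.
    by case: (w \in _); rewrite ?mul1r ?mul0r.
  rewrite -ge0_integralZl//; last 3 first.
  + by apply/measurable_EFinP; exact: measurable_funM.
  + by move=> w _; rewrite lee_fin mulr_ge0.
  + by rewrite lee_fin.
  rewrite le_eqVlt; apply/orP; left; apply/eqP; apply: eq_integral => w _.
  by rewrite /G /= -EFinM mulrCA.
Qed.

Lemma measurable_average d (T : measurableType d) (m : {sigma_finite_measure set T -> \bar R})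
  (a : T -> R) (q : 'rV[R]_n * T -> R) :
  measurable_fun setT a -> measurable_fun setT q ->
  (forall x, 0 <= a x) -> (forall w, 0 <= q w) ->
  measurable_fun setT (fun w => \int[m]_x (a x * q (w, x))%:E)%E.
Proof.
move=> ma mq a0 q0.
apply: (measurable_fun_fubini_tonelli_F (fun wz => (a wz.2 * q wz)%:E)).
  apply/measurable_EFinP; apply: measurable_funM => //.
  exact: (measurableT_comp ma measurable_snd).
by move=> wz; rewrite lee_fin mulr_ge0.
Qed.

Lemma measurable_pair d (T : measurableType d) (m : {sigma_finite_measure set T -> \bar R})
  (a : 'rV[R]_n * T -> R) :
  measurable_fun setT a -> (forall x, 0 <= a x) ->
  measurable_fun setT (fun z => \int[m]_s (a (z, s))%:E)%E.
Proof.
move=> ma a0; apply: (measurable_fun_fubini_tonelli_F (EFin \o a)) => //.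
exact/measurable_EFinP.
Qed.

(** The same with an iterated integral over two measure spaces. *)
Section two.
Context d1 d2 (T1 : measurableType d1) (T2 : measurableType d2).
Variables (m1 : {sigma_finite_measure set T1 -> \bar R})
  (m2 : {sigma_finite_measure set T2 -> \bar R}).
Variables (a : T1 * T2 -> R) (q : 'rV[R]_n * (T1 * T2) -> R).
Hypotheses (ma : measurable_fun setT a) (mq : measurable_fun setT q)
  (a0 : forall x, 0 <= a x) (q0 : forall w, 0 <= q w).

Let K (p : 'rV[R]_n * T1) : \bar R :=
  (\int[m2]_s (a (p.2, s) * q (p.1, (p.2, s)))%:E)%E.

Let K0 p : (0 <= K p)%E.
Proof. by apply: integral_ge0 => s _; rewrite lee_fin mulr_ge0. Qed.

Let mK : measurable_fun setT K.
Proof.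
apply: (measurable_fun_fubini_tonelli_F (fun p : ('rV[R]_n * T1) * T2 =>
  (a (p.1.2, p.2) * q (p.1.1, (p.1.2, p.2)))%:E)); last first.
  by move=> p; rewrite lee_fin mulr_ge0.
have m12 : measurable_fun setT (fun p : ('rV[R]_n * T1) * T2 => (p.1.2, p.2)).
  apply: measurable_fun_pair => //.
  exact: (measurableT_comp measurable_snd measurable_fst).
apply/measurable_EFinP; apply: measurable_funM; first exact: (measurableT_comp ma).
apply: (measurableT_comp mq); apply: measurable_fun_pair => //.
exact: (measurableT_comp measurable_fst measurable_fst).
Qed.

Lemma measurable_average2 : measurable_fun setT
  (fun w => \int[m1]_z \int[m2]_s (a (z, s) * q (w, (z, s)))%:E)%E.
Proof. by apply: (measurable_fun_fubini_tonelli_F K). Qed.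

Lemma average_tonelli2 (b : T1 * T2 -> R) : measurable_fun setT b ->
  (forall x, 0 <= a x * b x) ->
  (forall x, (a x)%:E * \int[vol n]_(w in box n 0 1) (q (w, x))%:E <= (a x * b x)%:E)%E ->
  (\int[vol n]_(w in box n 0 1) \int[m1]_z \int[m2]_s (a (z, s) * q (w, (z, s)))%:E <=
   \int[m1]_z \int[m2]_s (a (z, s) * b (z, s))%:E)%E.
Proof.
move=> mb ab0 H; have mB := @measurable_box R n 0 1.
pose chi : 'rV[R]_n -> R := \1_(box n 0 1).
have mchi : measurable_fun setT chi by exact: measurable_indic.
have chi0 w : 0 <= chi w by rewrite /chi indicE.
pose G (p : 'rV[R]_n * T1) := ((chi p.1)%:E * K p)%E.
have mG : measurable_fun setT G.
  apply: emeasurable_funM => //.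
  by apply/measurable_EFinP; exact: (measurableT_comp mchi measurable_fst).
have G0 p : (0 <= G p)%E by rewrite mule_ge0 ?lee_fin.
have -> : (\int[vol n]_(w in box n 0 1) \int[m1]_z \int[m2]_s (a (z, s) * q (w, (z, s)))%:E =
    \int[vol n]_w \int[m1]_z G (w, z))%E.
  rewrite integral_mkcond; apply: eq_integral => w _; rewrite patchE /G /= /chi indicE.
  case: (w \in _); first by apply: eq_integral => z _; rewrite mul1e.
  by rewrite integral0_eq// => z _; rewrite mul0e.
rewrite (fubini_tonelli G)//; apply: ge0_le_integral => //.
- by move=> z _; exact: integral_ge0.
- by apply: (measurable_fun_fubini_tonelli_G G).
- apply: (measurable_fun_fubini_tonelli_F (fun x => (a x * b x)%:E)) => //.
  by apply/measurable_EFinP; exact: measurable_funM.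
- move=> z _.
  have -> : (\int[vol n]_w G (w, z) = \int[vol n]_(w in box n 0 1) K (w, z))%E.
    rewrite [RHS]integral_mkcond; apply: eq_integral => w _; rewrite patchE /G /= /chi indicE.
    by case: (w \in _); rewrite ?mul1e ?mul0e.
  have mpz : measurable_fun setT (fun ws : 'rV[R]_n * T2 => (ws.1, (z, ws.2))).
    apply: measurable_fun_pair => //; exact: measurable_fun_pair.
  have ms : measurable_fun setT (fun s : T2 => (z, s)) by exact: measurable_fun_pair.
  apply: (@average_tonelli _ _ m2 (fun s => a (z, s)) (fun s => b (z, s))
     (fun ws => q (ws.1, (z, ws.2)))) => //.
  + exact: measurableT_comp.
  + exact: measurableT_comp.
  + exact: measurableT_comp.
Qed.

End two.

End averages.

Lemma cont_sum {R : realType} {n} (I : Type) (s : seq I) (f : I -> 'rV[R]_n -> R) x :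
  (forall j, {for x, continuous (f j)}) ->
  {for x, continuous (fun y => \sum_(j <- s) f j y)}.
Proof.
move=> cf; elim: s => [|j s IH].
  rewrite (_ : (fun y => _) = fun=> 0); first exact: cst_continuous.
  by apply/funext => y; rewrite big_nil.
rewrite (_ : (fun y => _) = (fun y => f j y + \sum_(k <- s) f k y)).
  exact: contD.
by apply/funext => y; rewrite big_cons.
Qed.

Section morrey.
Context {R : realType} {n : nat}.
Local Notation leb := (@lebesgue_measure R).
Variables (i : 'I_n.+1) (u : 'rV[R]_n.+1 -> R).
Hypothesis Cu : C1on setT u.

(** Bound for the derivatives of u along the slices x_i = t and, when i is not the last
    index, for |u| / y. *)
Definition slice_grad (x : 'rV[R]_n.+1) : R := \sum_(j | j != i) grad_bound u j x.

Lemma slice_grad_ge0 x : 0 <= slice_grad x.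
Proof. by apply: sumr_ge0 => j _; exact: grad_bound_ge0. Qed.

Lemma measurable_slice_grad : measurable_fun setT slice_grad.
Proof.
rewrite [X in measurable_fun _ X](_ : _ = (fun x => \sum_j (if j != i then
   grad_bound u j x else 0))); last first.
  by apply/funext => x; rewrite /slice_grad big_mkcond.
by apply: measurable_sum => j; case: (j != i) => //; exact: measurable_grad_bound.
Qed.

Lemma ins_shift t (z w : 'rV[R]_n) (r : R) :
  ins i t (z - r *: w) = ins i t z + (- r) *: ins i 0 w.
Proof.
apply/rowP => j.
have E (A B : 'rV[R]_n.+1) : (A + (- r) *: B) 0 j = A 0 j + - r * B 0 j by rewrite !mxE.
rewrite E; case: (unliftP i j) => [k|] ->; rewrite ?ins_lift ?ins_same ?mulr0 ?addr0//.
by rewrite !mxE mulNr.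
Qed.

(** The difference of u between z and its translate by tau^(n+1) w, as an integral along
    s |-> z - s^(n+1) w.  In this parametrization the average over w of the integrand is
    bounded uniformly in s by [cube_average]. *)
Lemma morrey_path t (z w : 'rV[R]_n) (tau : R) : 0 < tau -> box n 0 1 w ->
  ((`|u (ins i t z) - u (ins i t (z - tau ^+ n.+1 *: w))|)%:E <=
   \int[leb]_(s in `]0%R, tau])
     (n.+1%:R * s ^+ n * slice_grad (ins i t (z - s ^+ n.+1 *: w)))%:E)%E.
Proof.
move=> tau0 w01; pose x := ins i t z; pose v := ins i 0 w.
pose phi (s : R) := u (x + (- s ^+ n.+1) *: v).
pose dphi (s : R) := (\sum_j v 0 j * partial j u (x + (- s ^+ n.+1) *: v)) * (- (n.+1%:R * s ^+ n)).
have Dg (s : R) : is_derive s 1 (fun r : R => - r ^+ n.+1) (- (n.+1%:R * s ^+ n)).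
  have H : is_derive s 1 (fun r : R => r ^+ n.+1) (n.+1%:R * s ^+ n).
    split; first exact: exprn_derivable.
    by rewrite exp_derive /= /GRing.scale /= mulr1.
  exact: is_deriveN.
have D (s : R) : is_derive s 1 phi (dphi s).
  apply: is_derive_path => //.
  - by move=> y j; exact: (C1on_derivable j Cu).
  - by move=> j y; exact: (C1on_partial j Cu).
have cphi : continuous phi.
  move=> s; apply: differentiable_continuous; apply/derivable1_diffP.
  exact: (@ex_derive _ _ _ _ _ _ _ (D s)).
have cpath : continuous (fun s : R => x + (- s ^+ n.+1) *: v).
  move=> s; apply: (@continuousD _ _ _ (cst x) (fun s : R => (- s ^+ n.+1) *: v)); first exact: cst_continuous.
  apply: (@continuousZr_tmp _ _ _ (fun s : R => - s ^+ n.+1)).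
  by apply: (@continuousN _ _ _ (fun s : R => s ^+ n.+1)); exact: exprn_continuous.
have cdphi : continuous dphi.
  move=> s; suff : {for s, continuous
      ((fun s => \sum_j v 0 j * partial j u (x + (- s ^+ n.+1) *: v)) \*
       (fun s => - (n.+1%:R * s ^+ n)))} by [].
  apply: continuousM.
    apply: (@continuous_comp _ _ _ (fun s : R => x + (- s ^+ n.+1) *: v)
      (fun y => \sum_j v 0 j * partial j u y)); first exact: cpath.
    apply: cont_sum => j; apply: (@contM _ _ (fun=> v 0 j)); first exact: cst_continuous.
    exact: (C1on_partial j Cu).
  apply: (@continuousN _ _ _ (fun s : R => n.+1%:R * s ^+ n)).
  apply: (@continuousM _ _ (cst n.+1%:R)); first exact: cst_continuous.
  exact: exprn_continuous.
have E : (\int[leb]_(s in `[0%R, tau]) (dphi s)%:E = (phi tau)%:E - (phi 0)%:E)%E.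
  apply: continuous_FTC2 => //; first exact: continuous_subspaceT.
    split; first by move=> s _; exact: (@ex_derive _ _ _ _ _ _ _ (D s)).
      by apply: cvg_at_right_filter; exact: cphi.
    by apply: cvg_at_left_filter; exact: cphi.
  by move=> s _; rewrite derive1E; exact: (@derive_val _ _ _ _ _ _ _ (D s)).
have phi0 : phi 0 = u x by rewrite /phi expr0n oppr0 scale0r addr0.
have phit : phi tau = u (ins i t (z - tau ^+ n.+1 *: w)) by rewrite /phi ins_shift.
have mdphi : measurable_fun setT (EFin \o dphi).
  by apply/measurable_EFinP; exact: continuous_measurable_fun.
have mR : measurable_fun setT (fun s : R =>
    (n.+1%:R * s ^+ n * slice_grad (ins i t (z - s ^+ n.+1 *: w)))%:E).
  apply/measurable_EFinP; apply: measurable_funM; first exact: measurable_funM.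
  apply: (measurableT_comp measurable_slice_grad); apply: measurable_ins => //.
  exact: (@measurable_row_affine _ _ _ _ (fun=> z) (fun=> w) (fun s : R => s ^+ n.+1)).
rewrite -phi0 -phit distrC -abse_EFin EFinB -E.
apply: (@le_trans _ _ (\int[leb]_(s in `[0%R, tau]) `|(dphi s)%:E|)%E).
  by apply: le_abse_integral => //; exact: measurable_funTS.
rewrite -integral_itv_obnd_cbnd; last first.
  by apply: measurable_funTS; exact: measurableT_comp.
apply: ge0_le_integral => //.
- by apply: measurable_funTS; exact: measurableT_comp.
- exact: measurable_funTS.
- move=> s /=; rewrite in_itv /= => /andP[s0 _]; rewrite lee_fin.
  rewrite /dphi normrM normrN normrM normr_nat normrX (gtr0_norm s0) mulrC.
  apply: ler_wpM2l; first by rewrite mulr_ge0// exprn_ge0// ltW.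
  rewrite ins_shift.
  apply: (le_trans (ler_norm_sum _ _ _)).
  rewrite (bigD1 i)//= /v ins_same mul0r normr0 add0r.
  apply: ler_sum => j ji; rewrite normrM.
  apply: (@le_trans _ _ `|partial j u (x + - s ^+ n.+1 *: v)|); last first.
    by rewrite /grad_bound lerDl; case: ifP => // _; rewrite divr_ge0.
  rewrite ler_piMl//; case: (unliftP i j) ji => [k ->|->]; last by rewrite eqxx.
  by rewrite ins_lift => _; have := w01 k; rewrite ler_norml; lra.
Qed.

End morrey.

(** * The slice estimate *)

Section slice_estimate.
Context {R : realType} {n : nat}.
Local Notation leb := (@lebesgue_measure R).
Variables (i : 'I_n.+1) (F dF : 'I_n.+1 -> 'rV[R]_n.+1 -> R).
Hypotheses (F0 : forall j (x : 'rV[R]_n.+1), x 0 ord_max <= 0 -> F j x = 0)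
  (dF0 : forall j (x : 'rV[R]_n.+1), x 0 ord_max <= 0 -> dF j x = 0)
  (mF : forall j, measurable_fun setT (F j))
  (mdF : forall j, measurable_fun setT (dF j))
  (cF : forall j (x : 'rV[R]_n.+1), 0 < x 0 ord_max -> {for x, continuous (F j)})
  (cdF : forall j (x : 'rV[R]_n.+1), 0 < x 0 ord_max -> {for x, continuous (dF j)})
  (DF : forall j (x : 'rV[R]_n.+1), 0 < x 0 ord_max -> is_derive x (delta_mx 0 j) (F j) (dF j x))
  (divF : forall x, \sum_j dF j x = 0).
Variables (u : 'rV[R]_n.+1 -> R) (c L : R).
Hypotheses (Cu : C1on setT u) (c0 : 0 < c)
  (u_supp : forall x : 'rV[R]_n.+1, u x != 0 -> halfbox L c x).
Hypothesis iF : (\int[vol n.+1]_x (weighted F i x)%:E < +oo)%E.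
Variable (t : R).
Hypothesis (tpos : i = ord_max -> 0 < t).

Let f (w : 'rV[R]_n) (z : 'rV[R]_n) := F i (ins i t z) * test_fun i u t w (ins i t z).

Let mf (w : 'rV[R]_n) : (forall k, 0 <= w 0 k) -> measurable_fun setT (f w).
Proof.
move=> w0; apply: measurable_funM.
  by apply: (measurableT_comp (mF i)); exact: measurable_ins.
apply: (@measurableT_comp _ _ _ _ _ _ (test_fun i u t w)); last exact: measurable_ins.
apply: continuous_measurable_rowT => x.
exact: (C1on_continuous (test_fun_C1 i t Cu c0 u_supp w0)).
Qed.

Let intf (w : 'rV[R]_n) W : (forall k, 0 <= w 0 k) -> (forall k, w 0 k <= W) ->
  (vol n).-integrable setT (EFin \o f w).
Proof.
move=> w0 wW; have Ct := test_fun_C1 i t Cu c0 u_supp w0.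
pose L' := `|L| + `|t| + `|t| + `|W|.
pose c' := Num.min c (if i == ord_max then t else c).
have c'0 : 0 < c' by rewrite lt_min c0 /=; case: eqP.
have S z : test_fun i u t w (ins i t z) != 0 -> halfbox L' c' (ins i t z).
  by apply: (test_fun_supp u_supp w0 tpos wW); rewrite ins_same lexx.
have cB := @halfbox_compact R n L' c'.
have [M1 M10 H1] := compact_bound_fin (I := unit) cB
  (fun j x Bx => @cF i x (lt_le_trans c'0 Bx.2)).
have [M2 M20 H2] := compact_bound_fin (I := unit) cB
  (fun j x Bx => C1on_continuous Ct (x := x) Logic.I).
apply: (@bounded_box_integrable _ _ (f w) (M1 * M2) L').
- exact: mf.
- move=> z; rewrite /f normrM.
  have [->|/S B] := eqVneq (test_fun i u t w (ins i t z)) 0.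
    by rewrite normr0 mulr0 mulr_ge0.
  by rewrite ler_pM// ?(H1 tt)// (H2 tt).
- move=> z nb; rewrite /f.
  have [->|/S [B _]] := eqVneq (test_fun i u t w (ins i t z)) 0; first by rewrite mulr0.
  by exfalso; apply: nb => k; have := B (lift i k); rewrite ins_lift ler_norml.
Qed.

Let wt (x : 'rV[R]_n.+1) := \sum_j weighted F j x.

Let wt_ge0 x : 0 <= wt x.
Proof. by apply: sumr_ge0 => j _; exact: weighted_ge0. Qed.

Let mwt : measurable_fun setT wt.
Proof. by apply: measurable_sum => j; exact: measurable_weighted. Qed.

Let p := slice_grad i u.
Let p0 x : 0 <= p x. Proof. exact: slice_grad_ge0. Qed.
Let mp : measurable_fun setT p. Proof. exact: measurable_slice_grad. Qed.

Let slice_main := (\int[vol n]_z (F i (ins i t z) * (u (ins i t z) / (ins i t z) 0 ord_max))%:E)%E.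

Let slice_main_f0 : slice_main = (\int[vol n]_z (f 0 z)%:E)%E.
Proof.
by apply: eq_integral => z _; rewrite /f /test_fun slice_map_ins subr0.
Qed.

(* Error made by the translation by w, plus the flux of the translated test function. *)
Let w_main (w : 'rV[R]_n) W : (forall k, 0 <= w 0 k) -> (forall k, w 0 k <= W) ->
  (`|slice_main| <=
   \int[vol n]_z (weighted F i (ins i t z) * `|u (ins i t z) - u (ins i t (z - w))|)%:E +
   \int[vol n.+1]_x (wt x * p (slice_map i t w x))%:E)%E.
Proof.
move=> w0 wW.
have z0 k : (0 : R) <= (0 : 'rV[R]_n) 0 k by rewrite mxE.
have z1 k : (0 : 'rV[R]_n) 0 k <= (0 : R) by rewrite mxE.
have i0 := intf z0 z1; have iw := intf w0 wW.
have f0 := integrable_fin_num measurableT i0.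
have fw := integrable_fin_num measurableT iw.
have E : (slice_main = \int[vol n]_z (f 0 z - f w z)%:E + \int[vol n]_z (f w z)%:E)%E.
  by rewrite integralB_EFin// subeK// slice_main_f0.
have mgr : measurable_fun setT (fun x => p (slice_map i t w x)).
  apply: (measurableT_comp mp); apply: continuous_measurable_map.
  exact: slice_map_continuous.
rewrite E; apply: (le_trans (lee_abs_add _ _)); apply: leeD.
  have md : measurable_fun setT (fun z => (f 0 z - f w z)%:E).
    by apply/measurable_EFinP; apply: measurable_funB; exact: mf.
  apply: (le_trans (le_abse_integral _ _ md)) => //.
  apply: ge0_le_integral => //.
  - exact: measurableT_comp.
  - apply/measurable_EFinP; apply: measurable_funM.
      apply: (measurableT_comp (measurable_weighted mF i)); exact: measurable_ins.
    apply: measurableT_comp => //.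
    have mu : measurable_fun setT u.
      by apply: continuous_measurable_rowT => x; exact: (C1on_continuous Cu).
    apply: measurable_funB; apply: (measurableT_comp mu); apply: measurable_ins => //.
    apply: measurable_rowP => k.
    rewrite (_ : (fun z => _) = (fun z : 'rV[R]_n => z 0 k - w 0 k)).
      by apply: measurable_funB => //; exact: measurable_coord.
    by apply/funext => z; rewrite !mxE.
  - move=> z _; rewrite abse_EFin lee_fin /f /test_fun !slice_map_ins !subr0.
    rewrite -mulrBr -mulrBl !normrM /weighted.
    set x := ins i t z.
    have [y0|y0] := ltP 0 (x 0 ord_max); last by rewrite F0// normr0 !mul0r.
    by rewrite normfV (gtr0_norm y0) mulrA mulrAC.
apply: (le_trans (slice_test_bound F0 dF0 mF mdF cF cdF DF divF Cu c0 u_supp iF tpos w0 wW)).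
apply: ge0_le_integral => //.
- move=> x _; rewrite lee_fin sumr_ge0// => j _.
  by rewrite mulr_ge0 ?weighted_ge0// grad_bound_ge0.
- apply/measurable_EFinP.
  rewrite [X in measurable_fun _ X](_ : _ = (fun x => \sum_j (if j != i then
     weighted F j x * grad_bound u j (slice_map i t w x) else 0))); last first.
    by apply/funext => x; rewrite big_mkcond.
  apply: measurable_sum => j; case: (j != i) => //.
  apply: measurable_funM; first exact: measurable_weighted.
  apply: (@measurableT_comp _ _ _ _ _ _ (grad_bound u j)).
    exact: measurable_grad_bound.
  by apply: continuous_measurable_map; exact: slice_map_continuous.
- by apply/measurable_EFinP; exact: measurable_funM.
- move=> x _; rewrite lee_fin /p /slice_grad mulr_sumr; apply: ler_sum => j _.
  rewrite ler_wpM2r ?grad_bound_ge0// /wt (bigD1 j)//= lerDl.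
  by apply: sumr_ge0 => k _; exact: weighted_ge0.
Qed.

(** [w_main] averaged over translations tau^(n+1) w, with w in the unit cube. *)
Lemma slice_estimate (tau mu : R) : 0 < tau -> 0 < mu ->
  (\int[vol n]_z (slice_grad i u (ins i t z) ^+ n.+1)%:E <= (mu ^+ n.+1)%:E)%E ->
  (`|\int[vol n]_z (F i (ins i t z) * (u (ins i t z) / (ins i t z) 0 ord_max))%:E| <=
   (2 * n.+1%:R * mu * tau)%:E * \int[vol n]_z (weighted F i (ins i t z))%:E +
   (2 * tau ^- n * mu)%:E * \int[vol n.+1]_x (\sum_j weighted F j x)%:E)%E.
Proof.
move=> tau0 mu0 Hmu; rewrite -/slice_main.
have mB := @measurable_box R n 0 1.
have tauN0 : 0 < tau ^+ n.+1 by rewrite exprn_gt0.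
pose slice_p z := p (ins i t z).
have msp : measurable_fun setT slice_p.
  by apply: (measurableT_comp mp); exact: measurable_ins.
have avg z s : 0 < s ->
    (\int[vol n]_(w in box n 0 1) (p (ins i t (z - s ^+ n.+1 *: w)))%:E <=
     (2 * s ^- n * mu)%:E)%E.
  by move=> s0; apply: (@cube_average _ _ slice_p) => // v; exact: p0.
pose a1 (zs : 'rV[R]_n * measurableTypeR R) : R :=
  weighted F i (ins i t zs.1) * (\1_(`]0, tau]%classic : set R) zs.2 * (n.+1%:R * `|zs.2| ^+ n)).
pose b1 (zs : 'rV[R]_n * measurableTypeR R) : R := 2 * zs.2 ^- n * mu.
pose q1 (wzs : 'rV[R]_n * ('rV[R]_n * measurableTypeR R)) : R :=
  p (ins i t (wzs.2.1 - wzs.2.2 ^+ n.+1 *: wzs.1)).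
pose q2 (wx : 'rV[R]_n * 'rV[R]_n.+1) : R := p (ins i t (del i wx.2 - tau ^+ n.+1 *: wx.1)).
have ms2 : measurable_fun setT (fun zs : 'rV[R]_n * measurableTypeR R => zs.2 : R).
  exact: measurable_snd.
have ma1 : measurable_fun setT a1.
  apply: measurable_funM.
    apply: (measurableT_comp (measurable_weighted mF i)); apply: measurable_ins => //.
  apply: measurable_funM.
    have m1 : measurable_fun setT (\1_(`]0, tau]%classic : set R) : R -> R).
      by apply: measurable_indic.
    exact: (measurableT_comp m1 ms2).
  apply: measurable_funM => //; apply: measurable_funX.
  exact: (measurableT_comp _ ms2).
have mb1 : measurable_fun setT b1.
  apply: measurable_funM => //; apply: measurable_funM => //.
  by apply: (measurableT_comp measurable_invr); apply: measurable_funX.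
have mq1 : measurable_fun setT q1.
  apply: (measurableT_comp mp); apply: measurable_ins => //.
  apply: (@measurable_row_affine _ _ _ _ (fun wzs : 'rV[R]_n * ('rV[R]_n * measurableTypeR R) => wzs.2.1)
    (fun wzs => wzs.1) (fun wzs => wzs.2.2 ^+ n.+1)) => //.
    exact: (measurableT_comp measurable_fst measurable_snd).
  - exact: measurable_fst.
  have ms22 : measurable_fun setT
      (fun wzs : 'rV[R]_n * ('rV[R]_n * measurableTypeR R) => wzs.2.2 : R).
    exact: (measurableT_comp measurable_snd measurable_snd).
  exact: (measurable_funX n.+1 ms22).
have mq2 : measurable_fun setT q2.
  apply: (measurableT_comp mp); apply: measurable_ins => //.
  apply: (@measurable_row_affine _ _ _ _ (fun wx : 'rV[R]_n * 'rV[R]_n.+1 => del i wx.2)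
    (fun wx => wx.1) (fun wx => tau ^+ n.+1)).
  - exact: (measurableT_comp (measurable_del i) measurable_snd).
  - exact: measurable_fst.
  - exact: measurable_cst.
(* E1 bounds the translation error, a1 being the weight |F_i| / y times the Jacobian of the
   path; E2 bounds the flux.  The cube averages of q1 and q2 are controlled by avg. *)
pose E1 w := (\int[vol n]_z \int[leb]_s (a1 (z, s) * q1 (w, (z, s)))%:E)%E.
pose E2 w := (\int[vol n.+1]_x (wt x * q2 (w, x))%:E)%E.
have ind0 s : 0 <= \1_(`]0, tau]%classic : set R) s :> R by rewrite indicE.
have a10 zs : 0 <= a1 zs by rewrite mulr_ge0 ?weighted_ge0// mulr_ge0// mulr_ge0// exprn_ge0.
have q10 wzs : 0 <= q1 wzs by exact: p0.
have q20 wx : 0 <= q2 wx by exact: p0.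
have mE1 : measurable_fun setT E1 by exact: (measurable_average2 (vol n) leb ma1 mq1 a10 q10).
have mE2 : measurable_fun setT E2 by exact: (measurable_average (vol n.+1) mwt mq2 wt_ge0 q20).
have E10 w : (0 <= E1 w)%E.
  apply: integral_ge0 => z _; apply: integral_ge0 => s _.
  by rewrite lee_fin mulr_ge0.
have E20 w : (0 <= E2 w)%E.
  by apply: integral_ge0 => x _; rewrite lee_fin mulr_ge0// p0.
have point w : box n 0 1 w -> (`|slice_main| <= E1 w + E2 w)%E.
  move=> w01.
  have w0 k : 0 <= (tau ^+ n.+1 *: w) 0 k.
    by rewrite mxE mulr_ge0 ?(ltW tauN0)//; have /andP[] := w01 k.
  have wW k : (tau ^+ n.+1 *: w) 0 k <= tau ^+ n.+1.
    by rewrite mxE ler_piMr ?(ltW tauN0)//; have /andP[] := w01 k.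
  apply: (le_trans (w_main w0 wW)); apply: leeD => //.
  have mq1w : measurable_fun setT (fun zs => q1 (w, zs)).
    apply: (measurableT_comp mp); apply: measurable_ins => //.
    apply: (@measurable_row_affine _ _ _ _ (fun zs : 'rV[R]_n * measurableTypeR R => zs.1)
      (fun=> w) (fun zs => zs.2 ^+ n.+1)).
    - exact: measurable_fst.
    - exact: measurable_cst.
    - exact: (measurable_funX n.+1 ms2).
  have ma1q : measurable_fun setT (fun zs => a1 zs * q1 (w, zs)) by exact: measurable_funM.
  have a1q0 zs : 0 <= a1 zs * q1 (w, zs) by rewrite mulr_ge0.
  rewrite /E1.
  apply: ge0_le_integral => //.
  - by move=> z _; rewrite lee_fin mulr_ge0// weighted_ge0.
  - apply/measurable_EFinP; apply: measurable_funM.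
      by apply: (measurableT_comp (measurable_weighted mF i)); exact: measurable_ins.
    apply: measurableT_comp => //.
    have mu' : measurable_fun setT u.
      by apply: continuous_measurable_rowT => x; exact: (C1on_continuous Cu).
    apply: measurable_funB; apply: (measurableT_comp mu'); apply: measurable_ins => //.
    exact: (@measurable_row_affine _ _ _ _ id (fun=> w) (fun=> tau ^+ n.+1)).
  - exact: (measurable_pair leb ma1q a1q0).
  - move=> z _; rewrite EFinM.
    apply: (@le_trans _ _ ((weighted F i (ins i t z))%:E * \int[leb]_(s in `]0%R, tau])
      (n.+1%:R * s ^+ n * slice_grad i u (ins i t (z - s ^+ n.+1 *: w)))%:E)%E).
      by apply: lee_wpmul2l; [rewrite lee_fin weighted_ge0|exact: morrey_path].
    have mg : measurable_fun setT (fun s : R =>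
        (n.+1%:R * s ^+ n * slice_grad i u (ins i t (z - s ^+ n.+1 *: w)))%:E).
      apply/measurable_EFinP; apply: measurable_funM; first exact: measurable_funM.
      apply: (measurableT_comp mp); apply: measurable_ins => //.
      exact: (@measurable_row_affine _ _ _ _ (fun=> z) (fun=> w) (fun s : R => s ^+ n.+1)).
    rewrite -ge0_integralZl//; last 3 first.
    + exact: measurable_funTS.
    + move=> s /=; rewrite in_itv /= => /andP[s0 _].
      by rewrite lee_fin mulr_ge0 ?slice_grad_ge0// mulr_ge0// exprn_ge0// ltW.
    + by rewrite lee_fin weighted_ge0.
    rewrite integral_mkcond le_eqVlt; apply/orP; left; apply/eqP.
    apply: eq_integral => s _; rewrite patchE /a1 /q1 /= indicE.
    case: ifPn => [|]; rewrite ?inE => Hs; last by rewrite mul0r mulr0 mul0r.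
    move: Hs => /=; rewrite in_itv /= => /andP[s0 _].
    by rewrite -EFinM mul1r (gtr0_norm s0) -!mulrA.
have S1 : (\int[vol n]_(w in box n 0 1) E1 w <=
    (2 * n.+1%:R * mu * tau)%:E * \int[vol n]_z (weighted F i (ins i t z))%:E)%E.
  have ab0 zs : 0 <= a1 zs * b1 zs.
    case: zs => z s; rewrite /a1 /b1 /= indicE.
    case: (boolP (s \in _)) => [|_]; last by rewrite mul0r mulr0 mul0r.
    rewrite inE /= in_itv /= => /andP[s0 _].
    rewrite mulr_ge0//; last by rewrite mulr_ge0 ?mulr_ge0 ?invr_ge0 ?exprn_ge0// ltW.
    rewrite mulr_ge0 ?weighted_ge0// mulr_ge0// mulr_ge0// exprn_ge0.
  apply: (le_trans (average_tonelli2 (vol n) leb ma1 mq1 a10 q10 mb1 ab0 _)).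
  - move=> [z s]; rewrite [leRHS]EFinM; have [Hs|Hs] := boolP (s \in `]0, tau]).
            apply: lee_wpmul2l; first by rewrite lee_fin.
      by apply: avg; move: Hs; rewrite in_itv /= => /andP[].
    rewrite (_ : a1 (z, s) = 0) ?mul0e// /a1 /= indicE.
    by rewrite memNset ?mul0r ?mulr0//= => Hs'; move: Hs; rewrite Hs'.
  - pose k := 2 * n.+1%:R * mu.
    have k0 : 0 <= k by rewrite !mulr_ge0// ltW.
    rewrite [leLHS](_ : _ = \int[vol n]_z ((k * tau)%:E * (weighted F i (ins i t z))%:E))%E.
      rewrite ge0_integralZl//.
      - apply/measurable_EFinP; apply: (measurableT_comp (measurable_weighted mF i)).
        exact: measurable_ins.
      - by move=> z _; rewrite lee_fin weighted_ge0.
      - by rewrite lee_fin mulr_ge0// ltW.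
    apply: eq_integral => z _.
    transitivity (\int[leb]_s ((weighted F i (ins i t z) * k)%:E *
        (\1_(`]0%R, tau]%classic : set R) s)%:E))%E.
      apply: eq_integral => s _; rewrite /a1 /b1 /= indicE -EFinM.
      case: (boolP (s \in _)) => [|_]; last by rewrite !(mul0r, mulr0).
      rewrite inE /= in_itv /= => /andP[s0 _]; congr EFin.
      rewrite (gtr0_norm s0) /k !mul1r !mulr1.
      have sn : s ^+ n != 0 by rewrite lt0r_neq0// exprn_gt0.
      by field.
    rewrite ge0_integralZl//; last 2 first.
    + by apply/measurable_EFinP; exact: measurable_indic.
    + by rewrite lee_fin mulr_ge0// weighted_ge0.
    rewrite integral_indic// setIT [X in (_ * X)%E](lebesgue_measure_itv `]0, tau]) /= lte_fin tau0.
    by rewrite sube0 -!EFinM; congr EFin; ring.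
have S2 : (\int[vol n]_(w in box n 0 1) E2 w <=
    (2 * tau ^- n * mu)%:E * \int[vol n.+1]_x (\sum_j weighted F j x)%:E)%E.
  apply: (le_trans (@average_tonelli _ _ _ _ (vol n.+1) wt (fun=> 2 * tau ^- n * mu) q2
    mwt (measurable_cst _) mq2 wt_ge0 _ _)).
  - by move=> w; exact: p0.
  - move=> x; rewrite [leRHS]EFinM; apply: lee_wpmul2l; first by rewrite lee_fin.
    rewrite /q2 /=; exact: (avg (del i x) tau tau0).
  - rewrite -ge0_integralZl//.
    + rewrite le_eqVlt; apply/orP; left; apply/eqP; apply: eq_integral => x _.
      by rewrite -EFinM mulrC.
    + exact/measurable_EFinP.
    + by move=> x _; rewrite lee_fin wt_ge0.
    + by rewrite lee_fin !mulr_ge0// ?invr_ge0 ?exprn_ge0// ltW.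
have -> : (`|slice_main| = \int[vol n]_(w in box n 0 1) cst `|slice_main| w)%E.
  by rewrite integral_cst// [X in (_ * X)%E]vol_box// subr0 expr1n mule1.
apply: (@le_trans _ _ (\int[vol n]_(w in box n 0 1) (E1 w + E2 w))%E).
  apply: ge0_le_integral => //.
  - by move=> w _; exact: abse_ge0.
  - by apply/measurable_funTS; exact: emeasurable_funD.
by rewrite ge0_integralD//; [exact: leeD|exact: measurable_funTS..].
Qed.

End slice_estimate.

(** * The estimate for one component *)

Section compact_support.
Context {R : realType} {n : nat}.
Variables (u : 'rV[R]_n.+1 -> R) (c L : R).
Hypotheses (Cu : C1on setT u) (c0 : 0 < c)
  (u_supp : forall x : 'rV[R]_n.+1, u x != 0 -> halfbox L c x).

Lemma supp_partial j (x : 'rV[R]_n.+1) : partial j u x != 0 -> halfbox L c x.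
Proof.
move=> p0; apply: contrapT => nb.
have oB := @open_halfboxC R n L c.
suff E : partial j u x = 0 by move: p0; rewrite E eqxx.
rewrite (@partial_near _ _ u (fun=> 0)).
  exact: (@derive_val _ _ _ _ _ _ _ (is_derive_cst _ _ _)).
apply: (@filterS _ _ (nbhs_filter x) (~` halfbox L c)); last exact: open_nbhs_nbhs.
by move=> y nB; apply: contrapT => /eqP/u_supp.
Qed.

Lemma supp_bound : exists2 B, 0 <= B &
  forall x, [/\ `|u x| <= B, forall j, `|partial j u x| <= B & `|u x| / `|x 0 ord_max| <= B].
Proof.
have cB := @halfbox_compact R n L c.
have [M1 M10 H1] := compact_bound_fin (I := unit) cB
  (fun j x Bx => C1on_continuous Cu (x := x) Logic.I).
have [M2 M20 H2] := compact_bound_fin cB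
  (fun j x Bx => C1on_partial j Cu (x := x) Logic.I).
exists (M1 + M2 + M1 / c); first by rewrite !addr_ge0// divr_ge0// ltW.
have M1c : 0 <= M1 / c by rewrite divr_ge0// ltW.
move=> x; split.
- have [->|/u_supp/(H1 tt) H] := eqVneq (u x) 0; first by rewrite normr0 !addr_ge0.
  by rewrite (le_trans H)// -addrA lerDl addr_ge0.
- move=> j; have [->|/supp_partial/(H2 j) H] := eqVneq (partial j u x) 0.
    by rewrite normr0 !addr_ge0.
  by rewrite (le_trans H)// (addrC M1) -addrA lerDl addr_ge0.
- have [->|/u_supp] := eqVneq (u x) 0; first by rewrite normr0 mul0r !addr_ge0.
  move=> Bx; apply: (@le_trans _ _ (M1 / c)); last by rewrite lerDr addr_ge0.
  have y0 : 0 < x 0 ord_max by apply: lt_le_trans Bx.2.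
  apply: ler_pM => //; first exact: (H1 tt).
  by rewrite lef_pV2 ?posrE ?normr_gt0 ?gt_eqF// (gtr0_norm y0); exact: Bx.2.
Qed.

Lemma measurable_C1 : measurable_fun setT u.
Proof. by apply: continuous_measurable_rowT => x; exact: (C1on_continuous Cu). Qed.

Lemma measurable_partial j : measurable_fun setT (partial j u).
Proof. by apply: continuous_measurable_rowT => x; exact: (C1on_partial j Cu). Qed.

Lemma slice_grad_supp i (x : 'rV[R]_n.+1) : slice_grad i u x != 0 -> halfbox L c x.
Proof.
move=> s0; apply: contrapT => nb; move: s0; rewrite /slice_grad big1 ?eqxx// => j _; rewrite /grad_bound.
have -> : u x = 0 by apply: contrapT => /eqP/u_supp.
have -> : partial j u x = 0 by apply: contrapT => /eqP/supp_partial.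
by rewrite normr0 mul0r if_same addr0.
Qed.

Lemma slice_grad_bound i : exists2 B, 0 <= B & forall x, slice_grad i u x <= B.
Proof.
have [B B0 H] := supp_bound; exists (\sum_(j | j != i) (B + B)).
  by apply: sumr_ge0 => j _; rewrite addr_ge0.
move=> x; have [H1 H2 H3] := H x; apply: ler_sum => j _.
by apply: lerD; [exact: H2|case: ifP].
Qed.

Lemma slice_grad_integrable i (t : R) : (vol n).-integrable setT
  (fun z => (slice_grad i u (ins i t z) ^+ n.+1)%:E).
Proof.
have [B B0 H] := slice_grad_bound i.
apply: (@bounded_box_integrable _ _ (fun z => slice_grad i u (ins i t z) ^+ n.+1) (B ^+ n.+1) L).
- apply: measurable_funX; apply: (measurableT_comp (measurable_slice_grad i Cu)).
  exact: measurable_ins.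
- move=> z; rewrite ger0_norm ?exprn_ge0 ?slice_grad_ge0//.
  by apply: lerXn2r; rewrite ?nnegrE ?slice_grad_ge0.
- move=> z nb; suff -> : slice_grad i u (ins i t z) = 0 by rewrite expr0n.
  apply: contrapT => /eqP/slice_grad_supp[H1 _]; apply: nb => k.
  by have := H1 (lift i k); rewrite ins_lift ler_norml.
Qed.

End compact_support.

Section coordinate_estimate.
Context {R : realType} {n : nat}.
Local Notation leb := (@lebesgue_measure R).
Variables (F dF : 'I_n.+1 -> 'rV[R]_n.+1 -> R).
Hypotheses (F0 : forall j (x : 'rV[R]_n.+1), x 0 ord_max <= 0 -> F j x = 0)
  (dF0 : forall j (x : 'rV[R]_n.+1), x 0 ord_max <= 0 -> dF j x = 0)
  (mF : forall j, measurable_fun setT (F j))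
  (mdF : forall j, measurable_fun setT (dF j))
  (cF : forall j (x : 'rV[R]_n.+1), 0 < x 0 ord_max -> {for x, continuous (F j)})
  (cdF : forall j (x : 'rV[R]_n.+1), 0 < x 0 ord_max -> {for x, continuous (dF j)})
  (DF : forall j (x : 'rV[R]_n.+1), 0 < x 0 ord_max -> is_derive x (delta_mx 0 j) (F j) (dF j x))
  (divF : forall x, \sum_j dF j x = 0).
Hypothesis K_fin : (\int[vol n.+1]_x (\sum_j weighted F j x)%:E < +oo)%E.
Let K := (\int[vol n.+1]_x (\sum_j weighted F j x)%:E)%E.

Let wt0 j x : 0 <= weighted F j x.
Proof. exact: weighted_ge0. Qed.

Let mw j : measurable_fun setT (weighted F j).
Proof. exact: measurable_weighted. Qed.

Lemma weighted_le_sum i : (\int[vol n.+1]_x (weighted F i x)%:E <= K)%E.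
Proof.
apply: ge0_le_integral => //.
- by move=> x _; rewrite lee_fin.
- exact/measurable_EFinP.
- by apply/measurable_EFinP; apply: measurable_sum.
- by move=> x _; rewrite lee_fin (bigD1 i)//= lerDl sumr_ge0.
Qed.

Section field.
Variables (u : 'rV[R]_n.+1 -> R) (c L : R).
Hypotheses (Cu : C1on setT u) (c0 : 0 < c)
  (u_supp : forall x : 'rV[R]_n.+1, u x != 0 -> halfbox L c x).

Lemma pairing_integrable i : (vol n.+1).-integrable setT
  (fun x => (F i x * (u x / x 0 ord_max))%:E).
Proof.
have [B B0 H] := supp_bound Cu c0 u_supp.
have mu := measurable_C1 Cu.
apply: (@le_integrable _ _ _ _ _ _ _ (fun x => (B * weighted F i x)%:E)) => //.
- apply/measurable_EFinP; apply: measurable_funM => //; apply: measurable_funM => //.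
  by apply: (measurableT_comp measurable_invr); exact: measurable_coord.
- move=> x _; rewrite !abse_EFin lee_fin (@ger0_norm _ (B * _)); last by apply: mulr_ge0.
  have [H1 _ _] := H x; have [y0|y0] := ltP 0 (x 0 ord_max).
    rewrite /weighted !normrM normfV (gtr0_norm y0) mulrCA.
    by apply: ler_wpM2r => //; rewrite divr_ge0// ltW.
  by rewrite F0// mul0r normr0 mulr_ge0.
- apply/integrableP; split; first by apply/measurable_EFinP; exact: measurable_funM.
  rewrite (eq_integral (fun x => B%:E * (weighted F i x)%:E)%E); last first.
    by move=> x _; rewrite gee0_abs ?lee_fin ?EFinM//; apply: mulr_ge0.
  rewrite ge0_integralZl//; last 2 first.
  + exact/measurable_EFinP.
  + by move=> x _; rewrite lee_fin.
  rewrite lte_mul_pinfty ?lee_fin//.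
  exact: (le_lt_trans (weighted_le_sum i)).
Qed.

(** [slice_estimate] for tau = beta / mu, so that only mu^(n+1) occurs. *)
Lemma slice_young i t (beta : R) : 0 < beta -> (i = ord_max -> 0 < t) ->
  (`|\int[vol n]_z (F i (ins i t z) * (u (ins i t z) / (ins i t z) 0 ord_max))%:E| <=
   (2 * n.+1%:R * beta)%:E * \int[vol n]_z (weighted F i (ins i t z))%:E +
   (2 * beta ^- n)%:E * K * \int[vol n]_z (slice_grad i u (ins i t z) ^+ n.+1)%:E)%E.
Proof.
move=> b0 tpos.
have iM := slice_grad_integrable Cu c0 u_supp i t.
have fM := integrable_fin_num measurableT iM.
set M := (\int[vol n]_z (slice_grad i u (ins i t z) ^+ n.+1)%:E)%E in fM *.
have M0 : (0 <= M)%E.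
  by apply: integral_ge0 => z _; rewrite lee_fin exprn_ge0// slice_grad_ge0.
have K0 : (0 <= K)%E by apply: integral_ge0 => z _; rewrite lee_fin sumr_ge0.
have fK : K \is a fin_num by rewrite ge0_fin_numE.
apply/lee_addgt0Pr => e e0.
pose k := 2 * beta ^- n * fine K.
have k0 : 0 <= k by rewrite !mulr_ge0 ?invr_ge0 ?exprn_ge0 ?fine_ge0// ltW.
(* mu must be positive, so mu^(n+1) is taken slightly larger than M. *)
pose d := e / (k + 1).
have d0 : 0 < d by rewrite divr_gt0// ltr_wpDl.
have Md0 : 0 < fine M + d by rewrite ltr_wpDl// fine_ge0.
pose mu := (fine M + d) `^ (n.+1%:R^-1).
have mu0 : 0 < mu by rewrite powR_gt0.
have muX : mu ^+ n.+1 = fine M + d.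
  by rewrite -powR_mulrn ?powR_ge0// -powRrM mulVf ?powRr1 ?pnatr_eq0// ltW.
have t0 : 0 < beta / mu by rewrite divr_gt0.
have iF : (\int[vol n.+1]_x (weighted F i x)%:E < +oo)%E.
  exact: (le_lt_trans (weighted_le_sum i)).
have Hmu : (M <= (mu ^+ n.+1)%:E)%E by rewrite muX EFinD fineK// leeDl// lee_fin ltW.
apply: (le_trans (slice_estimate F0 dF0 mF mdF cF cdF DF divF Cu c0 u_supp iF tpos t0 mu0 Hmu)).
rewrite (_ : 2 * n.+1%:R * mu * (beta / mu) = 2 * n.+1%:R * beta); last first.
  by field; rewrite lt0r_neq0.
rewrite -addeA leeD2l// -/K.
rewrite (_ : 2 * (beta / mu) ^- n * mu = 2 * beta ^- n * (fine M + d)); last first.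
  have mun : mu ^+ n != 0 by rewrite lt0r_neq0// exprn_gt0.
  have bn : beta ^+ n != 0 by rewrite lt0r_neq0// exprn_gt0.
  rewrite -muX exprS exprMn exprVn.
  by field; rewrite bn mun.
rewrite -(fineK fK) -(fineK fM) -!EFinM -EFinD lee_fin.
rewrite (_ : 2 * beta ^- n * (fine M + d) * fine K =
   2 * beta ^- n * fine K * fine M + k * d); last by rewrite /k; ring.
by rewrite lerD2l /d mulrCA ler_piMr ?(ltW e0)// ler_pdivrMr ?mul1r ?lerDl// ltr_wpDl.
Qed.

(** [slice_young] integrated over t; the slices y = t <= 0 do not contribute. *)
Lemma coordinate_estimate i (beta : R) : 0 < beta ->
  (`|\int[vol n.+1]_x (F i x * (u x / x 0 ord_max))%:E| <=
   (2 * n.+1%:R * beta)%:E * \int[vol n.+1]_x (weighted F i x)%:E +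
   (2 * beta ^- n)%:E * K * \int[vol n.+1]_x (slice_grad i u x ^+ n.+1)%:E)%E.
Proof.
move=> b0; rewrite (fubini_ins1 i); last exact: pairing_integrable.
have K0 : (0 <= K)%E by apply: integral_ge0 => z _; rewrite lee_fin sumr_ge0.
have fK : K \is a fin_num by rewrite ge0_fin_numE.
have ms := measurable_slice_grad i Cu.
have mA : measurable_fun setT (fun x => (weighted F i x)%:E) by exact/measurable_EFinP.
have mM : measurable_fun setT (fun x => (slice_grad i u x ^+ n.+1)%:E).
  by apply/measurable_EFinP; exact: measurable_funX.
have M0 x : (0 <= (slice_grad i u x ^+ n.+1)%:E)%E.
  by rewrite lee_fin exprn_ge0// slice_grad_ge0.
have A0 x : (0 <= (weighted F i x)%:E)%E by rewrite lee_fin.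
rewrite (tonelli_ins1 i mA A0) (tonelli_ins1 i mM M0).
pose A t := (\int[vol n]_z (weighted F i (ins i t z))%:E)%E.
pose M t := (\int[vol n]_z (slice_grad i u (ins i t z) ^+ n.+1)%:E)%E.
have mAt : measurable_fun setT A by exact: (measurable_tonelli_ins1 i mA A0).
have mMt : measurable_fun setT M by exact: (measurable_tonelli_ins1 i mM M0).
have At0 t : (0 <= A t)%E by exact: integral_ge0.
have Mt0 t : (0 <= M t)%E by exact: integral_ge0.
have a0 : 0 <= 2 * n.+1%:R * beta by rewrite !mulr_ge0// ltW.
have bn0 : 0 <= 2 * beta ^- n by rewrite !mulr_ge0// invr_ge0 exprn_ge0// ltW.
pose k := 2 * beta ^- n * fine K.
have k0 : 0 <= k by rewrite mulr_ge0// fine_ge0.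
have kE : ((2 * beta ^- n)%:E * K = k%:E)%E by rewrite /k [RHS]EFinM fineK.
have zl (b : R) (g : R -> \bar R) : 0 <= b -> measurable_fun setT g ->
    (forall t, (0 <= g t)%E) ->
    (b%:E * \int[leb]_t g t = \int[leb]_t (b%:E * g t))%E.
  by move=> b0' mg g0; rewrite ge0_integralZl.
rewrite kE (zl _ A)// (zl _ M)//.
rewrite -ge0_integralD//; last 4 first.
- by move=> t _; rewrite mule_ge0.
- exact: measurable_funeM.
- by move=> t _; rewrite mule_ge0.
- exact: measurable_funeM.
apply: (le_trans (le_abse_integral _ _ _)) => //.
  exact: (measurable_fubini_ins1 i (pairing_integrable i)).
apply: ge0_le_integral => //.
- apply: measurableT_comp => //.
  exact: (measurable_fubini_ins1 i (pairing_integrable i)).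
- by apply: emeasurable_funD; exact: measurable_funeM.
- move=> t _; rewrite -kE.
  have [it|/negP it] := boolP ((i == ord_max) && (t <= 0)).
    have /andP[/eqP iN t0] := it.
    rewrite (_ : integral _ _ _ = 0)%E ?abse0 ?kE ?adde_ge0 ?mule_ge0//.
    by apply: integral0_eq => z _; rewrite F0 ?mul0r// -iN ins_same.
  by apply: slice_young => // iN; rewrite ltNge; apply/negP => t0; apply: it; rewrite iN eqxx.
Qed.

End field.
End coordinate_estimate.

(** * Hardy inequality *)

Lemma is_derive_of_line {R : realType} n (f : 'rV[R]_n -> R) (x v : 'rV[R]_n) (d : R) :
  is_derive (0 : R) 1 (fun s : R => f (x + s *: v)) d -> is_derive x v f d.
Proof.
move=> [df dE]; move: df dE; rewrite /derivable /derive line_quotient scale0r addr0.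
by move=> df dE; split.
Qed.

(** Derivative of s |-> |s|^(q+2), the power being written so that it is C^1 at 0. *)
Lemma is_derive_normX {R : realType} (q : nat) (r : R) :
  is_derive r 1 (fun s : R => `|s| ^+ q * s ^+ 2) (q.+2%:R * (`|r| ^+ q * r)).
Proof.
have [->|r0] := eqVneq r 0.
  rewrite !mulr0.
  have E : (fun h : R => h^-1 *: (((fun s : R => `|s| ^+ q * s ^+ 2) \o shift 0) (h *: 1) -
     (fun s : R => `|s| ^+ q * s ^+ 2) 0)) = (fun h : R => `|h| ^+ q * h).
    apply/funext => h /=; rewrite -[h *: 1]/(h * 1) mulr1 addr0.
    rewrite -[_ *: _]/(h^-1 * _) expr0n /= mulr0 subr0.
    have [->|h0] := eqVneq h 0; first by rewrite invr0 mulr0 mul0r.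
    by rewrite mulrCA expr2 mulKf.
  have C0 : (fun h : R => `|h| ^+ q * h) h @[h --> (0 : R)] --> (0 : R).
    rewrite -[X in _ --> X](mulr0 (`|0 : R| ^+ q)).
    apply: (@cvgM _ _ _ _ (fun h : R => `|h| ^+ q) id); last exact: cvg_id.
    apply: (@continuous_comp _ _ _ (fun h : R => `|h|) (fun s => s ^+ q)).
      exact: norm_continuous.
    exact: exprn_continuous.
  have C : (fun h : R => `|h| ^+ q * h) h @[h --> (0 : R)^'] --> (0 : R).
    by apply: cvg_trans C0; apply: cvg_app; exact: cvg_within.
  split; first by rewrite /derivable E; apply: cvgP C.
  by rewrite /derive E; exact: cvg_lim C.
pose s := Num.sg r.
have N : \forall t \near r, s ^+ q * t ^+ q.+2 = `|t| ^+ q * t ^+ 2.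
  have H : \forall t \near r, 0 < s * t.
    have c : {for r, continuous (fun t : R => s * t)} by apply: mulrl_continuous.
    have sr : 0 < s * r by rewrite /s -normrEsg normr_gt0.
    have H0 : nbhs (s * r) [set y | 0 < y].
      by apply: open_nbhs_nbhs; split => //; exact: open_gt.
    exact: (c _ H0).
  apply: filterS H => t st.
  have -> : `|t| = s * t.
    by rewrite -[RHS]gtr0_norm// normrM /s normr_sg r0 mul1r.
  by rewrite exprMn -mulrA -exprD addn2.
have D : is_derive r 1 (fun t : R => s ^+ q * t ^+ q.+2) (q.+2%:R * (`|r| ^+ q * r)).
  have H : is_derive r 1 (fun t : R => t ^+ q.+2) (q.+2%:R * r ^+ q.+1).
    split; first exact: exprn_derivable.
    by rewrite exp_derive /= /GRing.scale /= mulr1.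
  rewrite normrEsg -/s exprMn -mulrA -exprSr mulrCA.
  exact: (@is_deriveZ _ _ _ _ (s ^+ q) _ _ _ H).
exact: near_eq_is_derive N D.
Qed.

Lemma contX {R : realType} n (f : 'rV[R]_n -> R) x k : {for x, continuous f} ->
  {for x, continuous (fun z => f z ^+ k)}.
Proof.
move=> cf; apply: (@continuous_comp _ _ _ f (fun s => s ^+ k)) => //.
exact: exprn_continuous.
Qed.

Lemma cont_norm {R : realType} n (f : 'rV[R]_n -> R) x : {for x, continuous f} ->
  {for x, continuous (fun z => `|f z|)}.
Proof.
move=> cf; apply: (@continuous_comp _ _ _ f (fun s => `|s|)) => //.
exact: norm_continuous.
Qed.

Lemma supp_integrable {R : realType} n (h : 'rV[R]_n.+1 -> R) (c L : R) :
  continuous h -> (forall x : 'rV[R]_n.+1, ~ halfbox L c x -> h x = 0) ->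
  (vol n.+1).-integrable setT (EFin \o h).
Proof.
move=> ch h0.
have [M M0 H] := compact_bound_fin (I := unit) (@halfbox_compact R n L c)
  (fun j x Bx => ch x).
apply: (@bounded_box_integrable _ _ h M L).
- exact: continuous_measurable_rowT.
- move=> x; have [B|/h0->] := pselect (halfbox L c x); first exact: (H tt).
  by rewrite normr0.
- move=> x nb; apply: h0 => -[H1 _]; apply: nb => k.
  by have := H1 k; rewrite ler_norml.
Qed.

Section hardy.
Context {R : realType} {n : nat}.
Variables (v : 'rV[R]_n.+1 -> R) (c L : R) (q : nat).
Hypotheses (Cv : C1on setT v) (c0 : 0 < c)
  (v_supp : forall x : 'rV[R]_n.+1, v x != 0 -> halfbox L c x).
Local Notation ht x := ((x : 'rV[R]_n.+1) 0 ord_max).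
Local Notation dv := (partial ord_max v).

(* G = |v|^p / y^(p-1) and g is its derivative in y, with p = q + 2. *)
Let G x : R := `|v x| ^+ q * v x ^+ 2 * (ht x)^-1 ^+ q.+1.
Let g x : R := q.+2%:R * (`|v x| ^+ q * v x) * dv x * (ht x)^-1 ^+ q.+1
   - q.+1%:R * (`|v x| ^+ q * v x ^+ 2) * (ht x)^-1 ^+ q.+2.

Let far (x : 'rV[R]_n.+1) : ~ halfbox L c x -> v x = 0.
Proof. by move=> nb; apply: contrapT => /eqP/v_supp. Qed.

Let near_far (x : 'rV[R]_n.+1) : ~ halfbox L c x -> \forall z \near x, v z = 0.
Proof.
move=> nb; have oB := @open_halfboxC R n L c.
apply: (@filterS _ _ (nbhs_filter x) (~` halfbox L c)); last exact: open_nbhs_nbhs.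
by move=> z; exact: far.
Qed.

Let g_far x : v x = 0 -> g x = 0.
Proof. by move=> v0; rewrite /g v0 expr0n /= !(mulr0, mul0r) subrr. Qed.

Let y_gt0 (x : 'rV[R]_n.+1) : halfbox L c x -> 0 < ht x.
Proof. by move=> [_]; exact: lt_le_trans. Qed.

Let dG x : is_derive x (delta_mx 0 ord_max) G (g x).
Proof.
have [B|nb] := pselect (halfbox L c x); last first.
  rewrite (g_far (far nb)).
  have N : \forall z \near x, (fun=> 0) z = G z.
    apply: filterS (near_far nb) => z v0.
    by rewrite /G v0 expr0n /= mulr0 mul0r.
  exact: (near_eq_is_derive N (is_derive_cst _ _ _)).
have y0 := y_gt0 B.
have yx0 : ht x != 0 by rewrite gt_eqF.
have D1 : is_derive x (delta_mx 0 ord_max) (fun z => `|v z| ^+ q * v z ^+ 2)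
    (q.+2%:R * (`|v x| ^+ q * v x) * dv x).
  apply: is_derive_of_line.
  have dvx : derivable v (x + 0 *: delta_mx 0 ord_max) (delta_mx 0 ord_max).
    by rewrite scale0r addr0; exact: (C1on_derivable _ Cv).
  have D := is_derive_line dvx.
  rewrite scale0r addr0 in D.
  have := @is_derive1_comp _ (fun s => `|s| ^+ q * s ^+ 2)
     (fun s => v (x + s *: delta_mx 0 ord_max)) 0 _ _ (is_derive_normX q _) D.
  by rewrite scale0r addr0.
have D2 : is_derive x (delta_mx 0 ord_max) (fun z => (ht z)^-1 ^+ q.+1)
    (- (q.+1%:R * (ht x)^-1 ^+ q.+2)).
  apply: is_derive_of_line.
  have D : is_derive (0 : R) 1 (fun s : R => (ht x + s)) 1.
    have := is_deriveD (is_derive_cst (ht x) (0 : R) 1) (is_derive_id (0 : R) 1).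
    by rewrite add0r.
  have y00 : ht x + 0 != 0 by rewrite addr0.
  have DV := is_deriveV y00 D.
  rewrite (_ : (fun s => _) = (fun s => (ht x + s)^-1 ^+ q.+1)); last first.
    by apply/funext => s; rewrite coord_line eqxx mulr1.
  have H : is_derive ((ht x + 0)^-1) 1 (fun t : R => t ^+ q.+1) (q.+1%:R * (ht x + 0)^-1 ^+ q).
    split; first exact: exprn_derivable.
    by rewrite exp_derive /= /GRing.scale /= mulr1.
  have := @is_derive1_comp _ (fun t : R => t ^+ q.+1) (fun s : R => (ht x + s)^-1) 0 _ _ H DV.
  rewrite addr0 => E.
  suff <- : q.+1%:R * (ht x)^-1 ^+ q * (- (ht x) ^- 2 *: 1) = - (q.+1%:R * (ht x)^-1 ^+ q.+2) by [].
  rewrite -[_ *: _]/(_ * _) mulr1 -[in RHS](addn2 q) exprD -exprVn; ring.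
have E := is_deriveM D1 D2.
suff <- : (`|v x| ^+ q * v x ^+ 2) *: (- (q.+1%:R * (ht x)^-1 ^+ q.+2)) +
    (ht x)^-1 ^+ q.+1 *: (q.+2%:R * (`|v x| ^+ q * v x) * dv x) = g x by [].
rewrite -[X in X + _]/(_ * _) -[X in _ + X]/(_ * _) /g; ring.
Qed.

Let cv : continuous v. Proof. by move=> x; exact: (C1on_continuous Cv). Qed.
Let cdv : continuous dv. Proof. by move=> x; exact: (C1on_partial _ Cv). Qed.

Let cg : continuous g.
Proof.
move=> x; have [B|nb] := pselect (halfbox L c x); last first.
  apply: (@near_continuous _ _ (fun=> 0)); last exact: cst_continuous.
  by apply: filterS (near_far nb) => z /g_far ->.
have cy k : {for x, continuous (fun z => (ht z)^-1 ^+ k)}.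
  apply: contX; apply: contV; last exact: coord_continuous.
  by rewrite gt_eqF// y_gt0.
have cc (a : R) : {for x, continuous (fun _ : 'rV[R]_n.+1 => a)} by exact: cst_continuous.
have cvx := @cv x; have cdvx := @cdv x.
have cq : {for x, continuous (fun z => `|v z| ^+ q)} by apply: contX; exact: cont_norm.
apply: contD.
  apply: contM => //; apply: contM => //; apply: contM => //; exact: contM.
apply: contN; apply: contM => //; apply: contM => //; apply: contM => //; exact: contX.
Qed.

Let cdvX : continuous (fun x => `|dv x| ^+ q.+2).
Proof. by move=> x; apply: contX; apply: cont_norm; exact: cdv. Qed.

(** Constant of the Hardy inequality of exponent k + 2. *)
Definition hardy_cst (k : nat) : R := 2 * (k.+2%:R * (2 * k.+2%:R) ^+ k.+1).

Lemma hardy_cst_ge0 k : 0 <= hardy_cst k.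
Proof. by rewrite !mulr_ge0// exprn_ge0// mulr_ge0. Qed.

(* g is a derivative, so it integrates to zero. *)
Let pointwise x : (`|v x| / `|ht x|) ^+ q.+2 <= hardy_cst q * `|dv x| ^+ q.+2 - 2 * g x.
Proof.
have [B|/far v0] := pselect (halfbox L c x); last first.
  rewrite g_far// v0 normr0 mul0r expr0n /= mulr0 subr0.
  by rewrite mulr_ge0 ?hardy_cst_ge0// exprn_ge0.
have y0 := y_gt0 B; rewrite (gtr0_norm y0).
set a := `|v x| / ht x; set b := `|dv x|.
have a0 : 0 <= a by rewrite divr_ge0// ltW.
have b0 : 0 <= b by exact: normr_ge0.
have gle : g x <= q.+2%:R * (a ^+ q.+1 * b) - q.+1%:R * a ^+ q.+2.
  rewrite /g; apply: lerB.
    apply: (le_trans (ler_norm _)).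
    rewrite !normrM normr_nat !normrX normr_id normfV (gtr0_norm y0) -/b.
    by rewrite -exprSr /a exprMn le_eqVlt; apply/orP; left; apply/eqP; ring.
  rewrite /a exprMn -(addn2 q) exprD real_normK ?num_real//.
  by rewrite le_eqVlt; apply/orP; left; apply/eqP; ring.
have H : q.+2%:R * (a ^+ q.+1 * b) <= 2^-1 * a ^+ q.+2 + q.+2%:R * (2 * q.+2%:R) ^+ q.+1 * b ^+ q.+2.
  have [ab|ab] := leP (2 * q.+2%:R * b) a.
    rewrite -[leLHS]addr0; apply: lerD; last first.
      apply: mulr_ge0; last exact: exprn_ge0.
      by apply: mulr_ge0 => //; apply: exprn_ge0; exact: mulr_ge0.
    rewrite [in leRHS]exprS -subr_ge0.
    rewrite (_ : _ - _ = a ^+ q.+1 * (2^-1 * a - q.+2%:R * b)); last by ring.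
    by apply: mulr_ge0; [exact: exprn_ge0|lra].
  rewrite -[leLHS]add0r; apply: lerD.
    by rewrite mulr_ge0 ?invr_ge0// exprn_ge0.
  rewrite -[leRHS]mulrA ler_wpM2l// (exprSr b) mulrA -exprMn ler_wpM2r//.
  by apply: lerXn2r; rewrite ?nnegrE //; [exact: mulr_ge0|exact: ltW].
have q1 : a ^+ q.+2 <= q.+1%:R * a ^+ q.+2.
  by rewrite ler_peMl ?exprn_ge0// ler1n.
rewrite /hardy_cst; lra.
Qed.

(** Hardy inequality in the last coordinate, by integrating d_N (|v|^p / y^(p-1)) and
    absorbing the mixed term pointwise. *)
Lemma hardy :
  (\int[vol n.+1]_x ((`|v x| / `|ht x|) ^+ q.+2)%:E <=
   (hardy_cst q)%:E * \int[vol n.+1]_x (`|partial ord_max v x| ^+ q.+2)%:E)%E.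
Proof.
have ig : (vol n.+1).-integrable setT (EFin \o g).
  by apply: (@supp_integrable _ _ g c L cg) => x /far/g_far.
have idv : (vol n.+1).-integrable setT (EFin \o (fun x => `|dv x| ^+ q.+2)).
  apply: (@supp_integrable _ _ (fun x => `|dv x| ^+ q.+2) c L cdvX) => x nb.
  suff -> : dv x = 0 by rewrite normr0 expr0n.
  by apply: contrapT => /eqP/(supp_partial v_supp).
have g_int0 : (\int[vol n.+1]_x (g x)%:E = 0)%E.
  apply: (@int_div0 _ _ G g ord_max (`|L| + 1)) => //.
  - by move=> z r; apply: (@continuous_comp _ _ _ (fun s => ins ord_max s z) g); [exact: continuous_ins|exact: cg].
  - move=> x xL; have v0 : v x = 0.
      by apply: far => -[/(_ ord_max) H _]; have := ler_norm L; lra.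
    by rewrite /G v0 expr0n /= mulr0 mul0r.
  - move=> x xL; apply: g_far.
    by apply: far => -[/(_ ord_max) H _]; have := ler_norm L; lra.
have mdv : measurable_fun setT (fun x => (`|dv x| ^+ q.+2)%:E).
  by apply/measurable_EFinP; exact: continuous_measurable_rowT.
have i1 : (vol n.+1).-integrable setT (fun x => (hardy_cst q * `|dv x| ^+ q.+2)%:E).
  by have := integrableZl measurableT (hardy_cst q) idv.
have i2 : (vol n.+1).-integrable setT (fun x => (2 * g x)%:E).
  by have := integrableZl measurableT 2 ig.
apply: (@le_trans _ _ (\int[vol n.+1]_x ((hardy_cst q * `|dv x| ^+ q.+2) - 2 * g x)%:E)%E).
  apply: ge0_le_integral => //.
  - apply/measurable_EFinP; apply: measurable_funX; apply: measurable_funM.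
      by apply: measurableT_comp => //; exact: (measurable_C1 Cv).
    apply: (measurableT_comp measurable_invr).
    apply: (@measurableT_comp _ _ _ _ _ _ (@Num.norm R R)) => //.
  - by apply: (measurable_int (vol n.+1)); have := integrableB measurableT i1 i2.
  - by move=> x _; rewrite lee_fin; exact: pointwise.
rewrite integralB_EFin//.
have -> : (\int[vol n.+1]_x (2 * g x)%:E = 0)%E.
  under eq_integral do rewrite EFinM.
  by rewrite integralZl// g_int0 mule0.
rewrite sube0; under eq_integral do rewrite EFinM.
rewrite ge0_integralZl//; first by rewrite lee_fin hardy_cst_ge0.
Qed.

End hardy.

(** * Covariant derivative in rescaled components *)

Lemma sum_expn_le {R : realType} m (a : 'I_m -> R) (k : nat) :
  (forall i, 0 <= a i) -> (\sum_i a i) ^+ k.+1 <= m%:R ^+ k.+1 * \sum_i a i ^+ k.+1.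
Proof.
move=> a0; case: m a a0 => [|m] a a0; first by rewrite !big_ord0 expr0n mulr0.
pose i0 := [arg max_(i > ord0) a i]%O.
have amax i : a i <= a i0.
  by rewrite /i0; case: Order.TotalTheory.arg_maxP => // j _; exact.
apply: (@le_trans _ _ ((m.+1%:R * a i0) ^+ k.+1)).
  apply: lerXn2r; rewrite ?nnegrE ?sumr_ge0 ?mulr_ge0//.
  apply: (le_trans (ler_sum _ (fun i _ => amax i))).
  by rewrite sumr_const card_ord mulr_natl.
rewrite exprMn ler_wpM2l ?exprn_ge0//.
by rewrite (bigD1 i0)//= lerDl sumr_ge0// => i _; rewrite exprn_ge0.
Qed.

Section energy.
Context {R : realType} {n : nat}.
Variables (u : 'I_n.+1 -> 'rV[R]_n.+1 -> R) (c L : R).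
Hypotheses (Cu : forall k, C1on setT (u k)) (c0 : 0 < c)
  (u_supp : forall k (x : 'rV[R]_n.+1), u k x != 0 -> halfbox L c x).
Local Notation ht x := ((x : 'rV[R]_n.+1) 0 ord_max).

(** Components of the covariant derivative of y u in the half-space metric; see
    [nabla_hyp]. *)
Definition cov (k i : 'I_n.+1) (x : 'rV[R]_n.+1) : R :=
  ht x * partial i (u k) x - (k == i)%:R * u ord_max x + (k == ord_max)%:R * u i x.

(** Norm of the covariant derivative divided by y, so that [energy ^+ n.+1] is the (n+1)-th
    power of that norm times the Riemannian density y^(-n-1). *)
Definition energy (x : 'rV[R]_n.+1) : R :=
  Num.sqrt (\sum_k \sum_i cov k i x ^+ 2) / `|ht x|.

Lemma energy_ge0 x : 0 <= energy x.
Proof. by rewrite divr_ge0// sqrtr_ge0. Qed.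

Lemma measurable_energy : measurable_fun setT energy.
Proof.
have my : measurable_fun setT (fun x : 'rV[R]_n.+1 => ht x) by exact: measurable_coord.
have mc k i : measurable_fun setT (cov k i).
  apply: measurable_funD; first apply: measurable_funB.
  - by apply: measurable_funM => //; exact: measurable_partial.
  - by apply: measurable_funM => //; exact: measurable_C1.
  - by apply: measurable_funM => //; exact: measurable_C1.
apply: measurable_funM.
  apply: (measurableT_comp (continuous_measurable_fun (@sqrt_continuous R))).
  by do 2 (apply: measurable_sum => ?); exact: measurable_funX.
apply: (measurableT_comp measurable_invr).
exact: (@measurableT_comp _ _ _ _ _ _ (@Num.norm R R)).
Qed.

Lemma cov_le k i x : ht x != 0 -> `|cov k i x| <= `|ht x| * energy x.
Proof.
move=> y0; rewrite /energy mulrC divfK ?normr_eq0//.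
rewrite -sqrtr_sqr; apply: ler_wsqrtr.
rewrite (bigD1 k)//= (bigD1 i)//= -addrA lerDl addr_ge0//.
  by apply: sumr_ge0 => j _; rewrite sqr_ge0.
by apply: sumr_ge0 => j _; apply: sumr_ge0 => l _; rewrite sqr_ge0.
Qed.

Lemma partial_le k i x : ht x != 0 ->
  `|partial i (u k) x| <= energy x + `|u ord_max x| / `|ht x| + `|u i x| / `|ht x|.
Proof.
move=> y0; have yn : 0 < `|ht x| by rewrite normr_gt0.
rewrite -(ler_pM2l yn) -normrM !mulrDr.
have E z : `|ht x| * (`|z| / `|ht x|) = `|z| by rewrite mulrCA divff ?mulr1// gt_eqF.
rewrite !E.
rewrite (_ : ht x * _ = cov k i x + (k == i)%:R * u ord_max x - (k == ord_max)%:R * u i x); last first.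
  by rewrite /cov; ring.
apply: (le_trans (ler_normB _ _)); apply: lerD.
  apply: (le_trans (ler_normD _ _)); apply: lerD; first exact: cov_le.
  by case: (k == i); rewrite ?mul1r ?mul0r ?normr0.
by case: (k == ord_max); rewrite ?mul1r ?mul0r ?normr0.
Qed.

Lemma partial_last_le k x : ht x != 0 -> `|partial ord_max (u k) x| <= energy x.
Proof.
move=> y0; have yn : 0 < `|ht x| by rewrite normr_gt0.
rewrite -(ler_pM2l yn) -normrM.
rewrite (_ : ht x * _ = cov k ord_max x); first exact: cov_le.
by rewrite /cov; ring.
Qed.

Lemma partial_far k i x : ht x <= 0 -> partial i (u k) x = 0.
Proof.
move=> y0; apply: contrapT => /eqP/(supp_partial (@u_supp k))[_ cy].
by have := lt_le_trans c0 cy; rewrite ltNge y0.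
Qed.

Lemma field_far k x : ht x <= 0 -> u k x = 0.
Proof.
move=> y0; apply: contrapT => /eqP/u_supp[_ cy].
by have := lt_le_trans c0 cy; rewrite ltNge y0.
Qed.

Let a (x : 'rV[R]_n.+1) k : R := `|u k x| / `|ht x|.

Let a0 x k : 0 <= a x k. Proof. by rewrite divr_ge0. Qed.

Lemma slice_grad_le i x :
  slice_grad i (u i) x <= n.+1%:R * (energy x + 2 * \sum_k a x k).
Proof.
have s0 : 0 <= \sum_k a x k by apply: sumr_ge0 => k _; exact: a0.
have R0 : 0 <= energy x + 2 * \sum_k a x k by rewrite addr_ge0 ?energy_ge0// mulr_ge0.
have ak k : a x k <= \sum_k a x k.
  by rewrite (bigD1 k)//= lerDl; apply: sumr_ge0 => j _; exact: a0.
have [y0|y0] := leP (ht x) 0.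
  rewrite /slice_grad big1 ?mulr_ge0// => j _.
  by rewrite /grad_bound partial_far// field_far// normr0 mul0r if_same addr0.
have yx0 : ht x != 0 by rewrite gt_eqF.
set S := energy x + _.
have -> : n.+1%:R * S = \sum_(j < n.+1) S by rewrite sumr_const card_ord mulr_natl.
rewrite /slice_grad big_mkcond.
apply: ler_sum => j _; case: (j != i) => //; rewrite /grad_bound.
have [->|jN] := eqVneq j ord_max.
  apply: lerD; first exact: partial_last_le.
  by apply: (le_trans (ak i)); rewrite ler_peMl// ler1n.
rewrite addr0; apply: (le_trans (partial_le _ _ yx0)).
rewrite -addrA lerD2l mulr_natl mulr2n; apply: lerD; exact: ak.
Qed.

(** Constant in [slice_energy].  For n = 0 the slices are points and the truncated n.-1 is
    immaterial. *)
Definition slice_cst : R :=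
  n.+1%:R ^+ n.+1 * (2 ^+ n.+1 *
    (1 + 2 ^+ n.+1 * n.+1%:R ^+ n.+1 * (n.+1%:R * hardy_cst n.-1))).

Lemma slice_cst_ge0 : 0 <= slice_cst.
Proof.
have h0 := @hardy_cst_ge0 R n.-1.
by rewrite /slice_cst !mulr_ge0 ?exprn_ge0// addr_ge0// !mulr_ge0 ?exprn_ge0.
Qed.

Let mE : measurable_fun setT (fun x => (energy x ^+ n.+1)%:E).
Proof. by apply/measurable_EFinP; apply: measurable_funX; exact: measurable_energy. Qed.

Let E0 x : (0 <= (energy x ^+ n.+1)%:E)%E.
Proof. by rewrite lee_fin exprn_ge0// energy_ge0. Qed.

Let ma k : measurable_fun setT (fun x => a x k).
Proof.
apply: measurable_funM; first by apply: measurableT_comp => //; exact: measurable_C1.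
apply: (measurableT_comp measurable_invr).
apply: (@measurableT_comp _ _ _ _ _ _ (@Num.norm R R)) => //.
Qed.

Lemma hardy_energy k : (0 < n)%N ->
  (\int[vol n.+1]_x (a x k ^+ n.+1)%:E <=
   (hardy_cst n.-1)%:E * \int[vol n.+1]_x (energy x ^+ n.+1)%:E)%E.
Proof.
move=> n0; have H := hardy n.-1 (Cu k) c0 (@u_supp k).
rewrite prednK// in H; apply: (le_trans H).
apply: lee_wpmul2l; first by rewrite lee_fin hardy_cst_ge0.
apply: ge0_le_integral => //.
- apply/measurable_EFinP; apply: measurable_funX; apply: measurableT_comp => //.
  exact: measurable_partial.
- move=> x _; rewrite lee_fin; apply: lerXn2r; rewrite ?nnegrE ?energy_ge0//.
  have [y0|y0] := leP (ht x) 0; first by rewrite partial_far// normr0 energy_ge0.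
  by apply: partial_last_le; rewrite gt_eqF.
Qed.

(** The slice derivatives exceed the covariant ones by terms |u_k| / y, which [hardy]
    absorbs.  Its exponent n + 1 is at least 2 as soon as the slices are not points. *)
Lemma slice_energy i :
  (\int[vol n.+1]_x (slice_grad i (u i) x ^+ n.+1)%:E <=
   slice_cst%:E * \int[vol n.+1]_x (energy x ^+ n.+1)%:E)%E.
Proof.
have IE0 : (0 <= \int[vol n.+1]_x (energy x ^+ n.+1)%:E)%E by exact: integral_ge0.
have [n0|n0] := posnP n.
  rewrite integral0_eq ?mule_ge0 ?lee_fin ?slice_cst_ge0// => x _.
  rewrite /slice_grad big1 ?expr0n// => j /eqP []; apply/val_inj => /=.
  have := ltn_ord j; have := ltn_ord i; lia.
pose A x := \sum_k a x k ^+ n.+1.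
have A0 x : 0 <= A x by apply: sumr_ge0 => k _; rewrite exprn_ge0.
have mA : measurable_fun setT A by apply: measurable_sum => k; exact: measurable_funX.
pose k1 : R := n.+1%:R ^+ n.+1 * 2 ^+ n.+1.
pose k2 : R := k1 * (2 ^+ n.+1 * n.+1%:R ^+ n.+1).
have k10 : 0 <= k1 by rewrite mulr_ge0 ?exprn_ge0.
have k20 : 0 <= k2 by rewrite !mulr_ge0 ?exprn_ge0.
apply: (@le_trans _ _ (\int[vol n.+1]_x (k1%:E * (energy x ^+ n.+1)%:E + k2%:E * (A x)%:E))%E).
  apply: ge0_le_integral => //.
  - by move=> x _; rewrite lee_fin exprn_ge0// slice_grad_ge0.
  - apply/measurable_EFinP; apply: measurable_funX; exact: measurable_slice_grad.
  - apply: emeasurable_funD; apply: measurable_funeM => //; exact/measurable_EFinP.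
  - move=> x _; rewrite -!EFinM -EFinD lee_fin.
    have s0 : 0 <= \sum_k a x k by apply: sumr_ge0 => k _; exact: a0.
    apply: (@le_trans _ _ ((n.+1%:R * (energy x + 2 * \sum_k a x k)) ^+ n.+1)).
      apply: lerXn2r; rewrite ?nnegrE ?slice_grad_ge0 ?slice_grad_le//.
      by rewrite !mulr_ge0// addr_ge0 ?energy_ge0// mulr_ge0.
    rewrite exprMn /k2 /k1 -!mulrA -mulrDr ler_wpM2l ?exprn_ge0//.
    have : (\sum_k a x k) ^+ n.+1 <= n.+1%:R ^+ n.+1 * A x.
      by apply: sum_expn_le; exact: a0.
    move: (\sum_k a x k) s0 => s s0 sA.
    have := @sum_expn_le R 2 (fun i => if i == 0 then energy x else 2 * s) n.
    rewrite !big_ord_recr !big_ord0 /= !add0r => H.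
    apply: (le_trans (H _)).
      by move=> j; case: ifP => _; [exact: energy_ge0|exact: mulr_ge0].
    by rewrite -mulrDr ler_wpM2l ?exprn_ge0// lerD2l exprMn ler_wpM2l ?exprn_ge0.
rewrite ge0_integralD//; last 4 first.
- by move=> x _; rewrite mule_ge0 ?lee_fin ?exprn_ge0 ?energy_ge0.
- exact: measurable_funeM.
- by move=> x _; rewrite mule_ge0 ?lee_fin.
- by apply: measurable_funeM; exact/measurable_EFinP.
rewrite !ge0_integralZl//; last 2 first.
- exact/measurable_EFinP.
- by move=> x _; rewrite lee_fin.
have -> : (\int[vol n.+1]_x (A x)%:E = \sum_k \int[vol n.+1]_x (a x k ^+ n.+1)%:E)%E.
  rewrite -ge0_integral_sum//.
  - by apply: eq_integral => x _; rewrite sumEFin.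
  - by move=> k; apply/measurable_EFinP; exact: measurable_funX.
  - by move=> k x _; rewrite lee_fin exprn_ge0.
set E := integral _ _ _.
have S : (\sum_k \int[vol n.+1]_x (a x k ^+ n.+1)%:E <= (n.+1%:R * hardy_cst n.-1)%:E * E)%E.
  apply: (le_trans (lee_sum _ (fun k _ => hardy_energy k n0))).
  rewrite -ge0_sume_distrl; last by move=> k _; rewrite lee_fin hardy_cst_ge0.
  by rewrite sumEFin sumr_const card_ord mulr_natl.
apply: (@le_trans _ _ (k1%:E * E + k2%:E * ((n.+1%:R * hardy_cst n.-1)%:E * E))%E).
  by apply: leeD2l; apply: lee_wpmul2l.
rewrite muleA -EFinM -ge0_muleDl ?lee_fin ?mulr_ge0 ?hardy_cst_ge0// -EFinD.
rewrite le_eqVlt; apply/orP; left; apply/eqP; congr (_%:E * _)%E.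
by rewrite /k2 /k1 /slice_cst; ring.
Qed.

End energy.

(** * Pairing a divergence-free field with a test field *)

Lemma mule_ord_sum {R : realType} (m : nat) (S : \bar R) :
  (m%:R%:E * S = \sum_(i < m) S)%E.
Proof.
elim: m => [|m IH]; first by rewrite big_ord0 mul0e.
by rewrite big_ord_recr /= -IH -natr1 EFinD ge0_muleDl ?lee_fin// mul1e.
Qed.

Section pairing.
Context {R : realType} {n : nat}.
Variables (u : 'I_n.+1 -> 'rV[R]_n.+1 -> R) (c L : R).
Hypotheses (Cu : forall k, C1on setT (u k)) (c0 : 0 < c)
  (u_supp : forall k (x : 'rV[R]_n.+1), u k x != 0 -> halfbox L c x).
Local Notation ht x := ((x : 'rV[R]_n.+1) 0 ord_max).
Variable F : 'I_n.+1 -> 'rV[R]_n.+1 -> R.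
Hypotheses (F0 : forall j (x : 'rV[R]_n.+1), x 0 ord_max <= 0 -> F j x = 0)
  (mF : forall j, measurable_fun setT (F j)).

Let E := (\int[vol n.+1]_x (energy u x ^+ n.+1)%:E)%E.
Let P (x : 'rV[R]_n.+1) := \sum_i F i x * (u i x / x 0 ord_max).

Let my : measurable_fun setT (fun x : 'rV[R]_n.+1 => (ht x)^-1).
Proof. by apply: (measurableT_comp measurable_invr); exact: measurable_coord. Qed.

Let mP : measurable_fun setT P.
Proof.
apply: measurable_sum => i; apply: measurable_funM => //; apply: measurable_funM => //.
exact: measurable_C1.
Qed.

Let mE : measurable_fun setT (fun x => (energy u x ^+ n.+1)%:E).
Proof. by apply/measurable_EFinP; apply: measurable_funX; exact: measurable_energy. Qed.

Let mu_y k : measurable_fun setT (fun x => `|u k x| / `|ht x|).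
Proof.
apply: measurable_funM; first by apply: measurableT_comp => //; exact: measurable_C1.
apply: (measurableT_comp measurable_invr).
apply: (@measurableT_comp _ _ _ _ _ _ (@Num.norm R R)) => //.
Qed.

Let ae_integral0 (h : 'rV[R]_n.+1 -> R) : measurable_fun setT h -> (forall x, 0 <= h x) ->
  (\int[vol n.+1]_x (h x)%:E = 0)%E -> \forall x \ae (vol n.+1), h x = 0.
Proof.
move=> mh h0 ih.
have mh' : measurable_fun setT (EFin \o h) by exact/measurable_EFinP.
have /(ae_eq_integral_abs (vol n.+1) measurableT mh') H :
    (\int[vol n.+1]_x `|(EFin \o h) x| = 0)%E.
  by rewrite -ih; apply: eq_integral => x _; rewrite gee0_abs// lee_fin.
by apply: filterS H => x /(_ Logic.I) [].
Qed.

(** If the covariant derivative vanishes almost everywhere, so does the field u, even when F is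
    not integrable. *)
Lemma pairing_zero : E = 0%E -> (\int[vol n.+1]_x (P x)%:E = 0)%E.
Proof.
move=> EE.
have e0 : \forall x \ae (vol n.+1), energy u x ^+ n.+1 = 0.
  apply: ae_integral0 => //; first exact/measurable_EFinP.
  by move=> x; rewrite exprn_ge0// energy_ge0.
have u0 k : \forall x \ae (vol n.+1), (`|u k x| / `|ht x|) ^+ 2 = 0.
  apply: ae_integral0; first exact: measurable_funX.
    by move=> x; rewrite exprn_ge0// divr_ge0.
  apply/eqP; rewrite eq_le; apply/andP; split; last first.
    by apply: integral_ge0 => x _; rewrite lee_fin exprn_ge0// divr_ge0.
  apply: (le_trans (hardy 0 (Cu k) c0 (@u_supp k))).
  rewrite (@ae_eq_integral _ _ _ (vol n.+1) setT (cst 0%E))//.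
  - by rewrite integral0 mule0.
  - apply/measurable_EFinP; apply: measurable_funX; apply: measurableT_comp => //.
    exact: measurable_partial.
  - apply: filterS e0 => x ex _ /=; congr EFin.
    have {}ex : energy u x = 0 by apply/eqP; move/eqP: ex; rewrite expf_eq0.
    have [y0|y0] := leP (ht x) 0.
      by rewrite (partial_far c0 u_supp)// normr0 expr0n.
    have := partial_last_le u k (lt0r_neq0 y0); rewrite ex normr_le0 => /eqP ->.
    by rewrite normr0 expr0n.
have u0' : \forall x \ae (vol n.+1), forall k, (`|u k x| / `|ht x|) ^+ 2 = 0.
  exact: filter_forall.
rewrite (@ae_eq_integral _ _ _ (vol n.+1) setT (cst 0%E))//; first exact: integral0.
  exact/measurable_EFinP.
apply: filterS u0' => x H _ /=; congr EFin; rewrite /P big1// => i _.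
have /eqP := H i; rewrite expf_eq0 /= -normfV -normrM normr_eq0 => /eqP ->.
by rewrite mulr0.
Qed.

Section estimate.
Variable dF : 'I_n.+1 -> 'rV[R]_n.+1 -> R.
Hypotheses (dF0 : forall j (x : 'rV[R]_n.+1), x 0 ord_max <= 0 -> dF j x = 0)
  (mdF : forall j, measurable_fun setT (dF j))
  (cF : forall j (x : 'rV[R]_n.+1), 0 < x 0 ord_max -> {for x, continuous (F j)})
  (cdF : forall j (x : 'rV[R]_n.+1), 0 < x 0 ord_max -> {for x, continuous (dF j)})
  (DF : forall j (x : 'rV[R]_n.+1), 0 < x 0 ord_max -> is_derive x (delta_mx 0 j) (F j) (dF j x))
  (divF : forall x, \sum_j dF j x = 0).
Let K := (\int[vol n.+1]_x (\sum_j weighted F j x)%:E)%E.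
Hypothesis K_fin : (K < +oo)%E.

Let K0 : (0 <= K)%E.
Proof. by apply: integral_ge0 => x _; rewrite lee_fin sumr_ge0// => j _; exact: weighted_ge0. Qed.

Let E0 : (0 <= E)%E.
Proof. by apply: integral_ge0 => x _; rewrite lee_fin exprn_ge0// energy_ge0. Qed.

Lemma pairing_young (beta : R) : 0 < beta ->
  (`|\int[vol n.+1]_x (P x)%:E| <= n.+1%:R%:E *
    ((2 * n.+1%:R * beta)%:E * K + (2 * beta ^- n)%:E * K * ((slice_cst (R := R) (n := n))%:E * E)))%E.
Proof.
move=> b0.
have -> : (\int[vol n.+1]_x (P x)%:E =
    \sum_i \int[vol n.+1]_x (F i x * (u i x / x 0 ord_max))%:E)%E.
  rewrite -(integral_sum measurableT).
    by apply: eq_integral => x _; rewrite /P sumEFin.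
  by move=> i; exact: (pairing_integrable F0 mF K_fin (Cu i) c0 (@u_supp i)).
apply: (le_trans (lee_abs_sum _ _ _)).
set S := (_ + _)%E.
have -> : (n.+1%:R%:E * S = \sum_(i < n.+1) S)%E.
  exact: mule_ord_sum.
apply: lee_sum => i _.
apply: (le_trans (coordinate_estimate F0 dF0 mF mdF cF cdF DF divF K_fin (Cu i) c0 (@u_supp i) i b0)).
apply: leeD; apply: lee_wpmul2l.
- by rewrite lee_fin !mulr_ge0// ltW.
- exact: weighted_le_sum.
- by rewrite mule_ge0// lee_fin mulr_ge0// invr_ge0 exprn_ge0// ltW.
- exact: (slice_energy Cu c0 u_supp).
Qed.

(** Constant in [pairing_le]. *)
Definition pairing_cst : R := n.+1%:R * (2 * n.+1%:R + 2 * slice_cst (R := R) (n := n)).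

Lemma pairing_cst_gt0 : 0 < pairing_cst.
Proof. by rewrite mulr_gt0// ltr_pwDl ?mulr_gt0// mulr_ge0// slice_cst_ge0. Qed.

(** [pairing_young] with beta^(n+1) equal to the energy. *)
Lemma pairing_le : (`|\int[vol n.+1]_x (P x)%:E| <=
  pairing_cst%:E * K * poweR E n.+1%:R^-1)%E.
Proof.
have [E1|E1] := eqVneq E 0%E.
  by rewrite pairing_zero// abse0 !mule_ge0 ?poweR_ge0// lee_fin ltW// pairing_cst_gt0.
have [Koo|Kn] := eqVneq K 0%E.
  have := pairing_young (@ltr01 R); rewrite Koo !(mule0, mul0e) adde0 mule0.
  by move=> H; apply: (le_trans H).
have Kp : (0 < K)%E by rewrite lt0e Kn.
have [Eoo|En] := eqVneq E +oo%E.
  by rewrite Eoo poweRyr ?invr_eq0 ?pnatr_eq0// gt0_muley ?leey// mule_gt0// lte_fin pairing_cst_gt0.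
have fE : E \is a fin_num by rewrite ge0_fin_numE// lt_neqAle En leey.
have Ep : 0 < fine E by rewrite fine_gt0// lt0e E1 E0 ltey_eq fE.
pose beta := fine E `^ n.+1%:R^-1.
have b0 : 0 < beta by rewrite powR_gt0.
have bX : beta ^+ n.+1 = fine E.
  by rewrite -powR_mulrn ?powR_ge0// -powRrM mulVf ?powRr1 ?pnatr_eq0// ltW.
apply: (le_trans (pairing_young b0)).
have fK : K \is a fin_num by rewrite ge0_fin_numE.
rewrite -(fineK fE) poweR_EFin -/beta -(fineK fK). rewrite -!EFinM lee_fin.
rewrite -bX /pairing_cst exprS.
have bn : beta ^+ n != 0 by rewrite expf_neq0// gt_eqF.
by rewrite le_eqVlt; apply/orP; left; apply/eqP; field.
Qed.

End estimate.
End pairing.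

(** * The half-space metric *)

Section half_space_metric.
Context {R : realType} {n : nat}.
Local Notation N := (@ord_max n).
Local Notation g := (@hyp_metric R n).
Local Notation ht x := ((x : 'rV[R]_n.+1) 0 ord_max).
Implicit Types (x : 'rV[R]_n.+1) (X : 'rV[R]_n.+1 -> 'rV[R]_n.+1) (i j k l : 'I_n.+1).

Lemma hyp_metricE x i j : g x i j = (i == j)%:R * ht x ^- 2.
Proof. by rewrite /hyp_metric mxE mulr_natl. Qed.

Lemma hyp_metric_inv x i j : invmx (g x) i j = (i == j)%:R * ht x ^+ 2.
Proof. by rewrite /hyp_metric invmx_scalar mxE mulr_natl invrK. Qed.

Lemma sum_delta_l k (a : 'I_n.+1 -> R) : \sum_l (k == l)%:R * a l = a k.
Proof.
rewrite (bigD1 k)//= eqxx mul1r big1 ?addr0// => l lk.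
by rewrite eq_sym (negPf lk) mul0r.
Qed.

Lemma sum_delta_lM k (b : R) (a : 'I_n.+1 -> R) : \sum_l (k == l)%:R * b * a l = b * a k.
Proof. by under eq_bigr do rewrite -mulrA; rewrite sum_delta_l. Qed.

Lemma sum_delta_r k (a : 'I_n.+1 -> R) : \sum_l (l == k)%:R * a l = a k.
Proof. by under eq_bigr do rewrite eq_sym; exact: sum_delta_l. Qed.

Lemma derivable_coord j i x : derivable (fun z : 'rV[R]_n.+1 => z 0 j) x (delta_mx 0 i).
Proof. exact: (@ex_derive _ _ _ _ _ _ _ (partial_coord j i x)). Qed.
Arguments derivable_coord : clear implicits.

Lemma partial_coordE j i x : partial i (fun z : 'rV[R]_n.+1 => z 0 j) x = (j == i)%:R.
Proof. exact: (@derive_val _ _ _ _ _ _ _ (partial_coord j i x)). Qed.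

Lemma derivable_invy i x : ht x != 0 ->
  derivable (fun z : 'rV[R]_n.+1 => (z 0 N)^-1) x (delta_mx 0 i).
Proof. by move=> y0; exact: (derivableV y0 (derivable_coord N i x)). Qed.
Arguments derivable_invy : clear implicits.

Lemma partial_invy i x : ht x != 0 ->
  partial i (fun z : 'rV[R]_n.+1 => (z 0 N)^-1) x = - (ht x) ^- 2 * (i == N)%:R.
Proof.
by move=> y0; rewrite (partialV y0 (derivable_coord N i x)) partial_coordE eq_sym.
Qed.

Lemma partial_hyp_metric i j l x : 0 < ht x ->
  partial i (fun z => g z j l) x = (j == l)%:R * (i == N)%:R * (- 2 * ht x ^- 3).
Proof.
move=> y0; have yx0 : ht x != 0 by rewrite gt_eqF.
have E : (fun z => g z j l) = (fun z => (j == l)%:R * ((ht z)^-1 * (ht z)^-1)).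
  by apply/funext => z; rewrite hyp_metricE -invfM expr2.
have dV := derivable_invy i x yx0.
rewrite E partialM; [|exact: derivable_cst|exact: derivableM].
rewrite partialM// partial_invy// [partial i (fun=> _) x]derive_cst mulr0 addr0.
by rewrite -!exprVn; ring.
Qed.

(** The Christoffel symbols of |dx|^2 / y^2. *)
Lemma christoffel_hyp k i j x : 0 < ht x -> christoffel g k i j x =
  - (ht x)^-1 * ((i == N)%:R * (j == k)%:R + (j == N)%:R * (i == k)%:R
                - (k == N)%:R * (i == j)%:R).
Proof.
move=> y0; have yx0 : ht x != 0 by rewrite gt_eqF.
rewrite /christoffel.
under eq_bigr do rewrite hyp_metric_inv !partial_hyp_metric//.
rewrite sum_delta_lM (eq_sym j k) (eq_sym i k).
by field.
Qed.

(** In terms of the rescaled components u_k = X_k / y, the covariant derivative of X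
    has components  y d_i u_k - delta_ki u_N + delta_kN u_i. *)
Lemma nabla_hyp X (u : 'I_n.+1 -> 'rV[R]_n.+1 -> R) x k i : 0 < ht x ->
  (forall j, \forall z \near x, u j z = X z 0 j / ht z) ->
  derivable (fun z => X z 0 k) x (delta_mx 0 i) ->
  nabla g X x k i = cov u k i x.
Proof.
move=> y0 Hu dX; have yx0 : ht x != 0 by rewrite gt_eqF.
have ux j : u j x = X x 0 j / ht x by exact: (nbhs_singleton (Hu j)).
rewrite /cov (partial_near _ (Hu k)) partialM//; last exact: derivable_invy.
rewrite partial_invy//.
rewrite !ux mxE.
under eq_bigr do rewrite christoffel_hyp//.
rewrite (_ : \sum_j _ = - (ht x)^-1 * ((i == N)%:R * X x 0 k + (i == k)%:R * X x 0 N
   - (k == N)%:R * X x 0 i)); last first.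
  rewrite -[X in (i == N)%:R * X](sum_delta_r k (fun j => X x 0 j)).
  rewrite -[X in (i == k)%:R * X](sum_delta_r N (fun j => X x 0 j)).
  rewrite -[X in (k == N)%:R * X](sum_delta_l i (fun j => X x 0 j)).
  rewrite !mulr_sumr -big_split -sumrB mulr_sumr; apply: eq_bigr => j _ /=.
  by ring.
by rewrite (eq_sym k i); field.
Qed.

(** The divergence is the trace of [nabla_hyp]. *)
Lemma gdiv_hyp X (u : 'I_n.+1 -> 'rV[R]_n.+1 -> R) x : 0 < ht x ->
  (forall j, \forall z \near x, u j z = X z 0 j / ht z) ->
  (forall k i, derivable (fun z => X z 0 k) x (delta_mx 0 i)) ->
  gdiv g X x = ht x * (\sum_k partial k (u k) x) - n%:R * u N x.
Proof.
move=> y0 Hu dX; rewrite /gdiv /mxtrace.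
under eq_bigr do rewrite (nabla_hyp y0 Hu)// /cov eqxx mul1r.
rewrite big_split /= sumrB -mulr_sumr sum_delta_r sumr_const card_ord -[_ *+ _]mulr_natl -natr1.
by ring.
Qed.

Lemma gnorm11_hyp x (T : 'M[R]_n.+1) : 0 < ht x ->
  gnorm11 g x T = Num.sqrt (\sum_k \sum_i T k i ^+ 2).
Proof.
move=> y0; have yx0 : ht x != 0 by rewrite gt_eqF.
congr Num.sqrt; apply: eq_bigr => k _.
transitivity (\sum_l (k == l)%:R * \sum_i \sum_j (i == j)%:R * (T k i * T l j)).
  apply: eq_bigr => l _; rewrite mulr_sumr; apply: eq_bigr => i _.
  rewrite mulr_sumr; apply: eq_bigr => j _.
  by rewrite hyp_metricE hyp_metric_inv; field.
rewrite sum_delta_l; apply: eq_bigr => i _.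
by rewrite sum_delta_l expr2.
Qed.

Lemma ginner_hyp x (a b : 'rV[R]_n.+1) :
  ginner g x a b = ht x ^- 2 * \sum_i a 0 i * b 0 i.
Proof.
rewrite /ginner mulr_sumr; apply: eq_bigr => i _.
under eq_bigr do rewrite hyp_metricE -!mulrA.
by rewrite sum_delta_l.
Qed.

Lemma gnorm_hyp_ge x (a : 'rV[R]_n.+1) j : 0 < ht x -> `|a 0 j| / ht x <= Defs.gnorm g x a.
Proof.
move=> y0; rewrite /Defs.gnorm ginner_hyp -[leLHS]ger0_norm; last by rewrite divr_ge0// ltW.
rewrite -sqrtr_sqr; apply: ler_wsqrtr.
rewrite exprMn mulrC exprVn ler_wpM2l ?invr_ge0 ?exprn_ge0 ?(ltW y0)//.
rewrite real_normK ?num_real// expr2 (bigD1 j)//= lerDl sumr_ge0// => i _.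
by rewrite -expr2 sqr_ge0.
Qed.

Lemma open_upper_half : open (@upper_half R n).
Proof.
have -> : @upper_half R n = (fun x : 'rV[R]_n.+1 => x 0 N) @^-1` [set r | 0 < r] by [].
apply: open_comp; last exact: open_gt.
by move=> x _; exact: coord_continuous.
Qed.

Lemma smooth_coord X k : smooth_on (@upper_half R n) X ->
  C1on (@upper_half R n) (fun z => X z 0 k).
Proof.
move=> sX; have [dX pX] := sX 1%N; have cX := sX 0%N.
have cc (Y : 'rV[R]_n.+1 -> 'rV[R]_n.+1) x : {for x, continuous Y} ->
    {for x, continuous (fun z => Y z 0 k)}.
  move=> cY; apply: (@continuous_comp _ _ _ Y (fun z : 'rV[R]_n.+1 => z 0 k)) => //.
  exact: coord_continuous.
split; first by move=> x Ux; apply: cc; exact: cX.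
split; first by move=> x Ux i; have /derivable_mxP := dX x Ux i; exact.
move=> i x Ux; apply: (@near_continuous _ _ (fun z => (partial i X z) 0 k)).
  have H : \forall z \near x, upper_half z.
    by apply: open_nbhs_nbhs; split => //; exact: open_upper_half.
  apply: filterS H => z Uz; rewrite /partial derive_mx; last exact: dX.
  by rewrite mxE.
by apply: cc; exact: pX.
Qed.

End half_space_metric.

(** * Extension by zero and hyperbolic integrals *)

Section extension.
Context {R : realType} {n : nat}.
Local Notation N := (@ord_max n).
Local Notation ht x := ((x : 'rV[R]_n.+1) 0 ord_max).
Local Notation U := (@upper_half R n).
Implicit Types (h : 'rV[R]_n.+1 -> R) (x : 'rV[R]_n.+1).

(** Extension by zero of a function on the half space. *)
Definition ext h x : R := if 0 < ht x then h x else 0.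

Lemma near_upper x (Q : 'rV[R]_n.+1 -> Prop) : 0 < ht x ->
  (forall z : 'rV[R]_n.+1, 0 < ht z -> Q z) -> \forall z \near x, Q z.
Proof.
move=> y0 H; apply: (@filterS _ _ (nbhs_filter x) U) => //.
by apply: open_nbhs_nbhs; split => //; exact: open_upper_half.
Qed.

Lemma extE h x : 0 < ht x -> ext h x = h x.
Proof. by rewrite /ext => ->. Qed.

Lemma ext0 h x : ht x <= 0 -> ext h x = 0.
Proof. by rewrite /ext leNgt => /negPf ->. Qed.

Lemma ext_near h x : 0 < ht x -> \forall z \near x, h z = ext h z.
Proof. by move=> y0; apply: near_upper => // z z0; rewrite extE. Qed.

Lemma measurable_ext h : (forall x, 0 < ht x -> {for x, continuous h}) ->
  measurable_fun setT (ext h).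
Proof.
move=> ch; have mU : measurable U by apply: open_measurable_row; exact: open_upper_half.
rewrite (_ : ext h = h \_ U).
  apply/(measurable_restrict _ mU measurableT); rewrite setTI.
  exact: (continuous_measurable_row open_upper_half ch).
apply/funext => x; rewrite patchE /ext; case: ifPn => [xU|].
  by rewrite mem_set.
by case: ifPn => //; rewrite inE /upper_half /= => ->.
Qed.

Lemma ext_continuous h x : 0 < ht x -> {for x, continuous h} -> {for x, continuous (ext h)}.
Proof. by move=> y0; apply: near_continuous; exact: ext_near. Qed.

Lemma C1on_invy k : C1on U (fun x : 'rV[R]_n.+1 => (x 0 N)^-1 ^+ k).
Proof.
have y0 (x : 'rV[R]_n.+1) : U x -> x 0 N != 0 by exact: lt0r_neq0.
exact: (C1onX k open_upper_half (C1onV open_upper_half y0 (C1on_coord _ N))).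
Qed.

Lemma partial_invyX i k x : 0 < ht x ->
  partial i (fun z : 'rV[R]_n.+1 => (z 0 N)^-1 ^+ k) x =
  - (k%:R * (ht x)^-1 ^+ k.+1 * (i == N)%:R).
Proof.
move=> y0; have yx0 := lt0r_neq0 y0; elim: k => [|k IH].
  by rewrite !mul0r oppr0; under eq_fun do rewrite expr0; exact: derive_cst.
under eq_fun do rewrite exprS.
rewrite partialM.
- rewrite IH partial_invy// -natr1 -exprVn ![in RHS]exprS ![in LHS]exprS expr0; ring.
- exact: derivable_invy.
- exact: (C1on_derivable i (C1on_invy k)).
Qed.

(** Only measurability is needed: both integrals are differences of integrals of nonnegative
    functions. *)
Lemma hyp_integral_vol (h : 'rV[R]_n.+1 -> R) :
  measurable_fun setT (ext (fun x => h x / ht x ^+ n.+1)) ->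
  hyp_integral h = (\int[vol n.+1]_x (ext (fun x => h x / ht x ^+ n.+1) x)%:E)%E.
Proof.
move=> mh; set k := ext _ in mh *.
have pf (G : 'rV[R]_n.+1 -> \bar R) : measurable_fun setT G -> (forall x, (0 <= G x)%E) ->
    (\int[vol n.+1]_x G x = \int[lebesgue_tuple R n.+1]_t G (row_of_tuple t))%E.
  move=> mG G0; rewrite [LHS]ge0_integral_pushforward//.
  exact: measurable_row_of_tup.
transitivity (\int[lebesgue_tuple R n.+1]_t (k (row_of_tuple t))%:E)%E.
  rewrite /hyp_integral integral_mkcond; apply: eq_integral => t _.
  rewrite patchE /k /ext; case: ifPn; first by rewrite inE /= /upper_half /= => ->.
  by move=> nU; case: ifPn => // y0; move: nU; rewrite mem_set.
have mk : measurable_fun setT (EFin \o k) by exact/measurable_EFinP.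
rewrite [LHS]integralE [RHS]integralE; congr (_ - _)%E.
- by rewrite pf//; [by apply: eq_integral => t _; rewrite !funeposE|exact: measurable_funepos].
- by rewrite pf//; [by apply: eq_integral => t _; rewrite !funenegE|exact: measurable_funeneg].
Qed.

End extension.

(** * Densities and rescaled fields *)

Section density.
Context {R : realType} {n : nat}.
Local Notation N := (@ord_max n).
Local Notation ht x := ((x : 'rV[R]_n.+1) 0 ord_max).
Local Notation U := (@upper_half R n).
Local Notation g := (@hyp_metric R n).
Variable f : 'rV[R]_n.+1 -> 'rV[R]_n.+1.
Hypotheses (sf : smooth_on U f) (divf : forall x, U x -> gdiv g f x = 0).

Let h (j : 'I_n.+1) (x : 'rV[R]_n.+1) : R := f x 0 j * (ht x)^-1 ^+ n.+1.

(** The components of f times the Riemannian density y^(-n-1), and their own partial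
    derivatives, extended by zero. *)
Definition density (j : 'I_n.+1) : 'rV[R]_n.+1 -> R := ext (h j).

Definition density_partial (j : 'I_n.+1) : 'rV[R]_n.+1 -> R := ext (partial j (h j)).

Let Ch j : C1on U (h j).
Proof. exact: (C1onM open_upper_half (smooth_coord j sf) (C1on_invy n.+1)). Qed.

Lemma density_cont j (x : 'rV[R]_n.+1) : 0 < ht x -> {for x, continuous (density j)}.
Proof. by move=> y0; apply: ext_continuous => //; exact: (C1on_continuous (Ch j)). Qed.

Lemma density_partial_cont j (x : 'rV[R]_n.+1) : 0 < ht x ->
  {for x, continuous (density_partial j)}.
Proof. by move=> y0; apply: ext_continuous => //; exact: (C1on_partial j (Ch j)). Qed.

Lemma measurable_density j : measurable_fun setT (density j).
Proof. by apply: measurable_ext => x y0; exact: (C1on_continuous (Ch j)). Qed.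

Lemma measurable_density_partial j : measurable_fun setT (density_partial j).
Proof. by apply: measurable_ext => x y0; exact: (C1on_partial j (Ch j)). Qed.

Lemma density_derive j (x : 'rV[R]_n.+1) : 0 < ht x ->
  is_derive x (delta_mx 0 j) (density j) (density_partial j x).
Proof.
move=> y0; rewrite /density_partial extE//.
have D : is_derive x (delta_mx 0 j) (h j) (partial j (h j) x).
  by split => //; exact: (C1on_derivable j (Ch j)).
exact: (near_eq_is_derive (ext_near (h j) y0) D).
Qed.

(** The hyperbolic divergence of f is, up to the factor y^(n+1), the Euclidean divergence
    of the densities. *)
Lemma density_div x : \sum_j density_partial j x = 0.
Proof.
have [y0|y0] := leP (ht x) 0; first by apply: big1 => j _; exact: ext0.
have yx0 := lt0r_neq0 y0.
pose w j (z : 'rV[R]_n.+1) := f z 0 j / ht z.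
have df k i : derivable (fun z => f z 0 k) x (delta_mx 0 i).
  exact: (C1on_derivable i (smooth_coord k sf)).
have dw k i : derivable (w k) x (delta_mx 0 i).
  by apply: derivableM => //; exact: derivable_invy.
have hw j : h j = (fun z => w j z * (ht z)^-1 ^+ n).
  by apply/funext => z; rewrite /h /w exprS mulrA.
have ph j : partial j (h j) x = (ht x)^-1 ^+ n * partial j (w j) x -
    (j == N)%:R * (n%:R * (ht x)^-1 ^+ n.+1 * w j x).
  rewrite hw partialM//; last exact: (C1on_derivable j (C1on_invy n)).
  by rewrite partial_invyX//; ring.
have Hw j : \forall z \near x, w j z = f z 0 j / ht z by exact: near_upper.
have dv := divf y0; rewrite (gdiv_hyp y0 Hw df) in dv.
under eq_bigr do rewrite /density_partial extE// ph.
rewrite sumrB -mulr_sumr sum_delta_r.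
have -> : (ht x)^-1 ^+ n * \sum_i partial i (w i) x - n%:R * (ht x)^-1 ^+ n.+1 * w N x =
    (ht x)^-1 ^+ n.+1 * (ht x * \sum_i partial i (w i) x - n%:R * w N x).
  rewrite mulrBr exprS; congr (_ - _); last by ring.
  by rewrite (mulrC (ht x)^-1) -mulrA mulKf.
by rewrite dv mulr0.
Qed.

(** Each component of f is at most y times the norm of f. *)
Lemma weighted_density_le (L1 := hyp_L1norm f) :
  (\int[vol n.+1]_x (\sum_j weighted density j x)%:E <= n.+1%:R%:E * L1)%E.
Proof.
rewrite /L1 /hyp_L1norm.
pose G (x : 'rV[R]_n.+1) := Defs.gnorm g x (f x) / ht x ^+ n.+1.
have cG (x : 'rV[R]_n.+1) : 0 < ht x -> {for x, continuous G}.
  move=> y0; apply: (@near_continuous _ _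
      (fun z => Num.sqrt ((ht z)^-1 ^+ 2 * \sum_i f z 0 i * f z 0 i) * (ht z)^-1 ^+ n.+1)).
    by apply: near_upper => // z _; rewrite /G /Defs.gnorm ginner_hyp !exprVn.
  have ci k : {for x, continuous (fun z : 'rV[R]_n.+1 => (ht z)^-1 ^+ k)}.
    exact: (C1on_continuous (C1on_invy k)).
  apply: contM => //.
  apply: (@continuous_comp _ _ _ (fun z => (ht z)^-1 ^+ 2 * \sum_i f z 0 i * f z 0 i) Num.sqrt).
    apply: contM => //; apply: cont_sum => i.
    by apply: contM; exact: (C1on_continuous (smooth_coord i sf)).
  exact: sqrt_continuous.
have mG : measurable_fun setT (ext G) by exact: measurable_ext.
rewrite hyp_integral_vol// -/G mule_ord_sum.
rewrite -[leRHS]mule_ord_sum -ge0_integralZl//; last 2 first.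
- exact/measurable_EFinP.
- move=> x _; rewrite lee_fin /ext; case: ifPn => // y0.
  by rewrite /G divr_ge0 ?sqrtr_ge0// exprn_ge0// ltW.
apply: ge0_le_integral => //.
- by move=> x _; rewrite lee_fin sumr_ge0// => j _; apply: weighted_ge0 => k z; exact: ext0.
- by apply/measurable_EFinP; apply: measurable_sum => j; apply: measurable_weighted => k;
    exact: measurable_density.
- by apply: measurable_funeM; exact/measurable_EFinP.
move=> x _; rewrite -EFinM lee_fin.
have -> : n.+1%:R * ext G x = \sum_(j < n.+1) ext G x by rewrite sumr_const card_ord mulr_natl.
apply: ler_sum => j _; rewrite /weighted.
have [y0|y0] := leP (ht x) 0; first by rewrite /density !ext0// normr0 mul0r.
rewrite /density !extE// /h /G normrM mulrAC exprVn normfV (@gtr0_norm _ (_ ^+ _)) ?exprn_gt0//.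
by rewrite ler_wpM2r ?invr_ge0 ?exprn_ge0 ?(ltW y0)// gnorm_hyp_ge.
Qed.

End density.

Section rescaled.
Context {R : realType} {n : nat}.
Local Notation N := (@ord_max n).
Local Notation ht x := ((x : 'rV[R]_n.+1) 0 ord_max).
Local Notation U := (@upper_half R n).
Local Notation g := (@hyp_metric R n).
Variable phi : 'rV[R]_n.+1 -> 'rV[R]_n.+1.
Hypotheses (sphi : smooth_on U phi) (cphi : compactly_supported phi).

Let v (k : 'I_n.+1) (x : 'rV[R]_n.+1) : R := phi x 0 k / ht x.

(** The components of phi divided by y, that is, in the orthonormal frame y d_k, extended by
    zero. *)
Definition rescaled (k : 'I_n.+1) : 'rV[R]_n.+1 -> R := ext (v k).

Lemma rescaled_supp : exists L, exists2 c, 0 < c &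
  forall k (x : 'rV[R]_n.+1), rescaled k x != 0 -> halfbox L c x.
Proof.
pose S := U `&` closure (U `&` [set x | phi x != 0]).
have [L L0 HL] := compact_bound_fin (f := fun (i : 'I_n.+1) (x : 'rV[R]_n.+1) => x 0 i) cphi
  (fun i x _ => @coord_continuous _ _ _ _ _ _).
have [M M0 HM] := compact_bound_fin (I := unit)
  (f := fun _ (x : 'rV[R]_n.+1) => (ht x)^-1 ^+ 1) cphi
  (fun _ x Sx => C1on_continuous (C1on_invy 1) Sx.1).
exists L, (M + 1)^-1; first by rewrite invr_gt0 ltr_wpDl.
move=> k x; rewrite /rescaled /ext; case: ifPn; last by rewrite eqxx.
move=> y0 vx; have Sx : S x.
  split => //; apply: subset_closure; split => //=; apply: contraNneq vx => px.
  by rewrite /v px mxE mul0r.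
split; first by move=> j; exact: HL.
have := HM tt x Sx; rewrite expr1 gtr0_norm ?invr_gt0// => yM.
rewrite invf_ple ?posrE ?ltr_wpDl//.
by apply: (le_trans yM); rewrite lerDl.
Qed.

Let Cv k : C1on U (v k).
Proof.
have := C1onM open_upper_half (smooth_coord k sphi) (C1on_invy 1).
by apply: C1on_eq; [exact: open_upper_half|move=> x _; rewrite expr1].
Qed.

Lemma rescaled_C1 k : C1on setT (rescaled k).
Proof.
have [L [c c0 S]] := rescaled_supp.
apply: (@C1on_sub _ _ _ (U `|` ~` halfbox L c)).
  move=> x _; have [B|] := pselect (halfbox L c x); last by right.
  by left; exact: (lt_le_trans c0 B.2).
apply: C1onU.
  apply: (C1on_eq open_upper_half _ (Cv k)) => x Ux.
  by rewrite /rescaled extE.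
have oB := @open_halfboxC R n L c.
apply: (C1on_eq oB _ (C1on_cst _ 0)) => x nb.
by apply/esym; apply: contrapT => /eqP/S.
Qed.

Lemma cov_far k i (x : 'rV[R]_n.+1) : ht x <= 0 -> cov rescaled k i x = 0.
Proof.
move=> y0; have [L [c c0 S]] := rescaled_supp.
by rewrite /cov (partial_far c0 S)// !(field_far c0 S)// !mulr0 subrr addr0.
Qed.

Lemma energy_nabla (x : 'rV[R]_n.+1) : energy rescaled x ^+ n.+1 =
  ext (fun z => gnorm11 g z (nabla g phi z) ^+ n.+1 / ht z ^+ n.+1) x.
Proof.
have [y0|y0] := leP (ht x) 0.
  rewrite ext0// /energy big1 ?sqrtr0 ?mul0r ?expr0n// => k _.
  by apply: big1 => i _; rewrite cov_far// expr0n.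
rewrite extE// gnorm11_hyp// /energy exprMn exprVn (gtr0_norm y0); congr (Num.sqrt _ ^+ _ / _).
apply: eq_bigr => k _; apply: eq_bigr => i _; congr (_ ^+ _).
apply/esym; apply: nabla_hyp => //.
- by move=> j; apply: near_upper => // z z0; rewrite /rescaled extE.
- exact: (C1on_derivable i (smooth_coord k sphi)).
Qed.

Lemma Lnorm_energy :
  hyp_Lnorm_nabla phi = poweR (\int[vol n.+1]_x (energy rescaled x ^+ n.+1)%:E)%E n.+1%:R^-1.
Proof.
rewrite /hyp_Lnorm_nabla hyp_integral_vol.
  by congr (poweR _ _); apply: eq_integral => x _; rewrite energy_nabla.
rewrite (_ : ext _ = (fun x => energy rescaled x ^+ n.+1)); last first.
  by apply/funext => x; rewrite energy_nabla.
apply: measurable_funX; apply: measurable_energy => k; exact: rescaled_C1.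
Qed.

End rescaled.

Lemma pairing_vol {R : realType} {n : nat} (f phi : 'rV[R]_n.+1 -> 'rV[R]_n.+1) :
  smooth_on (@upper_half R n) f -> smooth_on (@upper_half R n) phi ->
  compactly_supported phi ->
  hyp_integral (fun x => ginner (@hyp_metric R n) x (f x) (phi x)) =
  (\int[vol n.+1]_x (\sum_i density f i x * (rescaled phi i x / x 0 ord_max))%:E)%E.
Proof.
move=> sf sphi cphi.
have E (x : 'rV[R]_n.+1) :
    ext (fun z => ginner (@hyp_metric R n) z (f z) (phi z) / z 0 ord_max ^+ n.+1) x =
    \sum_i density f i x * (rescaled phi i x / x 0 ord_max).
  have [y0|y0] := leP (x 0 ord_max) 0.
    by rewrite ext0// big1// => i _; rewrite /density ext0// mul0r.
  rewrite extE// ginner_hyp mulr_sumr mulr_suml; apply: eq_bigr => i _.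
  rewrite /density /rescaled !extE// exprVn.
  by field; rewrite ?expf_neq0// lt0r_neq0.
rewrite hyp_integral_vol; first by apply: eq_integral => x _; rewrite E.
rewrite (_ : ext _ = (fun x => \sum_i density f i x * (rescaled phi i x / x 0 ord_max))); last first.
  by apply/funext => x; exact: E.
apply: measurable_sum => i; apply: measurable_funM; first exact: measurable_density.
apply: measurable_funM; first by apply: measurable_C1; exact: rescaled_C1.
by apply: (measurableT_comp measurable_invr); exact: measurable_coord.
Qed.

Theorem theorem2 (R : realType) (n : nat) :
  exists C : R,
    forall f phi : 'rV[R]_n.+1 -> 'rV[R]_n.+1,
      smooth_on (@upper_half R n) f ->
      (forall x, upper_half x -> gdiv (@hyp_metric R n) f x = 0) ->
      smooth_on (@upper_half R n) phi ->
      compactly_supported phi ->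
      (`| hyp_integral (fun x => ginner (@hyp_metric R n) x (f x) (phi x)) |
         <= C%:E * hyp_L1norm f * hyp_Lnorm_nabla phi)%E.
Proof.
exists (pairing_cst (R := R) (n := n) * n.+1%:R) => f phi sf divf sphi cphi.
have [L [c c0 S]] := rescaled_supp cphi.
have Cu k := rescaled_C1 sphi cphi k.
have mF j := measurable_density sf j.
have F0 j (x : 'rV[R]_n.+1) : x 0 ord_max <= 0 -> density f j x = 0 by exact: ext0.
rewrite pairing_vol// Lnorm_energy//.
set E := (\int[vol n.+1]_x (energy (rescaled phi) x ^+ n.+1)%:E)%E.
have C0 := @pairing_cst_gt0 R n.
have L10 : (0 <= hyp_L1norm f)%E.
  apply: integral_ge0 => t y0; rewrite lee_fin divr_ge0 ?sqrtr_ge0// exprn_ge0// ltW//.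
have E0 : (0 <= E)%E.
  by apply: integral_ge0 => x _; rewrite lee_fin exprn_ge0// energy_ge0.
have [Ez|Ez] := eqVneq E 0%E.
  rewrite (pairing_zero Cu c0 S mF Ez) abse0 !mule_ge0 ?poweR_ge0//.
  by rewrite lee_fin mulr_ge0// ltW.
have Ep : (0 < poweR E n.+1%:R^-1)%E by rewrite poweR_gt0// lt0e Ez.
have [Loo|Ln] := eqVneq (hyp_L1norm f) +oo%E.
  by rewrite Loo gt0_muley ?gt0_mulye ?leey// lte_fin mulr_gt0.
have Lfin : (hyp_L1norm f < +oo)%E by rewrite lt_neqAle Ln leey.
have KL := weighted_density_le sf.
have Kfin : (\int[vol n.+1]_x (\sum_j weighted (density f) j x)%:E < +oo)%E.
  by apply: (le_lt_trans KL); rewrite lte_mul_pinfty ?lee_fin.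
have dF0 j (x : 'rV[R]_n.+1) : x 0 ord_max <= 0 -> density_partial f j x = 0 by exact: ext0.
apply: (le_trans (pairing_le Cu c0 S F0 mF dF0 (measurable_density_partial sf)
  (density_cont sf) (density_partial_cont sf) (density_derive sf) (density_div sf divf) Kfin)).
apply: lee_wpmul2r; first exact: poweR_ge0.
by rewrite [(_ * _%:R)%:E]EFinM -[leRHS]muleA; apply: lee_wpmul2l => //; rewrite lee_fin ltW.
Qed.
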